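(* Let $m\ge 3$, let $\mathcal{C}=\mathcal{C}(m,1)$ be the bordered algebra over $\mathbb{F}=\mathbb{Z}/2\mathbb{Z}$, and let $\{\mu^{0}_n\}_{n\ge1}$ be the weight-zero operations on $\mathcal{C}[t]$ defined in the context. Then the operations $\{\mu^{0}_n\}$ give $\mathcal{C}[t]$ the structure of a unital $A_\infty$ algebra.
   Context: **Algebra.** Fix $m\ge 3$. Let $Q$ be the quiver with vertices $[1],\dots,[m-1]$ and edges $L_i\colon[i]\to[i-1]$, $R_i\colon[i-1]\to[i]$ for $2\le i\le m-1$, $U_1\colon[1]\to[1]$ and $U_m\colon[m-1]\to[m-1]$. $\mathcal{C}=\mathcal{C}(m,1)$ is the path algebra of $Q$ over $\mathbb{F}=\mathbb{Z}/2\mathbb{Z}$ (products are read left to right as concatenation of paths) modulo the relations $L_iL_{i-1}=0$, $R_{i-1}R_i=0$ for $3\le i\le m-1$, and $L_2U_1=U_1R_2=R_{m-1}U_m=U_mL_{m-1}=0$. $\mathbf{I}_{[x]}$ is the idempotent (constant path) at $[x]$; $\mathcal{I}=\mathcal{I}(m,1)$ is the subring spanned by the $\mathbf{I}_{[x]}$; $1=\sum_x\mathbf{I}_{[x]}$. An element represented by a (nonzero) non-constant path is called a pure algebra element; $\mathcal{C}_+$ is the span of the pure elements. Tensor products are over $\mathcal{I}$. $\mathcal{C}[t]$ is graded by $\mathrm{gr}$, with $\mathrm{gr}(\mathcal{C})=0$, $\mathrm{gr}(t)=2m-4$. **Tiling graphs of weight zero.** A planar rooted graph is a finite graph $\Gamma$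 embedded in the closed disk $\mathbb{D}$, such that $\Gamma\cap\partial\mathbb{D}$ is the set of leaves of $\Gamma$, one of which is distinguished and called the root. A compatibly decorated graph is a planar rooted graph, with at least one internal vertex, all of whose internal vertices have degree $2m-2$, with every edge oriented and labeled by an integer in $\{1,\dots,m-1\}$, such that around each internal vertex $m-1$ consecutive edge-ends are incoming and labeled $1,\dots,m-1$ in counterclockwise order, and the other $m-1$ consecutive edge-ends are outgoing and labeled $1,\dots,m-1$ in clockwise order. The $2m-2$ sectors at each internal vertex are labeled: $L_i$ is the sector between the outgoing edges $i-1$ and $i$; $R_i$ the sector between the incoming edges $i-1$ and $i$ ($2\le i\le m-1$); $U_1$ the sector between incoming edge $1$ and outgoing edge $1$; $U_m$ the sector between incoming edge $m-1$ and outgoing edge $m-1$. The weight-zero centered tiling graphs are exactly the compatibly decorated graphs that are trees. Graphs are considered up to orientation-preserving isotopy of $\mathbb{D}$. For such a tree $\Gamma$: $d(\Gamma)$ is the number of internal vertices; $\iota(\Gamma)=\mathbf{I}_{[k]}$, where $k$ is the label of the edge at the root. The leaves divide $\partial\mathbb{D}$ into intervals $I_1,\dots,I_n$, ordered counterclockwise starting at the root. The algebra element $a(I_j)$ is the product of the labels of the sectors in the component of $\mathbb{D}\setminus\Gamma$ meeting $I_j$, in the order in which they are met when running along the part of $\Gamma$ bounding that component from the starting point to the end point of $I_j$ ($I_j$ being oriented counterclockwise). Put $\vec a(\Gamma)=(a(I_1),\dots,a(I_n))$. **Operations.** For pure $a_1,\dots,a_n$ let $c^{0}_n(a_1,\dots,a_n)=\sum_{\Gamma:\,\vec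 a(\Gamma)=(a_1,\dots,a_n)}\iota(\Gamma)\,t^{d(\Gamma)}$ (sum over weight-zero centered tiling graphs), extended linearly to $\mathcal{C}_+^{\otimes n}\to\mathcal{I}[t]$. The operation $\mu^0_2$ is multiplication on $\mathcal{C}[t]$. For $n\ne2$ and pure $a_1,\dots,a_n$, $$\mu^{0}_n(a_1,\dots,a_n)=c^{0}_n(a_1,\dots,a_n)+\sum_{a_1=a\cdot a_1'}a\cdot c^{0}_n(a_1',a_2,\dots,a_n)+\sum_{a_n=a_n'\cdot a}c^{0}_n(a_1,\dots,a_{n-1},a_n')\cdot a,$$ where the sums run over factorizations into pure elements. The operations are extended $t$-equivariantly to $\mathcal{C}[t]$, with $\mu^0_n(a_1,\dots,a_n)=0$ if some $a_i$ is an idempotent and $n\ne2$. **$A_\infty$ algebras (characteristic 2).** The $A_\infty$ structure is over the ground ring $\mathcal{I}$: the maps $\mu_n\colon A^{\otimes n}\to A$, $n\ge1$, are bimodule maps of degree $n-2$ satisfying, for all $n\ge1$ and all $a_1,\dots,a_n$, $$\sum_{1\le i<j\le n+1}\mu_{n-j+i+1}(a_1,\dots,a_{i-1},\mu_{j-i}(a_i,\dots,a_{j-1}),a_j,\dots,a_n)=0.$$ Unital means $\mu_2(a,1)=\mu_2(1,a)=a$ for all $a$, and $\mu_n(a_1,\dots,a_n)=0$ whenever $n\ne2$ and some $a_i=1$. *)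

(* Defs.v *)
From HB Require Import structures.
From mathcomp Require Import all_boot all_order all_algebra.
From mathcomp Require Import finmap.
From mathcomp Require Import boolp classical_sets functions cardinality fsbigop.
From mathcomp Require Import monalg.
From mathcomp Require Import zify.

Set Implicit Arguments.
Unset Strict Implicit.
Unset Printing Implicit Defensive.

Import GRing.Theory.
Local Open Scope ring_scope.

(* The vertices are the naturals x with 1 <= x <= m - 1. *)
Inductive arrow := aL of nat | aR of nat | aU1 | aUm.

Definition arrow_code (a : arrow) : (nat + nat) + bool :=
  match a with
  | aL i => inl (inl i) | aR i => inl (inr i)
  | aU1 => inr true | aUm => inr false
  end.
Definition arrow_decode (c : (nat + nat) + bool) : arrow :=
  match c with
  | inl (inl i) => aL i | inl (inr i) => aR i
  | inr b => if b then aU1 else aUm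
  end.
Lemma arrow_codeK : cancel arrow_code arrow_decode.
Proof. by case. Qed.
HB.instance Definition _ := Equality.copy arrow (can_type arrow_codeK).
HB.instance Definition _ := Choice.copy arrow (can_type arrow_codeK).

Section Quiver.
Variable m : nat.

Definition is_vertex (x : nat) : bool := (1 <= x <= m.-1)%N.

Definition is_arrow (a : arrow) : bool :=
  match a with aL i | aR i => (2 <= i <= m.-1)%N | aU1 | aUm => true end.

Definition src (a : arrow) : nat :=
  match a with aL i => i | aR i => i.-1 | aU1 => 1 | aUm => m.-1 end%N.
Definition tgt (a : arrow) : nat :=
  match a with aL i => i.-1 | aR i => i | aU1 => 1 | aUm => m.-1 end%N.

(* zero_rel a b means that the length-two path "a then b" is one of the
   defining relations of the algebra. *)
Definition zero_rel (a b : arrow) : bool :=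
  match a, b with
  | aL i, aL j => (3 <= i <= m.-1)%N && (j == i.-1)
  | aR j, aR i => (3 <= i <= m.-1)%N && (j == i.-1)
  | aL i, aU1 => i == 2%N
  | aU1, aR i => i == 2%N
  | aR i, aUm => i == m.-1
  | aUm, aL i => i == m.-1
  | _, _ => false
  end.

(* A path is a pair (starting vertex, list of arrows). *)
Fixpoint composable (x : nat) (s : seq arrow) : bool :=
  if s is a :: s' then [&& is_arrow a, src a == x & composable (tgt a) s']
  else true.

Definition path_end (p : nat * seq arrow) : nat := last p.1 (map tgt p.2).

(* Paths of the quiver without two consecutive arrows related by f. *)
Definition is_rpath (f : rel arrow) (p : nat * seq arrow) : bool :=
  [&& is_vertex p.1, composable p.1 p.2 & sorted (fun a b => ~~ f a b) p.2].

End Quiver.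

Record rpath (m : nat) (f : rel arrow) :=
  RPath { path_of : nat * seq arrow; rpathP : is_rpath m f path_of }.
HB.instance Definition _ m f := [isSub for @path_of m f].
HB.instance Definition _ m f := [Choice of rpath m f by <:].

(* The F_2-algebra with basis the paths avoiding f, two paths being multiplied
   by concatenation, or to 0 if they do not concatenate to such a path. It is
   the path algebra itself if f is empty, and its quotient by the ideal
   generated by the paths "a then b", f a b, in general; C_presentation below
   proves this for f = zero_rel m.
   The proof of 3 <= m makes the ring nontrivial. *)
Definition palg (m : nat) (hm : (3 <= m)%N) (f : rel arrow) : Type :=
  {malg 'F_2[rpath m f]}.

Section PathAlgebra.
Variables (m : nat) (hm : (3 <= m)%N) (f : rel arrow).
Local Notation K := (rpath m f).
Local Notation A := (palg hm f).

HB.instance Definition _ := GRing.Lmodule.on A.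
HB.instance Definition _ := Choice.on A.

Definition bas (w : K) : A := << w >>.

(* The class of an arbitrary pair (vertex, arrows), which is 0 if the pair is
   not a path avoiding f. *)
Definition cls (p : nat * seq arrow) : A :=
  if insub p is Some w then bas w else 0.

Definition idem (x : nat) : A := cls (x, [::]).
Definition arr (a : arrow) : A := cls (src m a, [:: a]).

Definition cat_rpath (p q : K) : A :=
  if path_end m (val p) == (val q).1
  then cls ((val p).1, (val p).2 ++ (val q).2) else 0.

Definition lext (V : lmodType 'F_2) (F : K -> V) (g : A) : V :=
  \sum_(w <- msupp (g : {malg 'F_2[K]})) (g : {malg 'F_2[K]})@_w *: F w.

Definition palg_mul (g h : A) : A :=
  lext (fun p => lext (fun q => cat_rpath p q) h) g.
Definition palg_one : A := \sum_(1 <= x < m) idem x.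

Lemma lextE (V : lmodType 'F_2) (F : K -> V) (g : {malg 'F_2[K]}) (d : {fset K}) :
  (msupp g `<=` d)%fset -> lext F g = \sum_(w <- d) g@_w *: F w.
Proof.
move=> sub; rewrite /lext; apply: big_fset_incl => // w _ /mcoeff_outdom ->.
by rewrite scale0r.
Qed.

Lemma lext_linear (V : lmodType 'F_2) (F : K -> V) : linear (lext F : A -> V).
Proof.
move=> c g h; pose d := (msupp (g : {malg 'F_2[K]}) `|` msupp (h : {malg 'F_2[K]}))%fset.
have sg : (msupp (g : {malg 'F_2[K]}) `<=` d)%fset by apply: fsubsetUl.
have sh : (msupp (h : {malg 'F_2[K]}) `<=` d)%fset by apply: fsubsetUr.
have sgh : (msupp (c *: g + h : {malg 'F_2[K]}) `<=` d)%fset.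
  apply: fsubset_trans (msuppD_le _ _) _; rewrite fsubUset sh andbT.
  exact: fsubset_trans (msuppZ_le _ _) sg.
rewrite (lextE F sg) (lextE F sh) (lextE F sgh) scaler_sumr -big_split /=.
apply: eq_bigr => w _.
by rewrite mcoeffD mcoeffZ scalerDl scalerA.
Qed.
HB.instance Definition _ (V : lmodType 'F_2) (F : K -> V) :=
  GRing.isLinear.Build 'F_2 A V *:%R (lext F) (lext_linear F).

Lemma lext_bas (V : lmodType 'F_2) (F : K -> V) w : lext F (bas w) = F w.
Proof.
rewrite (@lextE _ _ _ [fset w]%fset) ?msuppU_le // big_seq_fset1.
by rewrite mcoeffUU scale1r.
Qed.

Lemma coef_bas w k : (bas w : {malg 'F_2[K]})@_k = (w == k)%:R.
Proof. exact: mcoeffU. Qed.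

Lemma coef_scale (c : 'F_2) (g : A) k :
  (c *: g : {malg 'F_2[K]})@_k = c * (g : {malg 'F_2[K]})@_k.
Proof. exact: mcoeffZ. Qed.

Lemma basE (g : A) :
  g = \sum_(w <- msupp (g : {malg 'F_2[K]})) (g : {malg 'F_2[K]})@_w *: bas w.
Proof.
rewrite {1}(monalgE g); apply: eq_bigr => w _.
apply/malgP => k; apply: (etrans (mcoeffU _ _ _)); apply: esym.
apply: (etrans (coef_scale _ _ _)).
by rewrite [X in _ * X]mcoeffU mulrnAr mulr1.
Qed.

Lemma lin_eq (V : lmodType 'F_2) (F G : {linear A -> V}) :
  (forall w, F (bas w) = G (bas w)) -> F =1 G.
Proof.
move=> FG g; rewrite (basE g) !linear_sum; apply: eq_bigr => w _.
by rewrite !linearZ /= FG.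
Qed.

Lemma lext_fun_linear (V : lmodType 'F_2) (F : K -> A -> V) (g : A) :
  (forall w, linear (F w)) -> linear (fun h => lext (fun w => F w h) g).
Proof.
move=> linF c h k; rewrite /lext scaler_sumr -big_split /=.
by apply: eq_bigr => w _; rewrite linF scalerDr !scalerA [c * _]mulrC.
Qed.

Definition palg_mulr (h g : A) : A := palg_mul g h.

Lemma palg_mulr_linear h : linear (palg_mulr h).
Proof. exact: lext_linear. Qed.
Lemma palg_mul_linear g : linear (palg_mul g).
Proof. by apply: lext_fun_linear => w; exact: lext_linear. Qed.
HB.instance Definition _ h :=
  GRing.isLinear.Build 'F_2 A A *:%R (palg_mulr h) (palg_mulr_linear h).
HB.instance Definition _ g :=
  GRing.isLinear.Build 'F_2 A A *:%R (palg_mul g) (palg_mul_linear g).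

Lemma palg_mul0l h : palg_mul 0 h = 0.
Proof. exact: (linear0 (palg_mulr h)). Qed.
Lemma palg_mul0r g : palg_mul g 0 = 0.
Proof. exact: (linear0 (palg_mul g)). Qed.

Lemma palg_mul_bas p q : palg_mul (bas p) (bas q) = cat_rpath p q.
Proof. by rewrite /palg_mul !lext_bas. Qed.

Lemma cls_val (w : K) : cls (val w) = bas w.
Proof. by rewrite /cls valK. Qed.

Lemma cls0 p : ~~ is_rpath m f p -> cls p = 0.
Proof. by move=> np; rewrite /cls insubN. Qed.

Lemma clsP p : is_rpath m f p -> exists2 w : K, val w = p & cls p = bas w.
Proof. by move=> pp; exists (Sub p pp); rewrite ?SubK // -cls_val SubK. Qed.

Lemma is_vertex_tgt a : is_arrow m a -> is_vertex m (tgt m a).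
Proof.
by case: a => [i|i||] /=; rewrite /is_vertex; move: hm; case: m => [|[|[|n]]] //=; lia.
Qed.

Lemma is_vertex_path_end x s :
  is_vertex m x -> composable m x s -> is_vertex m (path_end m (x, s)).
Proof.
elim: s x => [|a s IHs] x //= _ /and3P[aa _ cs].
by apply: IHs cs; exact: is_vertex_tgt.
Qed.

Lemma composable_cat x s t :
  composable m x (s ++ t) =
  composable m x s && composable m (path_end m (x, s)) t.
Proof. by elim: s x => [|a s IHs] x //=; rewrite IHs !andbA. Qed.

Lemma path_end_cat x s t :
  path_end m (x, s ++ t) = path_end m (path_end m (x, s), t).
Proof. by rewrite /path_end /= map_cat last_cat. Qed.

Lemma is_rpath_cat x s t : is_rpath m f (x, s ++ t) ->
  is_rpath m f (x, s) /\ is_rpath m f (path_end m (x, s), t).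
Proof.
case/and3P=> /= vx; rewrite composable_cat => /andP[cs ct] st.
split; apply/and3P; split=> //=.
- by case/cat_sorted2: st.
- exact: is_vertex_path_end.
- by case/cat_sorted2: st.
Qed.

Lemma palg_mul_cls p q :
  palg_mul (cls p) (cls q) =
  if path_end m p == q.1 then cls (p.1, p.2 ++ q.2) else 0.
Proof.
case: p q => [x s] [y t] /=.
have [ps|nps] := boolP (is_rpath m f (x, s)); last first.
  rewrite (cls0 nps) palg_mul0l; case: eqP => // _.
  by rewrite cls0 //; apply: contra nps => /is_rpath_cat[].
have [qt|nqt] := boolP (is_rpath m f (y, t)); last first.
  rewrite (cls0 nqt) palg_mul0r; case: eqP => // eqy.
  by rewrite cls0 //; apply: contra nqt => /is_rpath_cat[_]; rewrite eqy.
have [u eu ->] := clsP ps; have [v ev ->] := clsP qt.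
by rewrite palg_mul_bas /cat_rpath eu ev.
Qed.

Lemma palg_mulA : associative palg_mul.
Proof.
have E3 p q r : palg_mul (bas p) (palg_mul (bas q) (bas r)) =
                palg_mul (palg_mul (bas p) (bas q)) (bas r).
  rewrite -!cls_val; case: p q r => [[x s] ?] [[y t] ?] [[z u] ?] /=.
  rewrite !palg_mul_cls /=; case: ifP => e1; case: ifP => e2.
  - rewrite !palg_mul_cls /= e2 path_end_cat (eqP e2) e1 catA //.
  - by rewrite palg_mul_cls e2 palg_mul0l.
  - by rewrite palg_mul0r palg_mul_cls /= path_end_cat (eqP e2) e1.
  - by rewrite palg_mul0l palg_mul0r.
move=> g h k.
apply: (lin_eq (F := palg_mulr (palg_mul h k))
               (G := palg_mulr k \o palg_mulr h)) => p /=; rewrite /palg_mulr.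
apply: (lin_eq (F := palg_mul (bas p) \o palg_mulr k)
               (G := palg_mulr k \o palg_mul (bas p))) => q /=; rewrite /palg_mulr.
apply: (lin_eq (F := palg_mul (bas p) \o palg_mul (bas q))
               (G := palg_mul (palg_mul (bas p) (bas q)))) => r /=.
exact: E3.
Qed.

Lemma big_vertex (V : zmodType) (x : nat) (F : nat -> V) : is_vertex m x ->
  (forall y, y != x -> F y = 0) -> \sum_(1 <= y < m) F y = F x.
Proof.
move=> vx F0; rewrite (bigD1_seq x) ?iota_uniq //=; last first.
  by rewrite mem_index_iota; move: vx hm; rewrite /is_vertex; case: m => //=; lia.
by rewrite big1 ?addr0 // => y; exact: F0.
Qed.

Lemma palg_mul1 : left_id palg_one palg_mul.
Proof.
move=> g; apply: (lin_eq (F := palg_mul palg_one) (G := idfun)) => w /=.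
rewrite -/(palg_mulr _ _) linear_sum /= -cls_val /palg_mulr.
case: w => [[x s] /= px]; rewrite (big_vertex (x := x)).
- by rewrite palg_mul_cls /= eqxx.
- by case/and3P: px.
- by move=> y /negPf ne; rewrite palg_mul_cls /= ne.
Qed.

Lemma palg_mulr1 : right_id palg_one palg_mul.
Proof.
move=> g; apply: (lin_eq (F := palg_mulr palg_one) (G := idfun)) => w /=.
rewrite /palg_mulr linear_sum /= -cls_val.
case: w => [[x s] /= px]; rewrite (big_vertex (x := path_end m (x, s))).
- by rewrite palg_mul_cls /= eqxx cats0.
- by case/and3P: px => /= *; exact: is_vertex_path_end.
- by move=> y /negPf ne; rewrite palg_mul_cls /= eq_sym ne.
Qed.

Lemma palg_mulDl : left_distributive palg_mul +%R.
Proof. by move=> g h k; rewrite -!/(palg_mulr k _) linearD. Qed.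
Lemma palg_mulDr : right_distributive palg_mul +%R.
Proof. by move=> g h k; rewrite linearD. Qed.

Lemma bas_neq0 w : bas w != 0 :> A.
Proof. by rewrite /bas monalgU_eq0 oner_eq0. Qed.

Lemma palg_one_neq0 : palg_one != 0.
Proof.
have p1 : is_rpath m f (1%N, [::]).
  by rewrite /is_rpath /= /is_vertex; move: hm; case: m => //=; lia.
have [w _ ew] := clsP p1; apply: contraNneq (bas_neq0 w) => e.
by rewrite -[bas w]palg_mul1 e palg_mul0l.
Qed.

HB.instance Definition _ := GRing.Zmodule_isNzRing.Build A
  palg_mulA palg_mul1 palg_mulr1 palg_mulDl palg_mulDr palg_one_neq0.

Lemma mul_cls p q : cls p * cls q =
  if path_end m p == q.1 then cls (p.1, p.2 ++ q.2) else 0.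
Proof. exact: palg_mul_cls. Qed.

Lemma bas_inj : injective bas.
Proof.
move=> u v uv; have := coef_bas u v; rewrite uv (coef_bas v v) eqxx.
by case: eqP => // _ /eqP; rewrite oner_eq0.
Qed.

Lemma cls_bas p w : cls p = bas w -> p = val w.
Proof.
have [/clsP[u <- ->] /bas_inj ->//|/cls0-> /esym/eqP] := boolP (is_rpath m f p).
by rewrite (negPf (bas_neq0 w)).
Qed.

End PathAlgebra.

Notation bordered m hm := (@palg m hm (zero_rel m)).
Notation path_algebra m hm := (@palg m hm (fun _ _ => false)).

(* The two-sided ideal generated by S. *)
Inductive ideal_gen (A : pzRingType) (S : A -> Prop) : A -> Prop :=
| ideal_gen0 : ideal_gen S 0
| ideal_gen_mem x : S x -> ideal_gen S x
| ideal_genD x y : ideal_gen S x -> ideal_gen S y -> ideal_gen S (x + y)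
| ideal_genMl a x : ideal_gen S x -> ideal_gen S (a * x)
| ideal_genMr a x : ideal_gen S x -> ideal_gen S (x * a).

Section Presentation.
Variables (m : nat) (hm : (3 <= m)%N).

Definition quo_map : path_algebra m hm -> bordered m hm :=
  lext (fun w : rpath m (fun _ _ => false) => cls hm (zero_rel m) (val w)).
HB.instance Definition _ := GRing.Linear.on quo_map.

Let noneP x s : is_rpath m (zero_rel m) (x, s) -> is_rpath m (fun _ _ => false) (x, s).
Proof.
case/and3P => vx cx _; apply/and3P; split=> //=.
by case: s {vx cx} => //= a s; elim: s a => //= b s IHs a; exact: IHs.
Qed.

Lemma quo_map_cls p : quo_map (cls hm _ p) = cls hm _ p.
Proof.
case: p => x s; have [/clsP-/(_ hm)[w <- ->]|np] := boolP (is_rpath m (fun _ _ => false) (x, s)).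
  exact: lext_bas.
by rewrite (cls0 _ np) linear0 cls0 //; apply: contra np; exact: noneP.
Qed.

Lemma quo_map_monoid : monoid_morphism quo_map.
Proof.
split=> [|g h].
  by rewrite [1 in LHS]/(1%R) linear_sum; apply: eq_bigr => x _; exact: quo_map_cls.
apply: (lin_eq (F := quo_map \o @palg_mulr _ hm _ h)
               (G := @palg_mulr _ hm _ (quo_map h) \o quo_map)) => p /=.
rewrite /palg_mulr.
apply: (lin_eq (F := quo_map \o @palg_mul _ hm _ (bas hm p))
               (G := @palg_mul _ hm _ (quo_map (bas hm p)) \o quo_map)) => q /=.
rewrite -!cls_val !quo_map_cls !palg_mul_cls.
by case: eqP => _; rewrite ?linear0 ?quo_map_cls.
Qed.
HB.instance Definition _ :=
  GRing.isMonoidMorphism.Build (path_algebra m hm) (bordered m hm) quo_map quo_map_monoid.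

Theorem C_presentation :
  [/\ forall x, quo_map (idem hm _ x) = idem hm _ x,
      forall a, quo_map (arr hm _ a) = arr hm _ a,
      forall y, exists x, quo_map x = y
    & forall x, quo_map x = 0 <->
        ideal_gen (fun r => exists a b : arrow,
          zero_rel m a b /\ r = arr hm _ a * arr hm _ b) x].
Proof.
split=> [x|a|y|x].
- exact: quo_map_cls.
- exact: quo_map_cls.
- exists (lext (fun w : rpath m (zero_rel m) => cls hm (fun _ _ => false) (val w)) y).
  apply: (lin_eq (F := quo_map \o lext (fun w : rpath m (zero_rel m) => cls hm _ (val w)))
    (G := idfun)) => w /=.
  by rewrite lext_bas quo_map_cls cls_val.
split; last first.
  elim=> [|_ [a [b [ab ->]]]|u v _ eu _ ev|u v _ ev|u v _ ev].
  - exact: linear0.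
  - rewrite rmorphM /= !quo_map_cls mul_cls /=; case: eqP => // _.
    by rewrite cls0 // /is_rpath /= ab !andbF.
  - by rewrite linearD /= eu ev addr0.
  - by rewrite rmorphM /= ev mulr0.
  - by rewrite rmorphM /= ev mul0r.
move=> x0; rewrite (basE x).
set S := (X in ideal_gen X _).
have idZ (c : 'F_2) y : ideal_gen S y -> ideal_gen S (c *: y).
  have [->|->] : c = 0 \/ c = 1 by case: c => -[|[|//]] ?; [left|right]; apply/val_inj.
  - by rewrite scale0r => _; constructor.
  - by rewrite scale1r.
rewrite big_seq; elim/big_ind: _ => [||w wx]; first by constructor.
  by move=> *; constructor.
apply: idZ; have [rw|nrw] := boolP (is_rpath m (zero_rel m) (val w)).
  exfalso; have [u eu eb] := clsP hm rw.
  have : (quo_map x : {malg 'F_2[rpath m (zero_rel m)]})@_u =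
         (x : {malg 'F_2[rpath m _]})@_w.
    rewrite /quo_map /lext raddf_sum (bigD1_seq w) ?fset_uniq //=.
    rewrite big1 ?addr0 => [|v nvw]; apply: etrans (coef_scale _ _ _) _.
      by rewrite eb (coef_bas hm u u) eqxx mulr1.
    rewrite /cls; case: insubP => [t _ et|_]; last by rewrite mcoeff0 mulr0.
    rewrite (coef_bas hm t u); case: eqP => [etu|]; last by rewrite mulr0.
    by case/negP: nvw; apply/eqP/val_inj;
      exact: (etrans (esym et) (etrans (congr1 val etu) eu)).
  rewrite x0 mcoeff0 => /esym/eqP; rewrite mcoeff_eq0 => /negP; exact.
rewrite -cls_val; case: w nrw {wx} => -[y s] ps /= nrw.
have [s1 [a [b [s2 [es ab]]]]] :
    exists s1 a b s2, s = s1 ++ a :: b :: s2 /\ zero_rel m a b.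
  case/and3P: ps nrw => /= vy cy _; rewrite /is_rpath /= vy cy /= {vy cy}.
  case: s => [//|a s] /=; elim: s a => [//|b s IHs] a /=.
  rewrite negb_and negbK => /orP[ab|/IHs[s1 [c [d [s2 [-> cd]]]]]].
  - by exists [::], a, b, s.
  - by exists (a :: s1), c, d, s2.
have/and3P[/= vy cy _] := ps; move: cy; rewrite es composable_cat /=.
case/and5P=> c1 ia /eqP sa ib /andP[/eqP sb c2].
have -> : cls hm (fun _ _ => false) (y, s1 ++ a :: b :: s2) =
  cls hm _ (y, s1) * (arr hm _ a * arr hm _ b) * cls hm _ (tgt m b, s2).
  by rewrite !mul_cls /= sb eqxx mul_cls /= sa eqxx mul_cls /=
     path_end_cat /path_end /= eqxx -!catA.
by apply: ideal_genMr; apply: ideal_genMl; apply: ideal_gen_mem; exists a, b.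
Qed.

End Presentation.

(* A planar rooted tree, up to isotopy, with oriented and labeled edges. It is
   presented by what lies beyond its root edge, i.e. the edge at the root leaf:
   every subtree carries the decoration of the edge leading to it, and the
   children of an internal vertex are listed counterclockwise, starting after
   the edge towards the root.
   The decoration (b, i) of an edge consists of its label i and of its
   orientation, away from the root if b and towards the root otherwise. *)
Inductive dtree := Leaf of bool * nat | Node of bool * nat & seq dtree.

Lemma dtree_nested_ind (P : dtree -> Prop) :
  (forall e, P (Leaf e)) ->
  (forall e cs, foldr (fun c Q => P c /\ Q) True cs -> P (Node e cs)) ->
  forall G, P G.
Proof.
move=> PL PN; fix IH 1 => -[e|e cs]; first exact: PL.
apply: PN; elim: cs => [|c cs IHcs]; first exact: I.
by split; [exact: IH | exact: IHcs].
Qed.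

HB.instance Definition _ := gen_eqMixin dtree.
HB.instance Definition _ := gen_choiceMixin dtree.

Definition top_edge (G : dtree) : bool * nat :=
  match G with Leaf e | Node e _ => e end.

(* An edge-end at a vertex is a pair (b, i), incoming if b and outgoing
   otherwise, with label i. The top edge of a subtree thus has the edge-end
   top_edge G at its vertex away from the root, and the following one at its
   vertex towards the root. *)
Definition upper_end (G : dtree) : bool * nat :=
  (~~ (top_edge G).1, (top_edge G).2).

Definition is_node (G : dtree) : bool := if G is Node _ _ then true else false.

Fixpoint internal_vertices (G : dtree) : nat :=
  if G is Node _ cs then (sumn (map internal_vertices cs)).+1 else 0.

Section Tiling.
Variable m : nat.

(* Listed counterclockwise. *)
Definition vertex_ends : seq (bool * nat) :=
  [seq (true, i) | i <- iota 1 m.-1] ++ [seq (false, i) | i <- rev (iota 1 m.-1)].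

Definition is_rotation (T : eqType) (s t : seq T) : bool :=
  has (fun k => rot k s == t) (iota 0 (size s)).

Fixpoint compatible (G : dtree) : bool :=
  if G is Node e cs
  then is_rotation vertex_ends (e :: map upper_end cs) && all compatible cs
  else true.

Definition tiling_tree (G : dtree) : bool := is_node G && compatible G.

(* The label of the sector between an edge-end and the next one
   counterclockwise. *)
Definition sector (e e' : bool * nat) : arrow :=
  match e.1, e'.1 with
  | true, true => aR e'.2
  | false, false => aL e.2
  | true, false => aUm
  | false, true => aU1
  end.

(* The sectors met when running along the tree with the boundary of the disk on
   the right, from one side of the top edge to its other side; None marks the
   passage at a leaf. *)
Fixpoint contour (G : dtree) : seq (option arrow) :=
  match G with
  | Leaf _ => [:: None]
  | Node e cs =>
    let fix around (x : bool * nat) (cs : seq dtree) :=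
      if cs is c :: cs'
      then Some (sector x (upper_end c)) :: contour c ++ around (upper_end c) cs'
      else [:: Some (sector x e)] in
    around e cs
  end.

Fixpoint split_leaves (s : seq (option arrow)) : seq (seq arrow) :=
  match s with
  | [::] => [:: [::]]
  | None :: s' => [::] :: split_leaves s'
  | Some a :: s' =>
    let r := split_leaves s' in (a :: head [::] r) :: behead r
  end.

Definition sector_words (G : dtree) : seq (seq arrow) := split_leaves (contour G).

Definition leaf_count (G : dtree) : nat := count_mem None (contour G).

Lemma size_sector_words G : size (sector_words G) = (leaf_count G).+1.
Proof.
rewrite /sector_words /leaf_count; elim: (contour G) => //= -[a|] s IHs /=.
  by rewrite size_behead IHs.
by rewrite IHs.
Qed.

Lemma leaf_count_node e cs :
  leaf_count (Node e cs) = sumn (map leaf_count cs).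
Proof.
rewrite /leaf_count /=; move: {2}e => x; elim: cs x => //= c cs IHcs x.
by rewrite count_cat IHcs.
Qed.

Fixpoint depth (G : dtree) : nat :=
  if G is Node _ cs then (foldr maxn 0 (map depth cs)).+1 else 1.

Lemma rotation_size (e : bool * nat) (cs : seq dtree) :
  is_rotation vertex_ends (e :: map upper_end cs) ->
  (size cs).+1 = (m.-1 + m.-1)%N.
Proof.
case/hasP => k _ /eqP/(congr1 size); rewrite size_rot /= size_map => <-.
by rewrite size_cat !size_map size_rev !size_iota.
Qed.

Lemma leaf_count_depth G : (3 <= m)%N -> compatible G -> (depth G <= leaf_count G)%N.
Proof.
move=> hm; elim/dtree_nested_ind: G => // e cs IHcs /= /andP[/rotation_size sz].
rewrite leaf_count_node => call.
have {sz} sz : (1 < size cs)%N by move: sz hm; clear; case: m => [|[|[|n]]] //=; lia.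
have [H1 H2] : (foldr maxn 0 (map depth cs) + size cs <= sumn (map leaf_count cs) + 1)%N
    /\ (size cs <= sumn (map leaf_count cs))%N;
  last by move: sz H1 H2; clear; move: (foldr _ _ _) (sumn _) (size _) => a b c; lia.
elim: cs IHcs call {sz} => //= c cs IHs [Pc /IHs{}IHs] /andP[/Pc dc /IHs[H1 H2]].
have : (0 < depth c)%N by case: (c).
split; lia.
Qed.

Fixpoint seqs_of (T : Type) (a : nat) (s : seq T) : seq (seq T) :=
  if a is a'.+1 then [seq x :: l | x <- s, l <- seqs_of a' s] else [:: [::]].

Lemma mem_seqs_of (T : eqType) (s l : seq T) :
  {subset l <= s} -> l \in seqs_of (size l) s.
Proof.
elim: l => //= x l IHl sub; apply/allpairsP; exists (x, l) => /=; split=> //.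
- by apply: sub; rewrite mem_head.
- by apply: IHl => y yl; apply: sub; rewrite inE yl orbT.
Qed.

Definition decorations : seq (bool * nat) :=
  [seq (b, i) | b <- [:: true; false], i <- iota 1 m.-1].

Fixpoint trees_upto (n : nat) : seq dtree :=
  if n is n'.+1 then
    map Leaf decorations ++
    [seq Node e cs | e <- decorations, cs <- seqs_of (m.-1 + m.-1).-1 (trees_upto n')]
  else [::].

Lemma mem_trees_upto G n : compatible G -> top_edge G \in decorations ->
  (depth G <= n)%N -> G \in trees_upto n.
Proof.
elim/dtree_nested_ind: G n => [e|e cs IHcs] [|n] //= cG eD dn; rewrite mem_cat.
  by rewrite map_f.
apply/orP; right; case/andP: cG => rot call.
have dec c : c \in cs -> top_edge c \in decorations.
  move=> ccs; have : upper_end c \in vertex_ends.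
    case/hasP: rot => k _ /eqP er; rewrite -(mem_rot k) er inE.
    by rewrite (map_f upper_end ccs) orbT.
  rewrite /upper_end /vertex_ends /decorations; case: (top_edge c) => b i /=.
  rewrite cats0 !mem_cat => /orP[] /mapP[j]; rewrite ?mem_rev => ij [eb ei];
    rewrite ei; case: b eb => //= _; rewrite map_f ?orbT //.
have -> : (m.-1 + m.-1).-1 = size cs by rewrite -(rotation_size rot).
apply/allpairsP; exists (e, cs); split=> //=; apply: mem_seqs_of => c.
elim: cs IHcs call dec dn {rot} => //= c' cs IHs [Pc Pcs] /andP[cc ccs] dec dn.
rewrite inE => /orP[/eqP->|ccs'].
  by apply: Pc => //; [apply: dec; rewrite mem_head | lia].
by apply: IHs => //; [move=> d dcs; apply: dec; rewrite inE dcs orbT | lia].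
Qed.

Lemma finite_tiling_trees (n : nat) : (3 <= m)%N ->
  finite_set [set G | tiling_tree G /\ size (sector_words G) = n]%classic.
Proof.
move=> hm; apply: (sub_finite_set _ (finite_seq (trees_upto n))).
move=> G /= [/andP[nG cG]]; rewrite size_sector_words => sn.
apply: mem_trees_upto => //; last first.
  by apply: leq_trans (leaf_count_depth hm cG) _; rewrite -sn.
case: G nG cG {sn} => //= e cs _ /andP[/hasP[k _ /eqP er] _].
have : e \in vertex_ends by rewrite -(mem_rot k) er mem_head.
rewrite /vertex_ends /decorations /= cats0 !mem_cat.
by case/orP=> /mapP[j]; rewrite ?mem_rev => ij ->; rewrite map_f ?orbT.
Qed.

End Tiling.

Section Operations.
Variables (m : nat) (hm : (3 <= m)%N).
Local Notation C := (bordered m hm).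
Local Notation K := (rpath m (zero_rel m)).
Local Notation Ct := {poly C}.

Definition nonconstant (w : K) : bool := (val w).2 != [::].

Definition pure (a : C) : Prop :=
  exists2 w, nonconstant w & a = bas hm w.

Definition iota_root (G : dtree) : C := idem hm (zero_rel m) (top_edge G).2.

Definition avec (G : dtree) : seq C :=
  [seq \prod_(a <- w) arr hm (zero_rel m) a | w <- sector_words G].

(* These are finite sums: see finite_tilings and finite_factorizations. *)
Definition c0 (s : seq C) : Ct :=
  \sum_(G \in [set G | tiling_tree m G /\ avec G = s]%classic)
    (iota_root G)%:P * 'X^(internal_vertices G).

Definition factorizations (b : C) : set (C * C) :=
  [set p | [/\ pure p.1, pure p.2 & b = p.1 * p.2]]%classic.

Definition mu0_pure (s : seq C) : Ct :=
  c0 s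
  + \sum_(p \in factorizations (head 0 s)) p.1%:P * c0 (p.2 :: behead s)
  + \sum_(p \in factorizations (last 0 s))
      c0 (rcons (take (size s).-1 s) p.1) * p.2%:P.

(* The value of mu^0_n, n <> 2, on n basis elements of C. *)
Definition mu0_basis (s : seq K) : Ct :=
  if all nonconstant s then mu0_pure (map (@bas m hm _) s) else 0.

(* The t-equivariant multilinear extension to C[t] of a function given on
   sequences of basis elements of C; the nonzero coefficients are 1, as they
   are in F_2. *)
Fixpoint multilinear (F : seq K -> Ct) (s : seq Ct) : Ct :=
  if s is x :: s' then
    \sum_(k < size x)
      \sum_(w <- msupp (x`_k : {malg 'F_2[K]}))
        'X^k * multilinear (fun r => F (w :: r)) s'
  else F [::].

(* The family (mu^0_n) as a function on sequences, mu^0_n being its restriction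
   to sequences of size n. *)
Definition mu0 (s : seq Ct) : Ct :=
  if size s == 2%N then s`_0 * s`_1 else multilinear mu0_basis s.

(* The ground ring, as a subset of C[t]. *)
Definition ground : set Ct :=
  [set x | exists c : nat -> 'F_2, x = (\sum_(1 <= i < m) c i *: idem hm (zero_rel m) i)%:P]%classic.

(* Homogeneous elements of degree d, for gr(C) = 0 and gr(t) = 2m - 4. *)
Definition gr_homogeneous (d : int) (x : Ct) : Prop :=
  forall k, x`_k != 0 -> (k * (2 * m - 4))%N%:Z = d.

Lemma finite_tilings (s : seq C) :
  finite_set [set G | tiling_tree m G /\ avec G = s]%classic.
Proof.
apply: sub_finite_set (finite_tiling_trees (size s) hm) => G /= [tG <-].
by split; rewrite ?size_map.
Qed.

Lemma finite_factorizations (b : C) : pure b -> finite_set (factorizations b).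
Proof.
case=> w _ ->; case ew : (val w) => [x s].
pose F i := (cls hm (zero_rel m) (x, take i s),
             cls hm (zero_rel m) (path_end m (x, take i s), drop i s)).
have [n en] : exists n, n = (size s).+1 by eexists.
apply: (sub_finite_set _ (finite_seq [seq F i | i <- iota 0 n])).
move=> [a b'] /= [[u _ /= ea] [v _ /= eb]] e0; subst a b'; apply/mapP; move: e0 => /=.
rewrite -(cls_val hm u) -(cls_val hm v) mul_cls; case: eqP => [e|_ /eqP]; last by rewrite (negPf (bas_neq0 _ _)).
move/esym/cls_bas; rewrite ew => -[ex es].
exists (size (val u).2).
  by rewrite mem_iota en -es size_cat /=; lia.
rewrite /F -es take_size_cat // drop_size_cat // -ex.
by rewrite -surjective_pairing e -surjective_pairing !cls_val.
Qed.

End Operations.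

(* The unital A-infinity structures (without signs, for characteristic 2) over
   the ground ring k on the ring A, viewed
   as a k-bimodule, with unit 1. The operation mu_n is the restriction of mu to
   sequences of size n; a bimodule map from the n-fold tensor product of A over
   k is given by a multiadditive, k-balanced map which is linear over k at both
   ends. *)
Record unital_Ainf (A : pzRingType) (k : set A) (homogeneous : int -> A -> Prop)
    (mu : seq A -> A) : Prop := UnitalAinf {
  Ainf_additive : forall (s s' : seq A) (x y : A),
    mu (s ++ (x + y) :: s') = mu (s ++ x :: s') + mu (s ++ y :: s');
  Ainf_left_linear : forall (c x : A) (s : seq A), k c ->
    mu (c * x :: s) = c * mu (x :: s);
  Ainf_right_linear : forall (c x : A) (s : seq A), k c ->
    mu (rcons s (x * c)) = mu (rcons s x) * c;
  Ainf_balanced : forall (c x y : A) (s s' : seq A), k c ->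
    mu (s ++ x * c :: y :: s') = mu (s ++ x :: c * y :: s');
  Ainf_degree : forall (s : seq A) (d : seq int),
    (0 < size s)%N -> size d = size s ->
    (forall i, (i < size s)%N -> homogeneous d`_i s`_i) ->
    homogeneous (\sum_(e <- d) e + ((size s)%:Z - 2)) (mu s);
  Ainf_relation : forall s : seq A, (0 < size s)%N ->
    \sum_(j < (size s).+1) \sum_(i < j)
      mu (take i s ++ mu (drop i (take j s)) :: drop j s) = 0;
  Ainf_unit_left : forall a : A, mu [:: 1; a] = a;
  Ainf_unit_right : forall a : A, mu [:: a; 1] = a;
  Ainf_unit_higher : forall s : seq A, size s != 2%N -> 1 \in s -> mu s = 0
}.

(* Main.v *)
Require Import Defs.
From mathcomp Require Import all_boot all_order all_algebra.
From mathcomp Require Import finmap.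
From mathcomp Require Import boolp classical_sets functions cardinality fsbigop.
From mathcomp Require Import monalg zify.

Import GRing.Theory.
Local Open Scope ring_scope.

Set Implicit Arguments.
Unset Strict Implicit.
Unset Printing Implicit Defensive.

(* Every arrow has exactly one continuation with nonzero product, so a pure
   element is a pair (arrow, length), and a sequence of pure elements is a string
   of arrows separated by bars (None). Let T(S) be t^d if S is the boundary word of a
   tiling tree with d vertices (which is then unique), and 0 otherwise. Crossing
   an edge of a tree gives two facts:
     T(X|Y) = T(Y|X), by moving the root, and
     T(XY) = sum of T(C) T(D) over all C, D with CD = Y|X, by cutting the tree
   along the edge that its boundary crosses between X and Y.
   Write [U] for the element of the path U. Then mu(S) is i T(S) plus the sum of
   [U] T(V) + T(U) [V] over S = UV, with i the idempotent of the root. In the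
   A-infinity relation, the terms whose outer operation is centered cancel by the
   cut formula; the same formula applied to the V of [U] T(V) leaves terms in
   which only the first and the last input overlap. These two inputs lie on a
   periodic line as the intervals [r, s) and [p, q); each remaining term is
   [out] T(w|Q) with out = [r, q) and w = [p, s). Every relative position
   contributes once according to the sign of q - s and once according to the sign
   of p - r, hence the sum vanishes in characteristic 2. *)

(** * Edge-ends and arrows *)

(** The obstacle is that multiplication and the tree operations have to be compared in one formula.
    A product of two neighbouring inputs deletes a bar if the arrows on its two sides are
    consecutive and is 0 otherwise; in the second case the weight of the string without the bar
    vanishes as well, so the cut formula needs no case distinction. The output of an inner centered
    operation is an idempotent, which every higher operation kills; hence inside a higher operation
    only extended inner operations count, and these leave a power of t, which is central, and a
    shortened input. Finally, a tree with d vertices has d(2m - 4) + 2 leaves, counting the root.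
    This matches the degree of t and, as m >= 3, shows that higher operations take at least four
    inputs, so that the operations are the sum of multiplication and of a higher part on inputs of
    every positive length. Constant inputs are treated apart, by linearity over the ground ring. *)

Section Ends.
Variables (m : nat) (hm : (3 <= m)%N).
Implicit Types e x y : bool * nat.

(* The end of the same edge at its other vertex. *)
Definition opp_end e : bool * nat := (~~ e.1, e.2).

(* The next edge-end at the same vertex, counterclockwise. *)
Definition nxt e : bool * nat :=
  if e.1 then (if (e.2 < m.-1)%N then (true, e.2.+1) else (false, e.2))
  else (if (1 < e.2)%N then (false, e.2.-1) else (true, e.2)).

Definition end_ok e : bool := is_vertex m e.2.

(* The sector between e and nxt e: arrows are thereby identified with edge-ends. *)
Definition lab e : arrow :=
  if e.1 then (if (e.2 < m.-1)%N then aR e.2.+1 else aUm)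
  else (if (1 < e.2)%N then aL e.2 else aU1).

(* The only arrow whose product with a is nonzero, see nonzero_step. *)
Definition succ (a : arrow) : arrow :=
  match a with aL i => aR i | aR i => aL i | aU1 => aU1 | aUm => aUm end.

Lemma sector_nxt e : sector e (nxt e) = lab e.
Proof. by case: e => -[] i; rewrite /sector /nxt /lab /=; case: (_ < _)%N. Qed.

Lemma opp_endK : involutive opp_end.
Proof. by case=> b i; rewrite /opp_end /= negbK. Qed.

Lemma succK : involutive succ.
Proof. by case. Qed.

Lemma end_ok_opp e : end_ok (opp_end e) = end_ok e.
Proof. by []. Qed.

Lemma end_ok_nxt e : end_ok e -> end_ok (nxt e).
Proof. by case: e => -[] i; rewrite /end_ok /is_vertex /nxt /=; case: ifP => /=; lia. Qed.

(** The counterclockwise order runs up the incoming labels and down the outgoing ones, so [opp_end]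
    reverses it, and conjugation by [opp_end] inverts [nxt]. *)
Definition prv e : bool * nat := opp_end (nxt (opp_end e)).

Lemma prvK e : end_ok e -> nxt (prv e) = e.
Proof.
case: e => -[] i; rewrite /end_ok /is_vertex /prv {2}/nxt /opp_end /= => ei; case: ifP => /= h;
  by rewrite /nxt /=; case: ifP => /= h'; first [congr (_, _); lia | exfalso; lia].
Qed.

Lemma nxtK e : end_ok e -> prv (nxt e) = e.
Proof. by move=> ee; rewrite /prv -{1}[e]opp_endK -/(prv (opp_end e)) prvK ?opp_endK. Qed.

Lemma end_ok_prv e : end_ok e -> end_ok (prv e).
Proof. by move=> ee; rewrite /prv end_ok_opp end_ok_nxt. Qed.

Definition end_of (a : arrow) : bool * nat :=
  match a with
  | aL i => (false, i) | aR i => (true, i.-1) | aU1 => (false, 1%N) | aUm => (true, m.-1)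
  end.

Lemma labK e : end_ok e -> end_of (lab e) = e.
Proof.
case: e => -[] i; rewrite /end_ok /is_vertex /lab /nxt /=;
  case: ifP => /= h ei; congr (_, _); lia.
Qed.

Lemma end_ofK a : is_arrow m a -> lab (end_of a) = a.
Proof.
case: a => [i|i||] /=; rewrite /lab /nxt /= => h.
- by case: ifP => //=; lia.
- by case: ifP => //=; [rewrite prednK //; lia | lia].
- by [].
- by rewrite ltnn.
Qed.

Lemma end_ok_of a : is_arrow m a -> end_ok (end_of a).
Proof. by case: a => [i|i||] /=; rewrite /end_ok /is_vertex /=; move: hm; lia. Qed.

Lemma src_lab e : end_ok e -> src m (lab e) = e.2.
Proof.
case: e => -[] i; rewrite /end_ok /is_vertex /lab /nxt /=;
  case: ifP => //=; lia.
Qed.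

Lemma tgt_lab e : end_ok e -> tgt m (lab e) = (nxt e).2.
Proof.
case: e => -[] i; rewrite /end_ok /is_vertex /lab /nxt /=;
  case: ifP => //=; lia.
Qed.

(** After the sector from [e] to [nxt e] the boundary walk follows the edge at [nxt e] and reaches
    its other vertex at [opp_end (nxt e)], where the next sector starts. Hence consecutive sectors
    of a face form a nonzero path. *)
Lemma succ_lab e : end_ok e -> succ (lab e) = lab (opp_end (nxt e)).
Proof.
case: e => -[] i; rewrite /end_ok /is_vertex /lab /nxt /=.
- case: ifP => /= h ei; last by rewrite h.
  by case: ifP => //=; lia.
- case: ifP => /= h ei; last by rewrite h.
  by case: ifP => //=; [rewrite prednK //; lia | lia].
Qed.

Lemma is_arrow_succ a : is_arrow m (succ a) = is_arrow m a.
Proof. by case: a. Qed.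

Lemma tgt_succ a : src m (succ a) = tgt m a.
Proof. by case: a. Qed.

Lemma nonzero_step a b : is_arrow m a -> is_arrow m b ->
  (src m b == tgt m a) && ~~ zero_rel m a b = (b == succ a).
Proof.
move=> ha hb; apply/idP/eqP.
  case: a ha => [i|i||]; case: b hb => [j|j||] //= hb ha /andP[/eqP h1 h2];
  try (by congr (_ _); lia); move: h1 h2; lia.
move=> ->; rewrite tgt_succ eqxx /=.
by case: a ha {hb} => [i|i||] //=; lia.
Qed.

(* The two arrows into a vertex are told apart by their nonzero continuation. *)
Lemma other_arrow a e : is_arrow m a -> end_ok e ->
  (tgt m a == src m (lab e)) && (lab e != succ a) = (a == lab (prv e)).
Proof.
move=> ha he; rewrite src_lab // -(end_ofK ha); have hf := end_ok_of ha.
move: (end_of a) hf => f hf; rewrite tgt_lab // succ_lab //.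
apply/andP/eqP => [[/eqP h1 h2]|h].
  have : nxt f = e; last by move=> <-; rewrite nxtK.
  have : e <> opp_end (nxt f) by move=> h; rewrite -h eqxx in h2.
  move: h1; case: (nxt f) => b i; case: (e) => b' i' /= ->; rewrite /opp_end /=.
  by case: b; case: b'.
have -> : f = prv e by rewrite -(labK hf) -(labK (end_ok_prv he)) h.
rewrite prvK // eqxx; split=> //; apply/eqP => /(congr1 end_of).
by rewrite !labK // /opp_end; case: (e) => -[] i.
Qed.

(** The version of [other_arrow] for the two arrows out of a vertex: [succ] exchanges source and
    target, and [opp_end] reverses the walk. *)
Lemma other_arrow_out b e : is_arrow m b -> end_ok e ->
  (src m b == src m (lab e)) && (b != succ (lab (prv e))) = (b == lab e).
Proof.
move=> hb he; have hb' : is_arrow m (succ b) by rewrite is_arrow_succ.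
have := other_arrow hb' (e := opp_end e) he; rewrite -tgt_succ !succK !src_lab //= => H.
rewrite succ_lab ?end_ok_prv // prvK // eq_sym [X in _ && ~~ X]eq_sym [X in X && _]eq_sym H.
by rewrite -(inj_eq (can_inj succK)) succK succ_lab ?end_ok_prv // prvK // opp_endK.
Qed.

Local Notation M := (m.-1 + m.-1)%N.

Lemma vertex_endsE : vertex_ends m = traject nxt (true, 1%N) M.
Proof.
have up k i : (i + k = m)%N ->
    traject nxt (true, i) k = [seq (true, j) | j <- iota i k].
  elim: k i => [//|k IHk] i ik; rewrite trajectS [in RHS]/=; congr cons.
  case: k IHk ik => [//|k] IHk ik; rewrite -IHk; last by lia.
  by congr (traject _ _ _); rewrite /nxt /=; case: ifP => //; lia.
have down k : traject nxt (false, k) k = [seq (false, j) | j <- rev (iota 1 k)].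
  elim: k => [//|k IHk].
  have -> : rev (iota 1 k.+1) = k.+1 :: rev (iota 1 k).
    by rewrite -{1}[k.+1]addn1 iotaD rev_cat add1n.
  by rewrite trajectS map_cons -IHk; congr cons; case: k {IHk}.
have it k i : (i + k = m.-1)%N -> iter k nxt (true, i) = (true, m.-1).
  elim: k i => [|k IHk] i ik; first by congr (_, _); lia.
  by rewrite iterSr {2}/nxt /=; case: ifP => h; [apply: IHk | ]; lia.
rewrite /vertex_ends trajectD up; last by lia.
congr (_ ++ _); rewrite -down; congr (traject _ _ _).
have -> : m.-1 = m.-2.+1 by lia.
by rewrite iterS it; [rewrite /nxt /= ltnn; congr (_, _) | ]; lia.
Qed.

Lemma iter_nxt e : end_ok e -> iter M nxt e = e.
Proof.
have H0 : iter M nxt (true, 1%N) = (true, 1%N).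
  have -> : M = (m.-2.+1 + m.-2.+1)%N by lia.
  have up k i : (i + k = m.-1)%N -> iter k nxt (true, i) = (true, m.-1).
    elim: k i => [|k IHk] i ik; first by congr (_, _); lia.
    by rewrite iterSr {2}/nxt /=; case: ifP => h; [apply: IHk | ]; lia.
  have down k : iter k nxt (false, k.+1) = (false, 1%N) by elim: k => // k IHk; rewrite iterSr.
  rewrite iterD [iter m.-2.+1 _ (true, _)]iterS up; last by lia.
  have -> : nxt (true, m.-1) = (false, m.-2.+1) by rewrite /nxt /= ltnn; congr (_, _); lia.
  by rewrite iterS down.
(* All ends lie on one orbit of [nxt], so periodicity at [(true, 1)] suffices. *)
have : forall k, iter M nxt (iter k nxt (true, 1%N)) = iter k nxt (true, 1%N).
  by move=> k; rewrite -iterD addnC iterD H0.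
move=> H ee; have /trajectP[k _ ->//] : e \in traject nxt (true, 1%N) M.
rewrite -vertex_endsE /vertex_ends mem_cat; case: e ee => b i.
rewrite /end_ok /is_vertex /= => ei; apply/orP; case: b; [left|right];
  by rewrite map_f // ?mem_rev mem_iota; lia.
Qed.

Lemma mem_vertex_ends e : (e \in vertex_ends m) = end_ok e.
Proof.
rewrite /vertex_ends mem_cat; apply/orP/idP.
  by case=> /mapP[j]; rewrite ?mem_rev mem_iota => jm ->; rewrite /end_ok /is_vertex /=; lia.
case: e => b i; rewrite /end_ok /is_vertex /= => ei; case: b; [left|right];
  by rewrite map_f // ?mem_rev mem_iota; lia.
Qed.

Lemma rot_traject k e : end_ok e -> (k <= M)%N ->
  rot k (traject nxt e M) = traject nxt (iter k nxt e) M.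
Proof.
move=> ee; elim: k => [|k IHk] km; first by rewrite rot0.
rewrite -add1n rotD ?size_traject; last by lia.
rewrite iterD IHk; last by lia.
set x := iter k nxt e; have ex : end_ok x by rewrite /x; elim: k {IHk km x} => //= k; exact: end_ok_nxt.
have xM : iter M nxt x = x by exact: iter_nxt.
case: M xM => [//|n] xM.
by rewrite trajectS rot1_cons [iter 1 _ _]/= trajectSr -iterSr xM.
Qed.

(** [vertex_ends] is one full turn of [nxt], so its rotations are the full turns from arbitrary
    ends, and compatibility becomes a condition on consecutive ends. *)
Lemma is_rotationE e t :
  is_rotation (vertex_ends m) (e :: t) =
  end_ok e && (t == traject nxt (nxt e) M.-1).
Proof.
have eM : M = (M.-1).+1 by lia.
have e1 : end_ok (true, 1%N) by rewrite /end_ok /is_vertex /=; lia.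
apply/hasP/andP.
  case=> k; rewrite mem_iota vertex_endsE size_traject => /andP[_ km].
  rewrite rot_traject //; last by lia.
  rewrite {1}eM trajectS => /eqP[<- <-]; split=> //.
  by elim: k {km} => //= k; exact: end_ok_nxt.
case=> ee /eqP->; have : e \in traject nxt (true, 1%N) M.
  by rewrite -vertex_endsE mem_vertex_ends.
case/trajectP=> k km ek; exists k.
  by rewrite mem_iota vertex_endsE size_traject.
rewrite vertex_endsE rot_traject //; last by lia.
by rewrite -ek {1}eM trajectS.
Qed.

End Ends.

(** * Boundary words of tiling trees *)

Section Trees.
Variables (m : nat) (hm : (3 <= m)%N).
Local Notation M := (m.-1 + m.-1)%N.
Local Notation nxt := (nxt m).
Local Notation lab := (lab m).
Local Notation compatible := (compatible m).
Implicit Types (G c : dtree) (cs : seq dtree) (e x y : bool * nat).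

(** Names the local fixpoint of [contour], with the closing end [e] as an argument: in inductions
    over the children [x] moves while [e] stays. *)
Fixpoint around x cs e : seq (option arrow) :=
  if cs is c :: cs'
  then Some (sector x (upper_end c)) :: contour c ++ around (upper_end c) cs' e
  else [:: Some (sector x e)].

Lemma contour_node e cs : contour (Node e cs) = around e cs e.
Proof. by rewrite /=; move: {2 3}e => x; elim: cs x => //= c cs IHcs x; rewrite IHcs. Qed.

Lemma around_cat x cs c cs' e :
  around x (cs ++ c :: cs') e =
  around x cs (upper_end c) ++ contour c ++ around (upper_end c) cs' e.
Proof. by elim: cs x => //= d cs IHcs x; rewrite IHcs -catA. Qed.

Lemma upper_endE G e : upper_end G = e -> top_edge G = opp_end e.
Proof. by move=> <-; rewrite -[LHS]opp_endK. Qed.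

Lemma compatible_node e cs :
  compatible (Node e cs) =
  [&& end_ok m e, map upper_end cs == traject nxt (nxt e) M.-1 & all compatible cs].
Proof. by rewrite /= is_rotationE // -andbA. Qed.

(** Moves the root across a vertex, from the edge [e] to the edge of [c]: the cyclic order of the
    ends is unchanged, and [G], the tree beyond the old root edge, becomes a child. *)
Lemma compatible_rot e cs c cs' G :
  compatible (Node e (cs ++ c :: cs')) -> compatible G -> upper_end G = e ->
  compatible (Node (upper_end c) (cs' ++ G :: cs)).
Proof.
rewrite [in X in X -> _]/= [in X in _ -> _ -> _ -> X]/= !all_cat /=.
case/andP=> rot /and3P[-> _ ->] -> Ge; rewrite !andbT.
move: rot; rewrite !map_cat /= Ge is_rotationE // => /andP[ee /eqP et].
have eT : e :: [seq upper_end i | i <- cs] ++ upper_end c :: [seq upper_end i | i <- cs'] =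
   traject nxt e M.
  by rewrite et -trajectS prednK //; lia.
have := congr1 (rot (size cs).+1) eT; rewrite rot_traject //; last first.
  by move/(congr1 size): eT; rewrite size_traject /= size_cat /= !size_map; lia.
have -> : (size cs).+1 = size (e :: [seq upper_end i | i <- cs]) by rewrite /= size_map.
rewrite -cat_cons rot_size_cat cat_cons.
set y := iter _ _ _; have -> : M = (M.-1).+1 by lia.
rewrite trajectS => -[-> ->]; rewrite is_rotationE // eqxx andbT.
by rewrite /y; elim: (size _) => //= k; exact: end_ok_nxt.
Qed.

(** Single sectors alternate with contours of children, so a cut away from both extremities lies
    inside or at an end of the contour of some child. *)
Lemma around_cut x cs e A1 A2 : around x cs e = A1 ++ A2 ->
  [\/ A1 = [::], A2 = [::] |
   exists cs1 c cs2 B1 B2,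
     [/\ cs = cs1 ++ c :: cs2, contour c = B1 ++ B2,
         A1 = around x cs1 (upper_end c) ++ B1 & A2 = B2 ++ around (upper_end c) cs2 e]].
Proof.
elim: cs x A1 => [|c cs IHcs] x [|a A1] /=; try by [constructor 1].
  by case=> _; case: A1; case: A2 => // *; constructor 2.
case=> <- eA; have [le|lt] := leqP (size A1) (size (contour c)).
  have [B2 ec] : exists B2, contour c = A1 ++ B2.
    exists (drop (size A1) (contour c)); rewrite -{1}(cat_take_drop (size A1) (contour c)).
    congr (_ ++ _); have := congr1 (take (size A1)) eA.
    by rewrite (take_size_cat A2) // takel_cat.
  constructor 3; exists [::], c, cs, A1, B2; split=> //.
  by move/eqP: eA; rewrite ec -catA eqseq_cat // eqxx => /eqP.
have e1 : A1 = contour c ++ drop (size (contour c)) A1.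
  rewrite -{1}(cat_take_drop (size (contour c)) A1); congr (_ ++ _).
  have := congr1 (take (size (contour c))) eA.
  by rewrite take_size_cat // takel_cat // ltnW.
move: eA; rewrite {1}e1 -catA => /eqP; rewrite eqseq_cat // eqxx => /eqP/IHcs.
case=> [d0|->|[cs1 [d [cs2 [B1 [B2 [-> ec eA1 eA2]]]]]]].
- by move: lt; rewrite e1 d0 cats0 ltnn.
- by constructor 2.
- constructor 3; exists (c :: cs1), d, cs2, B1, B2; split=> //.
  by rewrite e1 eA1 /= -catA.
Qed.

(* The contours of the two sides of an edge together form the boundary word of
   an unrooted tree; wherever this word is cut between two of its symbols, the
   walk is crossing an edge. *)
Lemma contour_rotate G H A1 A2 :
  compatible G -> compatible H -> upper_end H = top_edge G ->
  contour G = A1 ++ A2 ->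
  exists C D, [/\ compatible C, compatible D, upper_end D = top_edge C,
    A2 ++ contour H ++ A1 = contour C ++ contour D &
    (internal_vertices C + internal_vertices D =
     internal_vertices G + internal_vertices H)%N].
Proof.
have A1nil G' H' A : compatible G' -> compatible H' -> upper_end H' = top_edge G' ->
  contour G' = A -> exists C D, [/\ compatible C, compatible D, upper_end D = top_edge C,
    A ++ contour H' ++ [::] = contour C ++ contour D &
    (internal_vertices C + internal_vertices D =
     internal_vertices G' + internal_vertices H')%N].
  by move=> cG cH GH <-; exists G', H'; rewrite cats0.
have A2nil G' H' A : compatible G' -> compatible H' -> upper_end H' = top_edge G' ->
  contour G' = A -> exists C D, [/\ compatible C, compatible D, upper_end D = top_edge C,
    [::] ++ contour H' ++ A = contour C ++ contour D &
    (internal_vertices C + internal_vertices D =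
     internal_vertices G' + internal_vertices H')%N].
  move=> cG cH GH <-; exists H', G'; split=> //; last by rewrite addnC.
  by rewrite (upper_endE GH).
elim/dtree_nested_ind: G H A1 A2 => [e|e cs IHcs] H A1 A2 cG cH GH eA.
  case: A1 eA => [|a A1] eA; first exact: A1nil.
  have e2 : A2 = [::] by case: A1 A2 eA => [|? ?] [].
  by subst A2; apply: A2nil; rewrite // eA cats0.
move: (eA); rewrite contour_node.
case/around_cut => [eA1|eA2|[cs1 [c [cs2 [B1 [B2 [ecs ec eA1 eA2]]]]]]].
- by subst A1; apply: A1nil.
- by subst A2; rewrite cats0 in eA; apply: A2nil.
(* [H'] is everything outside [c], rooted at the edge of [c]. The pair of [c] and [H'] has the same
   cyclic boundary word as the original pair, and the cut now lies in the smaller tree [c]. *)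
subst cs; pose H' := Node (upper_end c) (cs2 ++ H :: cs1).
have cH' : compatible H' by apply: compatible_rot cG cH GH.
have cc : compatible c by move: cG; rewrite /= all_cat /= => /and4P[].
have IHc : forall H A1 A2, compatible c -> compatible H -> upper_end H = top_edge c ->
  contour c = A1 ++ A2 -> exists C D, [/\ compatible C, compatible D,
    upper_end D = top_edge C, A2 ++ contour H ++ A1 = contour C ++ contour D &
    (internal_vertices C + internal_vertices D =
     internal_vertices c + internal_vertices H)%N].
  by elim: cs1 IHcs {cG H' cH' GH eA eA1} => /= [|d cs1 IHcs1] [] // _ /IHcs1.
have [|C [D [cC cD CD eCD iv]]] := IHc H' _ _ cc cH' _ ec.
  by rewrite -[RHS]opp_endK.
exists C, D; split=> //.
  by rewrite -eCD contour_node around_cat eA1 eA2 GH -!catA.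
by rewrite iv /= !map_cat /= !sumn_cat /=; lia.
Qed.

(* The first symbol of a contour decides between leaf and vertex: the grammar
   of contours is LL(1). *)
Lemma contour_prefix G G' R R' :
  compatible G -> compatible G' -> top_edge G = top_edge G' ->
  contour G ++ R = contour G' ++ R' -> G = G' /\ R = R'.
Proof.
elim/dtree_nested_ind: G G' R R' => [e|e cs IHcs] [e'|e' cs'] R R'.
- by move=> _ _ /= -> [->].
- by rewrite contour_node /=; case: cs'.
- by rewrite contour_node /=; case: (cs).
rewrite !compatible_node !contour_node => /and3P[_ /eqP ecs call].
move=> /and3P[_ /eqP ecs' call'] /= ee; subst e'; move: ecs; rewrite -{}ecs'.
move: {1 3}e => x; elim: cs cs' x IHcs call call' => [|c cs IH] [|c' cs'] x //=.
  by move=> _ _ _ _ [->].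
move=> [Pc Pcs] /andP[cc ccs] /andP[cc' ccs'] [eu1 eu2 ecs] [_].
have ec : upper_end c = upper_end c' by rewrite /upper_end eu1 eu2.
rewrite -!catA => /(Pc _ _ _ cc cc')[|{}ec' eR].
  by rewrite (upper_endE ec) /upper_end opp_endK.
subst c'; have [[->] ->] := IH _ _ Pcs ccs ccs' ecs eR.
by [].
Qed.

Lemma contour_head G : tiling_tree m G ->
  exists S, contour G = Some (lab (top_edge G)) :: S.
Proof.
case: G => // e cs; rewrite /tiling_tree compatible_node contour_node /=.
case/and3P=> ee /eqP ecs _; have : M.-1 = (M.-2).+1 by lia.
move=> e1; move: ecs; rewrite e1; case: cs => //= c cs [-> _].
by rewrite sector_nxt; eexists.
Qed.

Lemma around_last x cs e : exists S,
  around x cs e = rcons S (Some (sector (last x (map upper_end cs)) e)).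
Proof.
elim: cs x => [|c cs IHcs] x /=; first by exists [::].
by have [S ->] := IHcs (upper_end c); eexists; rewrite -rcons_cat -rcons_cons.
Qed.

Lemma contour_last G : tiling_tree m G ->
  exists S, contour G = rcons S (Some (lab (prv m (top_edge G)))).
Proof.
case: G => // e cs; rewrite /tiling_tree compatible_node contour_node [_ && _]/=.
case/and3P=> ee /eqP ecs _; have [S ->] := around_last e cs e; exists S.
rewrite ecs last_traject; set y := iter _ _ _; have ny : nxt y = e.
  by rewrite /y -iterS prednK ?iter_nxt //; lia.
have oy : end_ok m y by rewrite /y; elim: M.-1 => //= k; exact: end_ok_nxt.
by rewrite -{1}ny sector_nxt /= -ny nxtK.
Qed.

Lemma end_ok_top G : tiling_tree m G -> end_ok m (top_edge G).
Proof. by case: G => // e cs; rewrite /tiling_tree compatible_node => /and3P[]. Qed.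

(** A vertex has 2m - 2 ends, one of them towards the root, so replacing a leaf by a vertex gains 2m
    - 4 leaves. The root is not counted. *)
Lemma leaf_countE G : compatible G ->
  leaf_count G = (internal_vertices G * (2 * m - 4)).+1.
Proof.
elim/dtree_nested_ind: G => // e cs IHcs; rewrite compatible_node leaf_count_node.
case/and3P=> _ /eqP/(congr1 size); rewrite size_map size_traject => sz call /=.
have : sumn (map leaf_count cs) = (sumn (map internal_vertices cs) * (2 * m - 4) + size cs)%N.
  elim: cs IHcs call {sz} => //= c cs IH [Pc Pcs] /andP[/Pc-> /(IH Pcs)->]; lia.
by rewrite sz => ->; lia.
Qed.

(** The first letter is the sector next to the root edge and determines that edge; then
    [contour_prefix] applies with empty remainders. *)
Lemma contour_inj G G' : tiling_tree m G -> tiling_tree m G' ->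
  contour G = contour G' -> G = G'.
Proof.
move=> tG tG' e; have [S eS] := contour_head tG; have [S' eS'] := contour_head tG'.
have [cG cG'] : compatible G /\ compatible G' by case/andP: tG => _ ->; case/andP: tG'.
have et : top_edge G = top_edge G'.
  by move: e; rewrite eS eS' => -[/(congr1 (end_of m))]; rewrite !labK ?end_ok_top.
by have [] := @contour_prefix G G' [::] [::] cG cG' et; rewrite ?cats0.
Qed.

End Trees.

(** * Sums over the cuts of a sequence *)

Section CutSums.
Variables (A : Type) (V : zmodType).
Implicit Types (F H : seq A -> seq A -> V) (S X Y : seq A).

(** Both trivial cuts are included, which keeps the splitting lemmas free of side conditions;
    weights and words vanish on the empty string. *)
Definition csum F S : V := \sum_(k < (size S).+1) F (take k S) (drop k S).

Lemma csum_nil F : csum F [::] = F [::] [::].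
Proof. by rewrite /csum big_ord_recl big_ord0 addr0. Qed.

Lemma csum_cons F a S :
  csum F (a :: S) = F [::] (a :: S) + csum (fun X Y => F (a :: X) Y) S.
Proof. by rewrite /csum big_ord_recl take0 drop0. Qed.

Lemma eq_csum F H S :
  (forall X Y, X ++ Y = S -> F X Y = H X Y) -> csum F S = csum H S.
Proof. by move=> FH; apply: eq_bigr => k _; apply: FH; rewrite cat_take_drop. Qed.

Lemma csum0 F S : (forall X Y, X ++ Y = S -> F X Y = 0) -> csum F S = 0.
Proof. by move=> F0; rewrite /csum big1 // => k _; apply: F0; rewrite cat_take_drop. Qed.

Lemma csumD F H S : csum (fun X Y => F X Y + H X Y) S = csum F S + csum H S.
Proof. exact: big_split. Qed.

Lemma csum_cat F X a Y :
  csum F (X ++ a :: Y) =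
  csum (fun P Q => F P (Q ++ a :: Y)) X + csum (fun P Q => F (X ++ a :: P) Q) Y.
Proof.
elim: X F => [|b X IHX] F /=; first by rewrite csum_cons csum_nil.
by rewrite !csum_cons IHX addrA.
Qed.

Lemma csum_rcons F S a :
  csum F (rcons S a) = csum (fun P Q => F P (rcons Q a)) S + F (rcons S a) [::].
Proof.
by rewrite -cats1 csum_cat csum_nil; congr (_ + _); apply: eq_csum => P Q _; rewrite cats1.
Qed.

(** Both sides range over the cuts of [S] into three pieces. *)
Lemma csumA (F : seq A -> seq A -> seq A -> V) S :
  csum (fun X Y => csum (fun P Q => F P Q Y) X) S =
  csum (fun P Y => csum (F P) Y) S.
Proof.
elim: S F => [|a S IHS] F; first by rewrite !csum_nil.
rewrite !csum_cons csum_nil -(IHS (fun P => F (a :: P))) -addrA -csumD.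
by congr (_ + _); apply: eq_csum => X Y _; rewrite csum_cons.
Qed.

Lemma csum_eq1 F X Y :
  (forall X' Y', X' ++ Y' = X ++ Y -> size X' <> size X -> F X' Y' = 0) ->
  csum F (X ++ Y) = F X Y.
Proof.
move=> F0; have lX : (size X < (size (X ++ Y)).+1)%N by rewrite size_cat; lia.
rewrite /csum (bigD1 (Ordinal lX)) //= take_size_cat // drop_size_cat //.
rewrite big1 ?addr0 // => k nk; apply: F0; first by rewrite cat_take_drop.
have := ltn_ord k; rewrite size_take => lk e; case/eqP: nk; apply/val_inj => /=.
by move: e; case: ifP; lia.
Qed.

End CutSums.

Lemma csum_mull (A : Type) (R : pzRingType) (F : seq A -> seq A -> R) c S :
  c * csum F S = csum (fun X Y => c * F X Y) S.
Proof. exact: mulr_sumr. Qed.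

Lemma csum_mulr (A : Type) (R : pzRingType) (F : seq A -> seq A -> R) c S :
  csum F S * c = csum (fun X Y => F X Y * c) S.
Proof. exact: mulr_suml. Qed.

Lemma csum_rev (A : Type) (V : zmodType) (F : seq A -> seq A -> V) S :
  csum F (rev S) = csum (fun X Y => F (rev Y) (rev X)) S.
Proof.
elim: S F => [|a S IHS] F; first by rewrite !csum_nil.
rewrite rev_cons csum_rcons csum_cons IHS addrC rev_cons; congr (_ + _).
by apply: eq_csum => X Y _; rewrite rev_cons.
Qed.

Lemma csum_exchange (A A' : Type) (V : zmodType) (F : seq A -> seq A -> seq A' -> seq A' -> V) S S' :
  csum (fun X Y => csum (F X Y) S') S = csum (fun P Q => csum (fun X Y => F X Y P Q) S) S'.
Proof. exact: exchange_big. Qed.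

(** Every cut but the first is indexed by the cut one symbol earlier. This turns a choice of the
    last word of a block into a choice of the first word after a cut. *)
Lemma csum_shift (A : Type) (V : zmodType) (F : seq A -> seq A -> V) S :
  csum F S = csum (fun P Y => if Y is u :: Z then F (rcons P u) Z else 0) S + F [::] S.
Proof.
elim: S F => [|u S IHS] F; first by rewrite !csum_nil add0r.
rewrite !csum_cons IHS /= addrC; congr (_ + _); rewrite addrC; congr (_ + _).
Qed.

Lemma csum_last (A : Type) (V : zmodType) (F : seq A -> seq A -> V) S :
  (forall X Y, X ++ Y = S -> Y <> [::] -> F X Y = 0) -> csum F S = F S [::].
Proof.
move=> F0; rewrite -{1}[S]cats0 csum_eq1 // => X Y; rewrite cats0 => e ns.
by apply: F0 => // eY; rewrite -e eY cats0 in ns.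
Qed.

Lemma csum_first (A : Type) (V : zmodType) (F : seq A -> seq A -> V) S :
  (forall X Y, X ++ Y = S -> X <> [::] -> F X Y = 0) -> csum F S = F [::] S.
Proof.
move=> F0; rewrite -{1}[S]cat0s csum_eq1 // => X Y; rewrite cat0s => e ns.
by apply: F0 => // eX; rewrite eX in ns.
Qed.

Lemma csum_map (A A' : Type) (V : zmodType) (f : A -> A') (F : seq A' -> seq A' -> V) S :
  csum F (map f S) = csum (fun X Y => F (map f X) (map f Y)) S.
Proof. by rewrite /csum size_map; apply: eq_bigr => k _; rewrite map_take map_drop. Qed.

Lemma csum_nilr (A : Type) (V : zmodType) (F : seq A -> seq A -> V) S :
  csum F S = csum (fun X Y => if nilp Y then 0 else F X Y) S + F S [::].
Proof.
elim: S F => [|x S IHS] F; first by rewrite !csum_nil add0r.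
by rewrite !csum_cons IHS addrA.
Qed.

Lemma csum_nill (A : Type) (V : zmodType) (F : seq A -> seq A -> V) S :
  csum F S = csum (fun X Y => if nilp X then 0 else F X Y) S + F [::] S.
Proof.
case: S => [|x S]; first by rewrite !csum_nil add0r.
by rewrite !csum_cons add0r addrC.
Qed.

(** * Sums over the bars of a string *)

Section BarSums.
Variables (A : Type) (V : zmodType).
Implicit Types (F H : seq (option A) -> seq (option A) -> V) (S X Y : seq (option A)).

(** Written as a sum over cuts, those in front of a bar, so that choices of bars and of cuts can be
    exchanged, as in [bsum_csuml]. *)
Definition bsum F S : V :=
  csum (fun X Y => if Y is None :: Y' then F X Y' else 0) S.

Lemma eq_bsum F H S :
  (forall X Y, X ++ None :: Y = S -> F X Y = H X Y) -> bsum F S = bsum H S.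
Proof. by move=> FH; apply: eq_csum => X [|[b|] Y] // /FH. Qed.

Lemma bsum0 F S : (forall X Y, X ++ None :: Y = S -> F X Y = 0) -> bsum F S = 0.
Proof. by move=> F0; apply: csum0 => X [|[b|] Y] // /F0. Qed.

Lemma bsumD F H S : bsum (fun X Y => F X Y + H X Y) S = bsum F S + bsum H S.
Proof.
by rewrite /bsum -csumD; apply: eq_csum => X [|[b|] Y] // _; rewrite addr0.
Qed.

Lemma bsum_nil F : bsum F [::] = 0.
Proof. by rewrite /bsum csum_nil. Qed.

Lemma bsum_letter F a S :
  bsum F (Some a :: S) = bsum (fun X Y => F (Some a :: X) Y) S.
Proof. by rewrite /bsum csum_cons add0r. Qed.

Lemma bsum_bar F S :
  bsum F (None :: S) = F [::] S + bsum (fun X Y => F (None :: X) Y) S.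
Proof. by rewrite /bsum csum_cons. Qed.

Lemma bsum_cat F X Y :
  bsum F (X ++ None :: Y) =
  bsum (fun P Q => F P (Q ++ None :: Y)) X + F X Y +
  bsum (fun P Q => F (X ++ None :: P) Q) Y.
Proof.
elim: X F => [|[b|] X IHX] F /=; first by rewrite bsum_bar bsum_nil add0r.
  by rewrite !bsum_letter IHX.
by rewrite !bsum_bar IHX !addrA.
Qed.

Lemma bsum_letters F w : bsum F (map Some w) = 0.
Proof.
apply: bsum0 => X Y; suff: X ++ None :: Y <> map Some w by [].
by elim: w X => [|a w IHw] [|b X] //= [_ /IHw].
Qed.

Lemma bsum_csuml (F : seq (option A) -> seq (option A) -> seq (option A) -> V) S :
  bsum (fun X Y => csum (fun P Q => F P Q Y) X) S = csum (fun P => bsum (F P)) S.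
Proof.
rewrite -csumA; apply: eq_csum => X [|[b|] Y] // _; by rewrite csum0.
Qed.

Lemma bsum_rcons F S x :
  bsum F (rcons S x) =
  bsum (fun X Y => F X (rcons Y x)) S + (if x is None then F S [::] else 0).
Proof.
elim: S F => [|[a|] S IHS] F /=.
- by case: x => [a|]; rewrite ?bsum_letter ?bsum_bar !bsum_nil ?addr0 ?add0r.
- by rewrite !bsum_letter IHS.
- by rewrite !bsum_bar IHS addrA.
Qed.

Lemma bsum_rev F S : bsum F (rev S) = bsum (fun X Y => F (rev Y) (rev X)) S.
Proof.
elim: S F => [|x S IHS] F; first by rewrite !bsum_nil.
rewrite rev_cons bsum_rcons IHS; case: x => [a|]; rewrite ?bsum_letter ?bsum_bar ?addr0.
  by apply: eq_bsum => X Y _; rewrite rev_cons.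
by rewrite addrC; congr (_ + _); apply: eq_bsum => X Y _; rewrite rev_cons.
Qed.

End BarSums.

(** * The weight of a string *)

Section Weights.
Variables (m : nat) (hm : (3 <= m)%N).
Local Notation C := (bordered m hm).
Local Notation Ct := {poly C}.
Local Notation nxt := (nxt m).
Local Notation lab := (lab m).
Local Notation compatible := (compatible m).
Local Notation tiling_tree := (tiling_tree m).
Local Notation string := (seq (option arrow)).
Local Notation iv := internal_vertices.
Implicit Types (S X Y : string).

Definition weight S : Ct :=
  \sum_(G \in [set G | tiling_tree G /\ contour G = S]%classic) ('X^(iv G) : Ct).
Local Notation T := weight.

Lemma weight_contour G : tiling_tree G -> T (contour G) = 'X^(iv G).
Proof.
move=> tG; rewrite /weight (_ : [set _ | _]%classic = [set G]%classic) ?fsbig_set1 //.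
apply/seteqP; split=> H /=; last by move->.
by case=> tH; move=> e; exact: (contour_inj hm tH tG e).
Qed.

Lemma weight_eq0 S : (forall G, tiling_tree G -> contour G <> S) -> T S = 0.
Proof.
move=> nS; rewrite /weight (_ : [set _ | _]%classic = set0) ?fsbig_set0 //.
by apply/seteqP; split=> // G [/nS].
Qed.

Lemma weight_neq0 S : T S != 0 -> exists2 G, tiling_tree G & contour G = S.
Proof.
move=> nz; apply: contrapT => nS; case/eqP: nz; apply: weight_eq0 => G tG eG.
by apply: nS; exists G.
Qed.

Lemma Xn_neq0 n : 'X^n != 0 :> Ct.
Proof. exact: monic_neq0 (monicXn _ _). Qed.

Lemma weightC S (x : Ct) : T S * x = x * T S.
Proof.
have [->|/weight_neq0[G tG <-]] := eqVneq (T S) 0; first by rewrite mul0r mulr0.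
by rewrite weight_contour // commr_polyXn.
Qed.

Lemma mulT_neq0 X Y : T X * T Y != 0 -> (T X != 0) /\ (T Y != 0).
Proof.
move=> nz; split; apply: contraNneq nz => ->; first by rewrite mul0r.
by rewrite mulr0.
Qed.

(** A boundary word starts with the sector just after the root edge and ends with the one just
    before it; [e] is the end of the root edge at its vertex. *)
Lemma weight_ends S : T S != 0 -> exists e, [/\ end_ok m e,
  exists S', S = Some (lab e) :: S' & exists S', S = rcons S' (Some (lab (prv m e)))].
Proof.
case/weight_neq0=> G tG <-; exists (top_edge G); split.
- exact: end_ok_top tG.
- exact: contour_head.
- exact: contour_last.
Qed.

Lemma weight_nil : T [::] = 0.
Proof. by apply/eqP/negP => /negP/weight_ends[e [_ []]]. Qed.

Lemma weight_bar S : T (None :: S) = 0.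
Proof. by apply/eqP/negP => /negP/weight_ends[e [_ []]]. Qed.

Lemma weight_rcons_bar S : T (rcons S None) = 0.
Proof.
apply/eqP/negP => /negP/weight_ends[e [_ _ [S']]] /(congr1 (last None)).
by rewrite !last_rcons.
Qed.

Lemma weight_letters w : T (map Some w) = 0.
Proof.
apply/eqP/negP => /negP/weight_neq0[G /andP[_ cG] eG].
have := leaf_countE hm cG; rewrite /leaf_count eG.
by have -> : count_mem None (map Some w) = 0%N by elim: (w).
Qed.

Lemma tiling_letter G a S : compatible G -> contour G = Some a :: S -> tiling_tree G.
Proof. by case: G => // e cs cG _; rewrite /tiling_tree cG. Qed.

Lemma tiling_rcons_letter G a S :
  compatible G -> contour G = rcons S (Some a) -> tiling_tree G.
Proof.
case: G => [e|e cs] cG //.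
by case: S => [|? []].
Qed.

(** The root is itself a leaf, on the far side of the root edge. Adding its bar makes the boundary
    word cyclic, and [contour_rotate] reads it from any position. *)
Lemma weight_rotate S A1 A2 : T S != 0 -> S = A1 ++ A2 ->
  exists G H, [/\ compatible G, compatible H, upper_end H = top_edge G,
    A2 ++ None :: A1 = contour G ++ contour H & T S = 'X^(iv G) * 'X^(iv H)].
Proof.
case/weight_neq0=> G tG <- eA; have cG : compatible G by case/andP: tG.
have [//||C [D [cC cD CD e iD]]] := contour_rotate hm (H := Leaf (upper_end G)) cG _ _ eA.
  exact: (opp_endK (top_edge G)).
by exists C, D; split=> //; rewrite weight_contour // -exprD iD addn0.
Qed.

Lemma weight_rot X Y : T (X ++ None :: Y) = T (Y ++ None :: X).
Proof.
have H A B : T (A ++ None :: B) != 0 -> T (A ++ None :: B) = T (B ++ None :: A).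
  move=> nz; have := weight_rotate (A1 := rcons A None) (A2 := B) nz.
  rewrite cat_rcons => /(_ erefl)[G [[e|e cs] [cG cH GH eGH ->]]]; last first.
    have [|S eS] := @contour_last m hm (Node e cs); first exact: cH.
    move: eGH; rewrite eS -rcons_cons -!rcons_cat => /(congr1 (last None)).
    by rewrite !last_rcons.
  move: eGH; rewrite -rcons_cons -rcons_cat [contour (Leaf _)]/= cats1.
  case/rcons_inj=> eG; rewrite mulr1 eG weight_contour //; case: G cG GH eG => [e'|e' cs'].
    by case: B nz => [|b [|? ?]] nz _ _ //= [] // eA; case/eqP: nz; rewrite eA weight_bar.
  by [].
have [e|/H//] := eqVneq (T (X ++ None :: Y)) 0.
by have [->|/H->//] := eqVneq (T (Y ++ None :: X)) 0.
Qed.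

Lemma contour_neq_nil G : contour G <> [::].
Proof. by case: G => // e cs; rewrite contour_node; case: cs. Qed.

(** Between two letters the walk crosses an edge; [a] is the last sector of the tree on one side and
    [b] the first one of the tree on the other side, so [succ_lab] applies. *)
Lemma weight_step X Y a b : T (X ++ Some a :: Some b :: Y) != 0 -> b = succ a.
Proof.
move=> nz; have := weight_rotate (A1 := rcons X (Some a)) (A2 := Some b :: Y) nz.
rewrite cat_rcons => /(_ erefl)[G [H [cG cH GH]]].
case eG : (contour G) => [|x S]; first by case: (contour_neq_nil eG).
rewrite -rcons_cons -rcons_cat => eGH _; have ex : x = Some b by case: eGH.
have tG : tiling_tree G by apply: tiling_letter cG _; rewrite eG ex.
have [S' eS'] := contour_head hm tG; have eb : b = lab (top_edge G).
  by move: eS'; rewrite eG ex => -[].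
have [z [S1 eH]] : exists z S1, contour H = rcons S1 z.
  by case/lastP eH : (contour H) => [|S1 z]; [case: (contour_neq_nil eH) | exists z, S1].
have ez : z = Some a.
  by move: eGH; rewrite eH -rcons_cat => /rcons_inj[].
have tH : tiling_tree H by apply: tiling_rcons_letter cH _; rewrite eH ez.
have [S2] := contour_last hm tH; rewrite eH ez => /rcons_inj[_ ->].
have oH := end_ok_top hm tH; rewrite succ_lab ?end_ok_prv // prvK //.
by rewrite eb -GH.
Qed.

Definition adj (x y : option arrow) : bool :=
  match x, y with
  | Some a, Some b => b == succ a
  | None, None => false
  | _, _ => true
  end.

Definition letter (x : option arrow) : bool := if x is Some a then is_arrow m a else true.

Definition good S : bool := all letter S && sorted adj S.

(* The strings of nonempty words w with nonzero product, separated by bars. *)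
Definition well_formed S : bool := [&& good S, isSome (head None S) & isSome (last None S)].

Lemma good_cat X Y : good (X ++ Y) -> good X /\ good Y.
Proof.
rewrite /good all_cat => /andP[/andP[-> ->]] /cat_sorted2[-> ->].
by [].
Qed.

Lemma sorted_adj X Y x y : sorted adj (X ++ x :: y :: Y) -> adj x y.
Proof. by elim: X => [|z [|z' X] IHX] /=; [case/andP | case/and3P | case/andP => _ /IHX]. Qed.

Lemma well_formed_cons S : well_formed S -> exists a S', S = Some a :: S'.
Proof. by case: S => [|[a|] S] /and3P[] // _ _ _; exists a, S. Qed.

Lemma well_formed_rcons S : well_formed S -> exists a S', S = rcons S' (Some a).
Proof.
case/lastP: S => [|S [a|]] /and3P[] //; last by rewrite last_rcons.
by move=> _ _ _; exists a, S.
Qed.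

Lemma well_formed_bar X Y :
  well_formed X -> well_formed Y -> well_formed (X ++ None :: Y).
Proof.
move=> wX wY; have [a [X' eX]] := well_formed_cons wX.
have [b [Y' eY]] := well_formed_cons wY.
case/and3P: wX => /andP[aX sX] _ lX; case/and3P: wY => /andP[aY sY] _ lY.
rewrite /well_formed last_cat /= {2}eX /= andbC eY /= in lY *; rewrite lY /=.
rewrite /good all_cat aX -eY /= aY /=; move: lX sX; rewrite eX /= cat_path => + ->.
by case: (last _ _) => //= c _; move: sY; rewrite eY.
Qed.

Lemma bar_cat X Y A1 A2 : A1 ++ A2 = X ++ None :: Y ->
  (exists2 Z, X = A1 ++ Z & A2 = Z ++ None :: Y) \/
  (exists2 Z, A1 = X ++ None :: Z & Y = Z ++ A2).
Proof.
elim: X A1 => [|x X IHX] [|a A1] /= => [->|[-> <-]|->|[-> /IHX[[Z -> ->]|[Z -> ->]]]].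
- by left; exists [::].
- by right; exists A1.
- by left; exists (x :: X).
- by left; exists Z.
- by right; exists Z.
Qed.

(** The converse of cutting an edge. Two trees can be glued along their root edges only if these are
    opposite ends of one edge; this is forced by [adj] at the junction of [A1] and [A2], which lies
    between two letters. *)
Lemma weight_glue X Y A1 A2 : X != [::] -> Y != [::] ->
  good (Y ++ None :: X) -> A1 ++ A2 = Y ++ None :: X ->
  T A1 * T A2 != 0 -> T (X ++ Y) = T A1 * T A2.
Proof.
move=> nX nY gYX eA /mulT_neq0[/weight_neq0[G tG eG] /weight_neq0[H tH eH]].
have [[cG cH] [oG oH]] : (compatible G /\ compatible H) /\ (end_ok m (top_edge G) /\ end_ok m (top_edge H)).
  by rewrite !(end_ok_top hm) //; case/andP: tG; case/andP: tH.
have GH : top_edge H = opp_end (top_edge G).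
  have [S eS] := contour_last hm tG; have [S' eS'] := contour_head hm tH.
  move: gYX; rewrite -eA -eG -eH eS eS' cat_rcons => /andP[_ /sorted_adj/=].
  by rewrite succ_lab ?end_ok_prv // prvK // => /eqP/(congr1 (end_of m)); rewrite !labK.
(* The glued tree is read starting at its bar: since the word starts with a bar, [C] is the root
   leaf, and [D] is the tree with boundary word [X ++ Y]. *)
suff [C [D [cC cD eCD iCD]]] : exists C D, [/\ compatible C, compatible D,
    None :: X ++ Y = contour C ++ contour D & (iv C + iv D = iv G + iv H)%N].
  rewrite -eG -eH !weight_contour // -exprD -iCD.
  case: C cC eCD {iCD} => [e|e cs] cC eCD; last first.
    by have [S eS] := @contour_head m hm (Node e cs) cC; move: eCD; rewrite eS.
  case: eCD => eD; rewrite add0n eD weight_contour //.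
  case: D eD cD => // e'; move: nX nY; case: (X) => //= ? [|? ?] //.
  by case: (Y).
have [[Z eX eA2]|[Z eA1 eX]] := bar_cat eA.
  have GH' : upper_end G = top_edge H by rewrite GH.
  rewrite -eH in eA2; have [C [D [cC cD _ e i]]] := contour_rotate hm cH cG GH' eA2.
  by exists C, D; split; rewrite // ?i 1?addnC // -e eG /= eX.
have HG : upper_end H = top_edge G by rewrite -[LHS]/(opp_end _) GH opp_endK.
rewrite -eG in eA1; have [C [D [cC cD _ e i]]] := contour_rotate hm cG cH HG eA1.
by exists C, D; split=> //; rewrite -e eH /= eX -catA.
Qed.

Lemma weight_cut X Y : well_formed X -> well_formed Y ->
  T (X ++ Y) = csum (fun A B => T A * T B) (Y ++ None :: X).
Proof.
move=> wX wY; have [a [X' eX]] := well_formed_rcons wX.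
have [b [Y' eY]] := well_formed_cons wY.
have /and3P[gYX _ _] := well_formed_bar wY wX.
have nX : X != [::] by rewrite eX; case: (X').
have nY : Y != [::] by rewrite eY.
have glue A1 A2 := @weight_glue X Y A1 A2 nX nY gYX.
have [e0|nz] := eqVneq (T (X ++ Y)) 0.
  rewrite e0 csum0 // => A1 A2 eA; apply/eqP; apply: contraT => nz1.
  by move: (nz1); rewrite -(glue _ _ eA nz1) e0 eqxx.
have [G [H [cG cH GH eGH eT]]] := weight_rotate nz erefl.
case eG : (contour G) => [|x S]; first by case: (contour_neq_nil eG).
have ex : x = Some b by move: eGH; rewrite eG eY => -[].
have tG : tiling_tree G by apply: tiling_letter cG _; rewrite eG ex.
have [z [S' eH]] : exists z S', contour H = rcons S' z.
  by case/lastP eH : (contour H) => [|S1 z]; [case: (contour_neq_nil eH) | exists z, S1].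
have ez : z = Some a.
  by move: eGH; rewrite eH eX -rcons_cons -!rcons_cat => /rcons_inj[].
have tH : tiling_tree H by apply: tiling_rcons_letter cH _; rewrite eH ez.
(* No other cut contributes: a contour that is a prefix of the same word has the same first letter,
   hence the same top edge, and [contour_prefix] makes it equal to that of [G]. *)
rewrite eGH csum_eq1 ?weight_contour // => A1 A2 eA ns.
apply/eqP; apply: contraT => /mulT_neq0[/weight_neq0[G' tG' eG'] _]; case: ns.
have [S1 eS1] := contour_head hm tG'; have [S2 eS2] := contour_head hm tG.
have et : top_edge G' = top_edge G.
  move: eA; rewrite -eG' eS1 eS2 => -[/(congr1 (end_of m))].
  by rewrite !labK ?(end_ok_top hm).
have [cG1 cG2] : compatible G' /\ compatible G by case/andP: tG'.
by rewrite -eG' in eA *; have [->] := contour_prefix hm cG1 cG2 et eA.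
Qed.

End Weights.

(** * The relation for strings *)

Section LeftIdentity.
Variables (A : Type) (R : pzRingType).
Local Notation string := (seq (option A)).
(* The properties of T and B are abstracted in order to apply the identity also
   to the reversed strings in the opposite ring. *)
Variables (T B : string -> R) (joins : string -> string -> bool) (ok : string -> Prop).
Implicit Types (S X Y P Q : string).

Hypothesis char2 : forall x : R, x + x = 0.
Hypothesis TC : forall X x, T X * x = x * T X.
Hypothesis T_nil : T [::] = 0.
Hypothesis T_bar : forall S, T (None :: S) = 0.
Hypothesis B_nil : B [::] = 0.
Hypothesis B_bar : forall X Y, B (X ++ None :: Y) = 0.
Hypothesis B_mul : forall X Y, X <> [::] -> Y <> [::] -> B X * B Y = B (X ++ Y).
Hypothesis ok_nil : ~ ok [::].
Hypothesis ok_bar : forall X Y, ok (X ++ None :: Y) -> ok X /\ ok Y.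
Hypothesis ok_suffix : forall X a Y, ok (X ++ Some a :: Y) -> ok (Some a :: Y).
Hypothesis T_cut : forall X Y, ok X -> ok Y ->
  T (X ++ Y) = csum (fun P Q => T P * T (X ++ None :: Q)) Y +
               csum (fun P Q => T Q * T (P ++ None :: Y)) X.
Hypothesis T_joins : forall X Y P Q, ok X -> ok Y -> ~~ joins X Y ->
  X = P ++ Q -> Q <> [::] -> T (Q ++ Y) = 0.
Hypothesis B_joins : forall X Y P Q, ok X -> ok Y -> ~~ joins X Y ->
  Y = P ++ Q -> P <> [::] -> B (X ++ P) = 0.

Definition left_sum S : R := csum (fun U V => B U * T V) S.

Let defect X Y : R := T (X ++ Y) +
  csum (fun V D => T V * T (X ++ None :: D)) Y +
  csum (fun P V => T V * T (P ++ None :: Y)) X.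

Lemma defect0 X Y : ok X -> ok Y -> defect X Y = 0.
Proof. by move=> oX oY; rewrite /defect T_cut // -addrA char2. Qed.

(** The cut between [X] and [Y] occurs in both sums on the right, so in characteristic 2 it has to
    be added a third time. *)
Lemma csum_cat2 (F : string -> string -> R) X Y :
  csum F (X ++ Y) = csum (fun P Q => F P (Q ++ Y)) X +
                    csum (fun P Q => F (X ++ P) Q) Y + F X Y.
Proof.
case: Y => [|y Y].
  rewrite cats0 csum_nil !cats0 -addrA char2 addr0.
  by apply: eq_csum => P Q _; rewrite cats0.
rewrite csum_cat csum_cons cats0 -addrA; congr (_ + _).
by rewrite addrC addrA char2 add0r; apply: eq_csum => P Q _; rewrite -cat_rcons.
Qed.

Lemma left_bar X Y : left_sum (X ++ None :: Y) = csum (fun P Q => B P * T (Q ++ None :: Y)) X.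
Proof.
rewrite /left_sum csum_cat [X in _ + X]csum0 ?addr0 // => P Q _.
by rewrite B_bar mul0r.
Qed.

Lemma mul_left X Y : X <> [::] ->
  B X * left_sum Y = csum (fun P Q => B (X ++ P) * T Q) Y + B X * T Y.
Proof.
move=> nX; rewrite /left_sum csum_mull; case: Y => [|y Y].
  by rewrite !csum_nil B_nil T_nil !mulr0 addr0.
rewrite !csum_cons B_nil mul0r mulr0 add0r cats0 addrC addrA char2 add0r.
by apply: eq_csum => P Q _; rewrite mulrA B_mul.
Qed.

(** Grouping by the left factor [B P] leaves as its cofactor the sum of [defect Q Y] over the bars
    of the string after [P]. If that string starts with a letter, [T_cut] makes each defect 0. If it
    starts with a bar, only the empty [Q] contributes; its defect is [T Y], which cancels against
    the separate term [B X * T Y]. *)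
Lemma left_identity S : ok S ->
  bsum (fun X Y => (if joins X Y then left_sum (X ++ Y) + B X * T Y else 0)
    + B X * left_sum Y
    + csum (fun V D => T V * left_sum (X ++ None :: D)) Y
    + csum (fun P V => T V * left_sum (P ++ None :: Y)) X) S = 0.
Proof.
move=> oS.
have E X Y : X ++ None :: Y = S ->
  (if joins X Y then left_sum (X ++ Y) + B X * T Y else 0) + B X * left_sum Y
    + csum (fun V D => T V * left_sum (X ++ None :: D)) Y
    + csum (fun P V => T V * left_sum (P ++ None :: Y)) X =
  csum (fun P Q => B P * defect Q Y) X + B X * T Y.
  move=> eS; rewrite -eS in oS; have [oX oY] := ok_bar oS.
  have nX : X <> [::] by move=> eX; apply: ok_nil; rewrite -eX.
  have -> : csum (fun P Q => B P * defect Q Y) X =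
     csum (fun P Q => B P * T (Q ++ Y)) X +
     csum (fun V D => T V * left_sum (X ++ None :: D)) Y +
     csum (fun P V => T V * left_sum (P ++ None :: Y)) X.
    under [X in _ + X + _]eq_csum => V D _ do rewrite left_bar csum_mull.
    under [X in _ + X]eq_csum => P V _ do rewrite left_bar csum_mull.
    rewrite csum_exchange csumA -!csumD; apply: eq_csum => P Q _.
    rewrite /defect !mulrDr !csum_mull; congr (_ + _ + _);
    by apply: eq_csum => U V _; rewrite !mulrA TC.
  rewrite [RHS]addrAC; congr (_ + _); rewrite [RHS]addrAC; congr (_ + _).
  rewrite mul_left //; case: ifPn => [_|nj].
    rewrite /left_sum csum_cat2 -!addrA; congr (_ + _).
    by rewrite [X in _ + X]addrA char2 add0r addrA char2 add0r.
  (* Without a join, [T_joins] and [B_joins] leave one trivial cut in each sum, and both remaining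
     terms are [B X * T Y]. *)
  rewrite add0r; congr (_ + _).
  rewrite -[X in _ = csum _ X]cats0 -[X in csum _ X = _]cat0s !csum_eq1 ?cats0 // => P Q eX ns.
    by rewrite (T_joins oX oY nj (esym eX)) ?mulr0 // => eQ; rewrite -eX eQ cats0 in ns.
  by rewrite (B_joins oX oY nj (esym eX)) ?mul0r // => eP; rewrite eP in ns.
rewrite (eq_bsum E) bsumD bsum_csuml /bsum -csumD; apply: csum0 => P [|[a|] S'] eS.
- by rewrite csum_nil addr0.
- rewrite addr0; apply: csum0 => X [|[b|] Y] // eXY.
  have oXY : ok (X ++ None :: Y) by rewrite eXY; rewrite -eS in oS; apply: ok_suffix oS.
  by have [oX oY] := ok_bar oXY; rewrite defect0 ?mulr0.
- rewrite csum_cons -/(bsum _ _) bsum0 => [|X Y _].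
    rewrite addr0 /defect csum_nil T_nil mul0r addr0 csum0 ?addr0 ?char2 // => V D _.
    by rewrite T_bar mulr0.
  rewrite /defect.
  have -> : csum (fun V D => T V * T ((None :: X) ++ None :: D)) Y = 0.
    by apply: csum0 => V D _; rewrite T_bar mulr0.
  rewrite T_bar !add0r csum0 ?mulr0 // => -[|v V] D /= [].
    by move=> ->; rewrite T_bar mul0r.
  by move=> -> _; rewrite T_bar mulr0.
Qed.

End LeftIdentity.

Section Strings.
Variables (m : nat) (hm : (3 <= m)%N).
Local Notation C := (bordered m hm).
Local Notation Ct := {poly C}.
Local Notation string := (seq (option arrow)).
Local Notation T := (weight hm).
Local Notation well_formed := (well_formed m).
Implicit Types (S X Y : string) (w u v : seq arrow).

(* Meaningful for nonempty w only: aU1 is a dummy. *)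
Definition pathw w : C := cls hm (zero_rel m) (src m (head aU1 w), w).

Definition is_word w : bool := [&& w != [::], all (is_arrow m) w & sorted (fun a b => b == succ a) w].

Lemma is_rpath_word x w : w != [::] ->
  is_rpath m (zero_rel m) (x, w) = (src m (head aU1 w) == x) && is_word w.
Proof.
case: w => // a w _; rewrite /is_rpath /is_word /=.
have [<-|] := eqVneq (src m a) x; last by rewrite !andbF.
have [ha|] := boolP (is_arrow m a); last by rewrite andbF.
have -> : is_vertex m (src m a).
  by rewrite -[a]succK tgt_succ is_vertex_tgt // is_arrow_succ.
elim: w a ha => //= b w IHw a ha; have [hb|] := boolP (is_arrow m b) => //=.
rewrite -(nonzero_step hm) //; have [e|] := eqVneq (src m b) (tgt m a) => //=.
  by rewrite !(andbCA _ (~~ _)) IHw.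
by rewrite andbF.
Qed.

Lemma pathw0 w : w != [::] -> ~~ is_word w -> pathw w = 0.
Proof. by move=> nw iw; apply: cls0; rewrite is_rpath_word // eqxx. Qed.

Lemma pathw_mul u v : u != [::] -> v != [::] -> pathw u * pathw v = pathw (u ++ v).
Proof.
move=> nu nv; rewrite /pathw mul_cls /=; case: eqP => [_|ne].
  by case: u nu.
apply/esym/cls0; apply/negP => /and3P[/= _]; rewrite composable_cat => /andP[_].
case: v nv ne => // b v _ ne /= /and3P[_ /eqP e _] _; apply: ne.
by rewrite e; case: (u) nu.
Qed.

Lemma char2C (x : Ct) : x + x = 0.
Proof.
have c2 (y : C) : y + y = 0.
  by rewrite -[y]scale1r -scalerDl (_ : 1 + 1 = 0 :> 'F_2) ?scale0r //; apply/val_inj.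
by apply/polyP => i; rewrite coefD coef0 c2.
Qed.

(** Zero on the empty string and on strings with a bar, so that a sum over all cuts selects by
    itself the cuts with a pure factor. *)
Definition wordB S : Ct :=
  if (S != [::]) && all isSome S then (pathw (pmap id S))%:P else 0.
Local Notation B := wordB.

Lemma pmap_Some w : pmap id (map Some w) = w.
Proof. by elim: w => //= a w ->. Qed.

Lemma wordB_map w : w != [::] -> B (map Some w) = (pathw w)%:P.
Proof.
by case: w => // a w _; rewrite /B pmap_Some /= (_ : all _ _ = true) //; elim: w.
Qed.

Lemma wordB_nil : B [::] = 0. Proof. by []. Qed.

Lemma wordB_bar X Y : B (X ++ None :: Y) = 0.
Proof. by rewrite /B all_cat /= !andbF. Qed.

Lemma some_map S : all isSome S -> exists w, S = map Some w.
Proof.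
elim: S => [|[a|] S IHS] //= => [_|/IHS[w ->]]; first by exists [::].
by exists (a :: w).
Qed.

Lemma wordB_neq0 S : B S != 0 -> exists2 w, S = map Some w & is_word w.
Proof.
rewrite /B; case: ifP => [/andP[nS /some_map[w ew]]|_]; last by rewrite eqxx.
have nw : w != [::] by move: nS; rewrite ew; case: (w).
rewrite ew pmap_Some => nz; exists w => //.
by apply: contraNT nz => /(pathw0 nw) ->; rewrite polyC0.
Qed.

Lemma wordB_mul X Y : X <> [::] -> Y <> [::] -> B X * B Y = B (X ++ Y).
Proof.
move=> /eqP nX /eqP nY; rewrite {3}/B all_cat; have -> : X ++ Y != [::] by case: X nX.
rewrite /B nX nY /=; have [/some_map[u eu]|_] := boolP (all isSome X); last by rewrite mul0r.
have [/some_map[v ev]|_] := boolP (all isSome Y); last by rewrite mulr0.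
rewrite eu ev -map_cat !pmap_Some -polyCM pathw_mul //.
  by move: nX; rewrite eu; case: (u).
by move: nY; rewrite ev; case: (v).
Qed.

(** The condition under which multiplying the last word of [X] by the first word of [Y] just deletes
    the bar; otherwise the product is 0. *)
Definition joins X Y : bool :=
  match last None X, head None Y with Some a, Some b => b == succ a | _, _ => false end.

Lemma weight_joins X Y : isSome (last None X) -> isSome (head None Y) ->
  ~~ joins X Y -> T (X ++ Y) = 0.
Proof.
case/lastP: X => // X [a|]; rewrite last_rcons //; case: Y => // [[b|]] Y // _ _.
rewrite /joins last_rcons /= => nj; apply/eqP; apply: contraNT nj.
by rewrite cat_rcons => /weight_step->.
Qed.

Lemma wordB_joins X Y : isSome (last None X) -> isSome (head None Y) ->
  ~~ joins X Y -> B (X ++ Y) = 0.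
Proof.
case/lastP: X => // X [a|]; rewrite last_rcons //; case: Y => // [[b|]] Y // _ _.
rewrite /joins last_rcons /= => nj; apply/eqP; apply: contraNT nj.
rewrite cat_rcons => /wordB_neq0[w ew /and3P[_ _ sw]].
have : sorted (fun x y : option arrow => if (x, y) is (Some a, Some b) then b == succ a else true) (map Some w).
  by rewrite sorted_map.
rewrite -ew; elim: X {w ew sw} => [|x X IHX] /=; first by case/andP.
by move/path_sorted.
Qed.

Lemma well_formed_barP X Y : well_formed (X ++ None :: Y) -> well_formed X /\ well_formed Y.
Proof.
case/and3P=> g hX lY; have [gX gY] := good_cat g.
have gY' : good m Y by case/andP: gY => aY /path_sorted sY; apply/andP.
rewrite /well_formed gX gY' /=; case/andP: g => _ g.
split; apply/andP; split.
- by case: (X) hX.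
- case/lastP: (X) hX g => // Z x _; rewrite last_rcons cat_rcons => /sorted_adj.
  by case: x.
- by case: (Y) lY g => [|y Z]; [rewrite last_cat | move=> _ /sorted_adj; case: y].
- by case: (Y) lY => [|y Z]; rewrite last_cat.
Qed.

Lemma well_formed_suffix X a Y : well_formed (X ++ Some a :: Y) -> well_formed (Some a :: Y).
Proof.
case/and3P=> g _ lY; have [_ gY] := good_cat g.
by rewrite /well_formed gY; move: lY; rewrite last_cat.
Qed.

Lemma well_formed_prefix X a Y : well_formed (X ++ Some a :: Y) -> well_formed (rcons X (Some a)).
Proof.
case/and3P; rewrite -cat_rcons => g hX _; have [gX _] := good_cat g.
by rewrite /well_formed gX last_rcons andbT; case: (X) hX.
Qed.

Lemma well_formed_head S : well_formed S -> isSome (head None S).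
Proof. by case/and3P. Qed.

Lemma well_formed_last S : well_formed S -> isSome (last None S).
Proof. by case/and3P. Qed.

(** The cuts of [Y|X] lie in [Y] or in [X]; the factor that contains the bar is rotated to put the
    remainders back in their order in [X|Y], as inputs of an outer operation. *)
Lemma weight_cut_edges X Y : well_formed X -> well_formed Y ->
  T (X ++ Y) = csum (fun P Q => T P * T (X ++ None :: Q)) Y +
               csum (fun P Q => T Q * T (P ++ None :: Y)) X.
Proof.
move=> wX wY; rewrite weight_cut // csum_cat; congr (_ + _); apply: eq_csum => P Q _.
  by rewrite weight_rot.
by rewrite weightC weight_rot.
Qed.

Local Notation left_part := (left_sum T B).

Definition right_part S : Ct := csum (fun U V => T U * B V) S.

Lemma string_left S : well_formed S ->
  bsum (fun X Y => (if joins X Y then left_part (X ++ Y) + B X * T Y else 0)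
    + B X * left_part Y
    + csum (fun V D => T V * left_part (X ++ None :: D)) Y
    + csum (fun P V => T V * left_part (P ++ None :: Y)) X) S = 0.
Proof.
apply: (left_identity (ok := well_formed)).
- exact: char2C.
- exact: weightC.
- exact: weight_nil.
- exact: weight_bar.
- exact: wordB_nil.
- exact: wordB_bar.
- exact: wordB_mul.
- by [].
- exact: well_formed_barP.
- exact: well_formed_suffix.
- exact: weight_cut_edges.
- move=> X Y P Q oX oY nj eX nQ; apply: weight_joins (well_formed_head oY) _.
    by move: (well_formed_last oX); rewrite eX last_cat; case: (Q) nQ.
  by move: nj; rewrite /joins eX last_cat; case: (Q) nQ.
- move=> X Y P Q oX oY nj eY nP; apply: wordB_joins (well_formed_last oX) _ _.
    by move: (well_formed_head oY); rewrite eY; case: (P) nP.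
  by move: nj; rewrite /joins eY; case: (P) nP.
Qed.

(* The mirror image of string_left: reverse all strings and multiply in the
   opposite ring. *)
Lemma string_right S : well_formed S ->
  bsum (fun X Y => (if joins X Y then right_part (X ++ Y) + T X * B Y else 0)
    + right_part X * B Y
    + csum (fun V D => T V * right_part (X ++ None :: D)) Y
    + csum (fun P V => T V * right_part (P ++ None :: Y)) X) S = 0.
Proof.
have rpE X : right_part X = left_sum (R := Ct^c) (T \o rev) (B \o rev) (rev X).
  by rewrite /left_sum csum_rev; apply: eq_csum => U V _; rewrite /= !revK.
move=> wS.
apply: (etrans _ (@left_identity arrow Ct^c (T \o rev) (B \o rev)
  (fun X Y => joins (rev Y) (rev X)) (fun S => well_formed (rev S))
  _ _ _ _ _ _ _ _ _ _ _ _ _ (rev S) _)).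
- rewrite bsum_rev; apply: eq_bsum => X Y _; rewrite !revK !rpE rev_cat.
  rewrite addrAC; congr (_ + _ + _).
    by rewrite /= !revK.
    rewrite csum_rev; apply: eq_csum => P V _ /=.
    by rewrite revK weightC rpE rev_cat rev_cons cat_rcons.
    rewrite csum_rev; apply: eq_csum => V D _ /=.
    by rewrite revK weightC rpE rev_cat rev_cons cat_rcons.
- exact: char2C.
- by move=> X x; apply/esym/weightC.
- exact: weight_nil.
- by move=> X; rewrite /= rev_cons weight_rcons_bar.
- exact: wordB_nil.
- by move=> X Y; rewrite /= rev_cat rev_cons cat_rcons wordB_bar.
- move=> X Y nX nY; rewrite /= rev_cat; apply: wordB_mul => e.
    by apply: nY; rewrite -[Y]revK e.
  by apply: nX; rewrite -[X]revK e.
- by [].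
- by move=> X Y; rewrite rev_cat rev_cons cat_rcons => /well_formed_barP[].
- move=> X a Y; rewrite rev_cat rev_cons cat_rcons; exact: well_formed_prefix.
- move=> X Y oX oY; rewrite /= rev_cat (weight_cut_edges oY oX) addrC !csum_rev.
  by congr (_ + _); apply: eq_csum => P Q _; rewrite /= rev_cat rev_cons cat_rcons [LHS]weightC.
- move=> X Y P Q oX oY nj eX nQ; rewrite /= rev_cat; apply: weight_joins (well_formed_last oY) _ _.
    by move: (well_formed_head oX); rewrite eX rev_cat; case/lastP: (Q) nQ => // Q' q _; rewrite rev_rcons.
  by move: nj; rewrite /joins eX rev_cat; case/lastP: (Q) nQ => // Q' q _; rewrite rev_rcons.
- move=> X Y P Q oX oY nj eY nP; rewrite /= rev_cat; apply: wordB_joins _ (well_formed_head oX) _.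
    by move: (well_formed_last oY); rewrite eY rev_cat last_cat; case: (P) nP => // p P' _; rewrite rev_cons !last_rcons.
  by move: nj; rewrite /joins eY rev_cat last_cat; case: (P) nP => // p P' _; rewrite rev_cons !last_rcons.
- by rewrite revK.
Qed.

(** For a boundary word this is the idempotent of the root: the first sector is an arrow starting at
    the label of the root edge, by [src_lab]. *)
Definition source S : Ct :=
  if head None S is Some a then (idem hm (zero_rel m) (src m a))%:P else 0.

Definition central_part S : Ct := source S * T S.

Definition string_mu S : Ct := central_part S + left_part S + right_part S.

Lemma bsum_letters_bar (V : zmodType) (F : string -> string -> V) w Y :
  bsum F (map Some w ++ None :: Y) =
  F (map Some w) Y + bsum (fun P Q => F (map Some w ++ None :: P) Q) Y.
Proof. by rewrite bsum_cat bsum_letters add0r. Qed.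

Lemma right_bar X Y : right_part (X ++ None :: Y) = csum (fun P Q => T (X ++ None :: P) * B Q) Y.
Proof.
rewrite /right_part csum_cat csum0 ?add0r // => P Q _.
by rewrite wordB_bar mulr0.
Qed.

Lemma left_letters w : left_part (map Some w) = 0.
Proof.
apply: csum0 => P Q e; have -> : Q = map Some (drop (size P) w).
  by rewrite map_drop -e drop_size_cat.
by rewrite weight_letters mulr0.
Qed.

Lemma right_letters w : right_part (map Some w) = 0.
Proof.
apply: csum0 => P Q e; have -> : P = map Some (take (size P) w).
  by rewrite map_take -e take_size_cat.
by rewrite weight_letters mul0r.
Qed.

(* What is left of the relation, after all cancellations by left_identity, of
   the terms with an outer extension on the left; outer_right is its mirror image. *)
Definition outer_left S : Ct :=
  bsum (fun X Y => (if joins X Y then B X * T Y else 0)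
    + B X * central_part Y + B X * right_part Y) S
  + csum (fun P V => T V * left_part P) S.

Definition outer_right S : Ct :=
  bsum (fun X Y => (if joins X Y then T X * B Y else 0)
    + central_part X * B Y + left_part X * B Y) S
  + csum (fun V D => T V * right_part D) S.

Lemma wordB_source X Y c d : last None X = Some c -> head None Y = Some d ->
  B X * source Y = if tgt m c == src m d then B X else 0.
Proof.
move=> lX hY; have [->|/wordB_neq0[w eX iw]] := eqVneq (B X) 0.
  by rewrite mul0r if_same.
have nw : w != [::] by case/and3P: iw.
rewrite eX wordB_map // /source hY -polyCM /pathw /idem mul_cls /path_end /= cats0.
have -> : last (src m (head aU1 w)) (map (tgt m) w) = tgt m c.
  move: lX nw; rewrite eX; case: (w) => // x w' /= lX _.
  by rewrite last_map; move: lX; rewrite last_map => -[->].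
by case: ifP; rewrite ?polyC0.
Qed.

Lemma source_wordB X Y c d : head None X = Some d -> head None Y = Some c ->
  source X * B Y = if src m c == src m d then B Y else 0.
Proof.
move=> hX hY; have [->|/wordB_neq0[w eY iw]] := eqVneq (B Y) 0.
  by rewrite mulr0 if_same.
have nw : w != [::] by case/and3P: iw.
rewrite eY wordB_map // /source hX -polyCM /pathw /idem mul_cls /path_end /= eq_sym.
have -> : src m (head aU1 w) = src m c by move: hY; rewrite eY; case: (w) nw => //= x w' _ [->].
by case: eqP => [->|]; rewrite ?polyC0.
Qed.

(** * Overlaps of the first and the last input *)

Section Alignment.
Variables (a b : arrow) (p q : nat) (Q : string).
Local Notation tr x k := (map Some (traject succ x k)).
Hypothesis p0 : (0 < p)%N.
Hypothesis q0 : (0 < q)%N.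
Hypothesis wS : well_formed (tr a p ++ None :: Q ++ None :: tr b q).

(* Lay the two words along the periodic line that continues them: the terms are
   indexed by the length k of the output, and w = p + q - k remains. *)
Let term k : Ct :=
  if iter k succ a == iter q succ b
  then B (tr a k) * T (tr b (p + q - k) ++ None :: Q) else 0.

Let trD x k l : tr x (k + l) = tr x k ++ tr (iter k succ x) l.
Proof. by rewrite trajectD map_cat. Qed.

Let take_tr x n k : (k <= n)%N -> take k (tr x n) = tr x k.
Proof. by move=> kn; rewrite -map_take take_traject. Qed.

Let drop_tr x n k : (k <= n)%N -> drop k (tr x n) = tr (iter k succ x) (n - k).
Proof.
by move=> kn; rewrite -{1}(subnKC kn) trD drop_size_cat // size_map size_traject.
Qed.

Let size_tr x n : size (tr x n) = n.
Proof. by rewrite size_map size_traject. Qed.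

Let csum_tr (F : string -> string -> Ct) x n :
  csum F (tr x n) = \sum_(k < n.+1) F (tr x k) (tr (iter k succ x) (n - k)).
Proof.
rewrite /csum size_tr; apply: eq_bigr => k _.
by rewrite take_tr ?drop_tr // -ltnS.
Qed.

Let last_tr x n : (0 < n)%N -> last None (tr x n) = Some (iter n.-1 succ x).
Proof. by case: n => // n _; rewrite trajectSr map_rcons last_rcons. Qed.

Let head_tr x n : (0 < n)%N -> head None (tr x n) = Some x.
Proof. by case: n. Qed.

Let joins_tr x n y Y : (0 < n)%N -> head None Y = Some y ->
  joins (tr x n) Y = (y == iter n succ x).
Proof. by case: n => // n n0 hY; rewrite /joins last_tr // hY -iterS. Qed.

Let iter_succ_inj n : injective (iter n succ).
Proof. by elim: n => // n IHn x y /(can_inj succK)/IHn. Qed.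

Let tr_neq0 x n : (0 < n)%N -> tr x n <> [::].
Proof. by case: n. Qed.

Let head_cat_tr x n Y : (0 < n)%N -> head None (tr x n ++ Y) = Some x.
Proof. by case: n. Qed.

Let well_formed_tr_suffix x n k : (k < n)%N -> well_formed (tr x n) ->
  well_formed (tr (iter k succ x) (n - k)).
Proof.
move=> kn; rewrite -{1}(subnKC (ltnW kn)) trD.
have : (0 < n - k)%N by rewrite subn_gt0.
by case: (n - k)%N => // l _; rewrite trajectS map_cons; exact: well_formed_suffix.
Qed.

Let well_formed_tr_prefix x n k : (0 < k <= n)%N -> well_formed (tr x n) ->
  well_formed (tr x k).
Proof.
case/andP=> k0 kn; rewrite -{1}(subnKC kn) trD.
by case: k k0 kn => // k _ _; rewrite trajectSr map_rcons cat_rcons; exact: well_formed_prefix.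
Qed.

(** Used with [i] the length of the first word and with [i] that of the last one: comparing the
    output length with them gives the two sign distinctions on the periodic line. *)
Let sum_split (F : nat -> Ct) i j :
  \sum_(k < (i + j).+1) F k = \sum_(k < i) F k + F i + \sum_(k < j) F (i + j - k)%N.
Proof.
rewrite -(big_mkord xpredT F) (big_cat_nat (n := i.+1)) //=; last by rewrite ltnS leq_addr.
rewrite big_nat_recr //= big_mkord; congr (_ + _).
rewrite -[X in \sum_(X <= _ < _) _]add0n big_addn -addSn addnC addnK big_nat_rev /= big_mkord.
by apply: eq_bigr => k _; congr F; have := ltn_ord k; lia.
Qed.

Let sum_rev0 (F : nat -> Ct) n : F 0%N = 0 -> \sum_(k < n.+1) F k = \sum_(k < n) F (n - k)%N.
Proof.
move=> F0; rewrite big_ord_recl /= F0 add0r (reindex_inj rev_ord_inj) /=.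
by apply: eq_bigr => k _; congr F; have := ltn_ord k; rewrite /bump; lia.
Qed.

Lemma outer_left_alignment :
  outer_left (tr a p ++ None :: Q ++ None :: tr b q) = \sum_(k < (p + q).+1) term k.
Proof.
have [wa wQb] := well_formed_barP wS; have [wQ wb] := well_formed_barP wQb.
rewrite /outer_left bsum_letters_bar bsum0 => [|X Y _]; last first.
  by rewrite !wordB_bar !mul0r if_same !addr0.
(* The three goals are the alignments k = p, where the output is the first word, k > p, where it
   also contains the end of the last word, and k < p, where it is a proper prefix of the first
   word. *)
rewrite addr0 sum_split [RHS](AC 3 (2 * 3 * 1)) /=; congr (_ + _ + _).
- set R := Q ++ None :: tr b q; rewrite /term addKn.
  have eR : T (tr b q ++ None :: Q) = T R by rewrite weight_rot.
  rewrite eR /central_part; have [->|nR] := eqVneq (T R) 0; first by rewrite !mulr0 !if_same addr0.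
  have [e [oe [R1 eR1] [R2 eR2]]] := weight_ends nR.
  have lb : iter q.-1 succ b = lab m (prv m e).
    have := congr1 (last None) eR2; rewrite last_rcons last_cat /= => h.
    by apply: Some_inj; rewrite -h -last_tr //; case: (q) q0.
  have hR : head None R = Some (lab m e) by rewrite eR1.
  (* The two products cancel when the letters join. What survives is the case where they meet at a
     vertex without joining; by [other_arrow] the two words then end with the same arrow, which is
     the condition in [term]. *)
  rewrite mulrA (wordB_source (last_tr a p0) hR) (joins_tr a p0 hR).
  have ac : is_arrow m (iter p.-1 succ a) by elim: p.-1 => [|n IHn] /=; rewrite ?is_arrow_succ //; case/and3P: wa => /andP[]; case: (p) p0 => //= n _ /andP[].
  have ep : iter p succ a = succ (iter p.-1 succ a) by rewrite -iterS prednK.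
  have eq : iter q succ b = succ (iter q.-1 succ b) by rewrite -iterS prednK.
  rewrite ep eq lb (inj_eq (can_inj succK)) -(other_arrow hm ac oe).
  have [->|ne] := eqVneq (lab m e) (succ _); first by rewrite tgt_succ eqxx andbF char2C.
  by rewrite add0r andbT; case: ifP => // _; rewrite mul0r.
- rewrite right_bar csum_mull csum_tr big_ord_recr /= subnn wordB_nil mulr0 mulr0 addr0.
  apply: eq_bigr => k _; have kq := ltn_ord k; rewrite /term.
  have eT : T (tr b (p + q - (p + q - k)) ++ None :: Q) = T (Q ++ None :: tr b k).
    by rewrite weight_rot; congr (T (_ ++ _ :: map _ (traject _ _ _))); lia.
  have q_k : (0 < q - k)%N by rewrite subn_gt0.
  rewrite eT weightC mulrA.
  have ec : (iter (p + q - k) succ a == iter q succ b) = (iter p succ a == iter k succ b).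
    have -> : (p + q - k = (q - k) + p)%N by lia.
    have -> : iter q succ b = iter (q - k) succ (iter k succ b) by rewrite -iterD subnK // ltnW.
    by rewrite iterD; apply: inj_eq; exact: iter_succ_inj.
  rewrite ec; case: eqP => [e|/eqP ne].
    by rewrite (wordB_mul (@tr_neq0 _ _ p0) (@tr_neq0 _ _ q_k)) -e -trD; congr (B (map _ (traject _ _ _)) * _); lia.
  rewrite (wordB_mul (@tr_neq0 _ _ p0) (@tr_neq0 _ _ q_k)) wordB_joins ?mul0r ?last_tr ?head_tr //.
  by rewrite (joins_tr _ p0 (head_tr _ q_k)) eq_sym.
- under eq_csum => P V _ do rewrite csum_mull.
  rewrite csumA csum_cat [X in _ + X]csum0 ?addr0 => [|P Y _]; last first.
    by apply: csum0 => U V _; rewrite wordB_bar mul0r mulr0.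
  rewrite csum_tr big_ord_recr /= subnn [X in _ + X]csum0 ?addr0; last first.
    case=> [|x U] V /= []; first by rewrite weight_nil !mulr0.
    by move=> -> _; rewrite weight_bar !mulr0.
  apply: eq_bigr => k _; have kp := ltn_ord k.
  have p_k : (0 < p - k)%N by rewrite subn_gt0.
  have wa' := well_formed_tr_suffix kp wa.
  (* The cut formula read backwards: the sum of products of two weights becomes the weight of the
     last word followed by the rest of the first one. *)
  transitivity (B (tr a k) * T (tr b q ++ (tr (iter k succ a) (p - k) ++ None :: Q))).
    rewrite (weight_cut hm wb (well_formed_bar wa' wQ)) csum_mull -catA cat_cons.
    by apply: eq_csum => U V _; rewrite [LHS]weightC mulrA.
  rewrite /term; case: eqP => [e|/eqP ne].
    by rewrite catA e -trD; congr (_ * T (map _ (traject _ _ _) ++ _)); lia.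
  rewrite weight_joins ?mulr0 ?last_tr ?head_cat_tr //.
  by rewrite (joins_tr _ q0 (head_cat_tr _ _ p_k)).
Qed.

(** The same terms, now split at k = q, the alignment in which the two words start together. *)
Lemma outer_right_alignment :
  outer_right (tr a p ++ None :: Q ++ None :: tr b q) = \sum_(k < (p + q).+1) term k.
Proof.
have [wa wQb] := well_formed_barP wS; have [wQ wb] := well_formed_barP wQb.
have wR := well_formed_bar wa wQ; rewrite [(p + q)%N]addnC sum_split.
set R := tr a p ++ None :: Q; have -> : tr a p ++ None :: Q ++ None :: tr b q = R ++ None :: tr b q.
  by rewrite -catA.
rewrite /outer_right bsum_cat bsum_letters addr0 [bsum _ R]bsum0 => [|X Y _]; last first.
  by rewrite !wordB_bar !mulr0 if_same !addr0.
rewrite add0r [RHS](AC 3 (2 * 3 * 1)) /=; congr (_ + _ + _).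
- rewrite /term addnK; have [e0|nR] := eqVneq (T R) 0.
    rewrite /central_part e0 mulr0 !mul0r if_same addr0; case: eqP => // e.
    by rewrite -[b](iter_succ_inj e) e0 mulr0.
  have [e [oe [R1 eR1] [R2 eR2]]] := weight_ends nR.
  have ea : a = lab m e.
    by have := congr1 (head None) eR1; rewrite head_cat_tr // => -[].
  have lQ : last None R = Some (lab m (prv m e)) by rewrite eR2 last_rcons.
  have hR : head None R = Some (lab m e) by rewrite eR1.
  have bc : is_arrow m b by case/and3P: wb => /andP[]; case: (q) q0 => //= n _ /andP[].
  have -> : joins R (tr b q) = (b == succ (lab m (prv m e))) by rewrite /joins lQ head_tr.
  rewrite /central_part -(weightC R (source R)) -mulrA (source_wordB hR (head_tr b q0)).
  have -> : (iter q succ a == iter q succ b) = (b == lab m e).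
    by rewrite (inj_eq (@iter_succ_inj q)) ea eq_sym.
  (* As on the left, the two products cancel when the letters join; otherwise [other_arrow_out]
     shows that they survive exactly when both words start with the same arrow. *)
  have H := other_arrow_out hm bc oe; have [be|nb] := eqVneq b (succ _).
    have -> : src m b == src m (lab m e).
      by rewrite be tgt_succ tgt_lab ?end_ok_prv // prvK // src_lab.
    by rewrite -H -be eqxx andbF char2C.
  move: H; rewrite nb andbT add0r => ->; case: eqP => [eb|]; last by rewrite mulr0.
  by rewrite weightC /R eb ea.
- rewrite left_bar; last exact: wordB_bar.
  rewrite csum_mulr csum_tr.
  rewrite (sum_rev0 (F := fun k => B (tr a k) * T (tr (iter k succ a) (p - k) ++ None :: Q) * B (tr b q))) ?mul0r //.
  apply: eq_bigr => k _; have kp := ltn_ord k; rewrite /term.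
  have p_k : (0 < p - k)%N by rewrite subn_gt0.
  have -> : (q + p - k = q + (p - k))%N by lia.
  have -> : (p + q - (q + (p - k)) = p - (p - k))%N by lia.
  rewrite iterD (inj_eq (@iter_succ_inj q)) -mulrA weightC mulrA; case: eqP => [e|/eqP ne].
    by rewrite (wordB_mul (@tr_neq0 _ _ p_k) (@tr_neq0 _ _ q0)) [(q + _)%N]addnC trD e.
  rewrite (wordB_mul (@tr_neq0 _ _ p_k) (@tr_neq0 _ _ q0)) wordB_joins ?mul0r ?last_tr ?head_tr //.
  by rewrite (joins_tr _ p_k (head_tr _ q0)) eq_sym.
- under eq_csum => V D _ do rewrite /right_part csum_mull.
  rewrite -(csumA (fun V P Q' => T V * (T P * B Q'))) csum_cat csum0 ?add0r => [|X Y _]; last first.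
    by apply: csum0 => U V _; rewrite wordB_bar !mulr0.
  rewrite csum_tr (sum_rev0 (F := fun k => csum (fun V P => T V * (T P * B (tr (iter k succ b) (q - k))))
     (R ++ None :: tr b k))); last first.
    apply: csum0 => U V; case/lastP: V => [|V x]; first by rewrite weight_nil mul0r mulr0.
    rewrite cats1 -rcons_cat => /rcons_inj[_ ->].
    by rewrite weight_rcons_bar mul0r mulr0.
  apply: eq_bigr => k _; have kq := ltn_ord k.
  have q_k : (0 < q - k)%N by rewrite subn_gt0.
  have wb' : well_formed (tr b (q - k)) by apply: well_formed_tr_prefix wb; rewrite q_k leq_subr.
  have -> : (q - (q - k) = k)%N by lia.
  (* Again the cut formula backwards, for the start of the last word followed by [R]. *)
  transitivity (T (tr b (q - k) ++ R) * B (tr (iter (q - k) succ b) k)).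
    rewrite (weight_cut hm wb' wR) csum_mulr.
    by apply: eq_csum => U V _; rewrite mulrA.
  rewrite /term; have -> : (iter k succ a == iter q succ b) = (a == iter (q - k) succ b).
    have -> : iter q succ b = iter k succ (iter (q - k) succ b) by rewrite -iterD subnKC // ltnW.
    by rewrite (inj_eq (@iter_succ_inj k)).
  rewrite /R; case: eqP => [e|/eqP ne].
    by rewrite -e catA {1}e -trD weightC; congr (_ * T (map _ (traject _ _ _) ++ _)); lia.
  rewrite weight_joins ?mul0r ?last_tr ?head_cat_tr //.
  by rewrite (joins_tr _ q_k (head_cat_tr _ _ p0)).
Qed.

End Alignment.

Lemma split_first_bar S :
  (exists w, S = map Some w) \/ (exists w S', S = map Some w ++ None :: S').
Proof.
elim: S => [|[a|] S IHS]; first by left; exists [::].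
  by case: IHS => [[w ->]|[w [S' ->]]]; [left; exists (a :: w) | right; exists (a :: w), S'].
by right; exists [::], S.
Qed.

Lemma split_last_bar S :
  (exists w, S = map Some w) \/ (exists S' w, S = S' ++ None :: map Some w).
Proof.
have [[w eS]|[w [S' eS]]] := split_first_bar (rev S).
  by left; exists (rev w); rewrite map_rev -eS revK.
by right; exists (rev S'), (rev w); rewrite map_rev -[LHS]revK eS rev_cat rev_cons cat_rcons.
Qed.

Lemma well_formed_word w : well_formed (map Some w) = is_word w.
Proof.
rewrite /well_formed /good /is_word sorted_map all_map.
by case: w => // a w; rewrite /= last_map andbT.
Qed.

Lemma word_traject w : is_word w -> exists a n, (0 < n)%N /\ w = traject succ a n.
Proof.
case: w => [|a w] /and3P[// _ _ /= aw]; exists a, (size w).+1; split=> //.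
rewrite trajectS; congr cons.
by elim: w a aw => //= b w IHw a /andP[/eqP-> /IHw {1}->].
Qed.

Lemma letters_prefix P Y w : P ++ Y = map Some w -> exists u, P = map Some u.
Proof. by move=> e; exists (take (size P) w); rewrite map_take -e take_size_cat. Qed.

Lemma letters_suffix P Y w : P ++ Y = map Some w -> exists u, Y = map Some u.
Proof. by move=> e; exists (drop (size P) w); rewrite map_drop -e drop_size_cat. Qed.

(** With at most one bar every term contains the weight of a string of letters, which is 0. With two
    bars the first and the last word are distinct inputs around a middle [Q], and both sides are the
    sum over alignments. *)
Lemma outer_eq S : well_formed S -> outer_left S = outer_right S.
Proof.
have T0l u (x : Ct) : T (map Some u) * x = 0 by rewrite weight_letters mul0r.
have left0 u (x : Ct) : x * left_part (map Some u) = 0 by rewrite left_letters mulr0.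
have right0 u (x : Ct) : x * right_part (map Some u) = 0 by rewrite right_letters mulr0.
have [[w -> _]|[u [S' eS]]] := split_first_bar S.
  rewrite /outer_left /outer_right !bsum_letters !csum0 // => P Y /letters_prefix[u ->].
    by rewrite T0l.
  by rewrite left0.
rewrite {}eS; have [[v ->] _|[Q [v ->]] wS] := split_last_bar S'.
  rewrite /outer_left /outer_right !bsum_letters_bar !bsum_letters.
  rewrite /central_part !weight_letters right_letters left_letters !mulr0 !mul0r !if_same !addr0 !add0r.
  rewrite !csum_cat !csum0 ?addr0 // => P Y.
  - by case/letters_suffix => w ->; rewrite right0.
  - by case/letters_prefix => w ->; rewrite T0l.
  - by case/letters_suffix => w ->; rewrite T0l.
  - by case/letters_prefix => w ->; rewrite left0.
have [wu wQv] := well_formed_barP wS; have [_ wv] := well_formed_barP wQv.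
move: wu wv; rewrite !well_formed_word => /word_traject[a [p [p0 eu]]] /word_traject[b [q [q0 ev]]].
by move: wS; rewrite eu ev => wS; rewrite outer_left_alignment // outer_right_alignment.
Qed.

(** The A-infinity relation on pure inputs. The terms of the first sum are inner multiplication,
    outer multiplication with the higher operation on the right or left, and inner right and left
    extensions preceded or followed by further inputs; the last two sums are the extensions starting
    at the first or ending at the last input. *)
Lemma string_relation S : well_formed S ->
  bsum (fun X Y => (if joins X Y then string_mu (X ++ Y) else 0)
     + B X * string_mu Y + string_mu X * B Y
     + csum (fun V D => T V * string_mu (X ++ None :: D)) Y
     + csum (fun P V => T V * string_mu (P ++ None :: Y)) X) S
  + csum (fun V D => T V * string_mu D) S
  + csum (fun P V => T V * string_mu P) S = 0.
Proof.
move=> wS.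
(* [jb] and [jt] occur only on the right, twice each: one copy completes [string_left] or
   [string_right], the other goes to the outer terms. *)
have shuffle (jc jl jr bc bl br cb lb rb s1c s1l s1r s2c s2l s2r jb jt : Ct) :
    (jc + jl + jr) + (bc + bl + br) + (cb + lb + rb) + (s1c + s1l + s1r) + (s2c + s2l + s2r)
  = (jc + s1c + s2c) + (jl + jb + bl + s1l + s2l) + (jr + jt + rb + s1r + s2r)
    + (jb + bc + br) + (jt + cb + lb).
  rewrite [RHS](AC (3*5*5*3*3) ((1*4*9)*(15*6*16)*(18*19*11)*(2*7*12)*(3*8*13)*(5*14)*(10*17))) /=.
  by rewrite (char2C jb) (char2C jt) !addr0.
have expand X Y : X ++ None :: Y = S ->
    (if joins X Y then string_mu (X ++ Y) else 0)
     + B X * string_mu Y + string_mu X * B Y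
     + csum (fun V D => T V * string_mu (X ++ None :: D)) Y
     + csum (fun P V => T V * string_mu (P ++ None :: Y)) X =
    0 + ((if joins X Y then left_part (X ++ Y) + B X * T Y else 0)
    + B X * left_part Y
    + csum (fun V D => T V * left_part (X ++ None :: D)) Y
    + csum (fun P V => T V * left_part (P ++ None :: Y)) X) +
    ((if joins X Y then right_part (X ++ Y) + T X * B Y else 0)
    + right_part X * B Y
    + csum (fun V D => T V * right_part (X ++ None :: D)) Y
    + csum (fun P V => T V * right_part (P ++ None :: Y)) X) +
    ((if joins X Y then B X * T Y else 0)
    + B X * central_part Y + B X * right_part Y) +
    ((if joins X Y then T X * B Y else 0)
    + central_part X * B Y + left_part X * B Y).
  move=> eS; have [wX wY] : well_formed X /\ well_formed Y.
    by apply: well_formed_barP; rewrite eS.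
  have central0 : (if joins X Y then central_part (X ++ Y) else 0) +
     csum (fun V D => T V * central_part (X ++ None :: D)) Y +
     csum (fun P V => T V * central_part (P ++ None :: Y)) X = 0.
    have srcX Z : source (X ++ Z) = source X by case: (X) wX.
    have e1 : (if joins X Y then central_part (X ++ Y) else 0) = source X * T (X ++ Y).
      case: ifPn => [_|nj]; first by rewrite /central_part srcX.
      by rewrite (weight_joins (well_formed_last wX) (well_formed_head wY)) ?mulr0.
    have e2 : csum (fun V D => T V * central_part (X ++ None :: D)) Y =
        source X * csum (fun V D => T V * T (X ++ None :: D)) Y.
      rewrite csum_mull; apply: eq_csum => V D _.
      by rewrite /central_part srcX !mulrA weightC.
    have e3 : csum (fun P V => T V * central_part (P ++ None :: Y)) X =
        source X * csum (fun P V => T V * T (P ++ None :: Y)) X.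
      rewrite csum_mull; apply: eq_csum => P V eP.
      case: P eP => [|x P] eP; first by rewrite /central_part weight_bar !mulr0.
      by rewrite /central_part !mulrA weightC -eP.
    by rewrite e1 e2 e3 -!mulrDr weight_cut_edges // -addrA char2C mulr0.
  rewrite -[X in _ = X + _ + _ + _ + _]central0.
  have eif : (if joins X Y then string_mu (X ++ Y) else 0) =
      (if joins X Y then central_part (X ++ Y) else 0) +
      (if joins X Y then left_part (X ++ Y) else 0) +
      (if joins X Y then right_part (X ++ Y) else 0).
    by case: ifP => // _; rewrite !addr0.
  have eifl : (if joins X Y then left_part (X ++ Y) + B X * T Y else 0) =
      (if joins X Y then left_part (X ++ Y) else 0) + (if joins X Y then B X * T Y else 0).
    by case: ifP => // _; rewrite !addr0.
  have eifr : (if joins X Y then right_part (X ++ Y) + T X * B Y else 0) =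
      (if joins X Y then right_part (X ++ Y) else 0) + (if joins X Y then T X * B Y else 0).
    by case: ifP => // _; rewrite !addr0.
  have dist F Z : csum (fun V D => T V * string_mu (F V D)) Z =
      csum (fun V D => T V * central_part (F V D)) Z +
      csum (fun V D => T V * left_part (F V D)) Z +
      csum (fun V D => T V * right_part (F V D)) Z.
    by rewrite -!csumD; apply: eq_csum => V D _; rewrite !mulrDr.
  have dist' F Z : csum (fun P V => T V * string_mu (F P V)) Z =
      csum (fun P V => T V * central_part (F P V)) Z +
      csum (fun P V => T V * left_part (F P V)) Z +
      csum (fun P V => T V * right_part (F P V)) Z.
    by rewrite -!csumD; apply: eq_csum => V D _; rewrite !mulrDr.
  rewrite eif eifl eifr (dist (fun V D => X ++ None :: D)) (dist' (fun P V => P ++ None :: Y)).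
  rewrite !mulrDr !mulrDl; exact: shuffle.
have dist Z : csum (fun V D => T V * string_mu D) Z =
    csum (fun V D => T V * central_part D) Z + csum (fun V D => T V * left_part D) Z +
    csum (fun V D => T V * right_part D) Z.
  by rewrite -!csumD; apply: eq_csum => V D _; rewrite !mulrDr.
have dist' Z : csum (fun P V => T V * string_mu P) Z =
    csum (fun P V => T V * central_part P) Z + csum (fun P V => T V * left_part P) Z +
    csum (fun P V => T V * right_part P) Z.
  by rewrite -!csumD; apply: eq_csum => V D _; rewrite !mulrDr.
(* If both pieces are boundary words, the last arrow of the first one continues into the first arrow
   of the second one, so their roots carry the same idempotent. *)
have ec : csum (fun V D => T V * central_part D) S = csum (fun P V => T V * central_part P) S.
  apply: eq_csum => X Y eS; rewrite /central_part.
  have [->|nX] := eqVneq (T X) 0; first by rewrite mul0r !mulr0.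
  have [->|nY] := eqVneq (T Y) 0; first by rewrite mul0r !mulr0.
  suff -> : source Y = source X.
    by rewrite -!(weightC _ (source X)) !mulrA; congr (_ * _); exact: weightC.
  have [e [oe [X1 eX1] [X2 eX2]]] := weight_ends nX; have [f [of_ [Y1 eY1] _]] := weight_ends nY.
  move: wS; rewrite -eS eX2 eY1 cat_rcons => /and3P[/andP[_ /sorted_adj/=/eqP->] _ _].
  have -> : source (rcons X2 (Some (lab m (prv m e)))) = source X by rewrite eX2.
  by rewrite eX1 /source /= tgt_succ tgt_lab ?end_ok_prv // prvK // src_lab.
(* Both sides sum over the cuts into three pieces, with weights of the outer pieces and the word of
   the middle one. The two sums that remain belong to [outer_left] and [outer_right]. *)
have elr : csum (fun V D => T V * left_part D) S = csum (fun P V => T V * right_part P) S.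
  under [RHS]eq_csum => P V _ do rewrite /right_part csum_mull.
  rewrite csumA; apply: eq_csum => U Y _; rewrite /left_sum csum_mull.
  by apply: eq_csum => P V _; rewrite [RHS]weightC mulrA.
have eo : outer_left S + outer_right S = 0 by rewrite outer_eq // char2C.
rewrite (eq_bsum expand) [bsum _ S]bsumD [bsum _ S]bsumD [bsum _ S]bsumD [bsum _ S]bsumD.
rewrite string_left // string_right // [bsum _ S]bsum0 // !add0r dist dist' ec elr.
rewrite [LHS](AC (2*3*3) ((1*7)*(2*5)*(3*6)*(4*8))) /= -/(outer_left S) -/(outer_right S).
by rewrite eo !char2C.
Qed.

End Strings.

(** * The operations on basis elements *)

Section Join.
Implicit Types (u v w : seq arrow) (us vs : seq (seq arrow)).
Local Notation string := (seq (option arrow)).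

Definition join us : string :=
  if us is u :: us' then map Some u ++ flatten [seq None :: map Some v | v <- us'] else [::].

Lemma join_cons u us : us != [::] -> join (u :: us) = map Some u ++ None :: join us.
Proof. by case: us. Qed.

Lemma join_cat us vs : us != [::] -> vs != [::] -> join (us ++ vs) = join us ++ None :: join vs.
Proof.
elim: us => // u [|u' us] IHus _ nvs; first by rewrite cat1s join_cons //= cats0.
by rewrite cat_cons join_cons // IHus // [join [:: u, u' & us]]join_cons // -catA.
Qed.

Lemma join_rcons us v : us != [::] -> join (rcons us v) = join us ++ None :: map Some v.
Proof. by move=> nus; rewrite -cats1 join_cat //= cats0. Qed.

Lemma split_leaves_letters w S : split_leaves (map Some w ++ S) =
  (w ++ head [::] (split_leaves S)) :: behead (split_leaves S).
Proof.
elim: w => [|a w IHw] /=; last by rewrite IHw.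
by case: S => [|[a|] S].
Qed.

Lemma split_leaves_join us : us != [::] -> split_leaves (join us) = us.
Proof.
elim: us => // u [|u' us] IHus _.
  by rewrite /= cats0 -[map Some u]cats0 split_leaves_letters /= cats0.
by rewrite join_cons // split_leaves_letters [split_leaves _]/= IHus //= cats0.
Qed.

Lemma split_leaves_neq_nil S : split_leaves S != [::].
Proof. by case: S => [|[]]. Qed.

Lemma join_split_leaves S : join (split_leaves S) = S.
Proof.
elim: S => [|[a|] S IHS] //=; rewrite -[in RHS]IHS; move: (split_leaves_neq_nil S).
  by case: (split_leaves S).
by case: (split_leaves S).
Qed.

Lemma count_join us : (0 < size us)%N -> (count_mem None (join us)).+1 = size us.
Proof.
have cm u : count_mem None (map Some u) = 0%N by elim: u.
elim: us => // u [|u' us] IHus _; first by rewrite /= cats0 cm.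
by rewrite join_cons // count_cat cm -[size (_ :: _ :: _)]/((size (u' :: us)).+1) -(IHus isT).
Qed.

End Join.

Section Basis.
Variables (m : nat) (hm : (3 <= m)%N).
Local Notation C := (bordered m hm).
Local Notation Ct := {poly C}.
Local Notation K := (rpath m (zero_rel m)).
Local Notation T := (weight hm).
Local Notation B := (wordB hm).
Local Notation pathw := (pathw hm).
Local Notation is_word := (is_word m).
Local Notation well_formed := (well_formed m).
Local Notation left_part := (left_sum T B).
Local Notation string_mu := (string_mu hm).
Implicit Types (u v w : seq arrow) (us vs : seq (seq arrow)).

Definition kword (k : K) : seq arrow := (val k).2.

Lemma kword_word k : nonconstant k -> is_word (kword k).
Proof.
rewrite /nonconstant /kword => nk; have := valP k; rewrite [val k]surjective_pairing.
by rewrite is_rpath_word // => /andP[].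
Qed.

Lemma bas_pathw k : nonconstant k -> bas hm k = pathw (kword k).
Proof.
rewrite /nonconstant /kword /pathw => nk; have := valP k; rewrite [val k]surjective_pairing.
rewrite is_rpath_word // => /andP[/eqP -> _].
by rewrite -surjective_pairing cls_val.
Qed.

Lemma word_kword w : is_word w -> exists2 k : K, nonconstant k & kword k = w.
Proof.
move=> iw; have nw : w != [::] by case/and3P: iw.
have /(clsP hm)[k ek _] : is_rpath m (zero_rel m) (src m (head aU1 w), w).
  by rewrite is_rpath_word // eqxx.
by exists k; rewrite /nonconstant /kword ek.
Qed.

Lemma pathw_inj u w : is_word u -> w != [::] -> pathw w = pathw u -> w = u.
Proof.
case/word_kword=> k nk <- nw; rewrite -bas_pathw // => /cls_bas.
by rewrite /kword => <-.
Qed.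

Lemma prod_arr w : w != [::] -> \prod_(a <- w) arr hm (zero_rel m) a = pathw w.
Proof.
elim: w => // a [|b w] IHw _; first by rewrite big_seq1.
by rewrite big_cons IHw // -[arr _ _ _]/(pathw [:: a]) pathw_mul.
Qed.

Lemma one_neq_bas k : nonconstant k -> bas hm k <> 1.
Proof.
move=> nk e; have := mul_cls hm (zero_rel m) ((val k).1, [::]) (val k).
rewrite cls_val e mulr1 /= eqxx -surjective_pairing cls_val => /cls_bas ek.
by move: nk; rewrite /nonconstant -ek.
Qed.

Lemma prod_arr_word u w : is_word u ->
  \prod_(a <- w) arr hm (zero_rel m) a = pathw u -> w = u.
Proof.
move=> iu; have [->|nw] := eqVneq w [::]; last by rewrite prod_arr // => /pathw_inj->.
by have [k nk <-] := word_kword iu; rewrite big_nil -bas_pathw // => /esym/one_neq_bas[].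
Qed.

(** [avec] keeps only products, but a nonzero path determines its word, and an empty sector word
    would give 1, which is not pure. *)
Lemma avecP us (G : dtree) : us != [::] -> all is_word us ->
  (avec hm G = map pathw us) <-> (contour G = join us).
Proof.
move=> nus aus; rewrite /avec /sector_words; split=> [|->]; last first.
  rewrite split_leaves_join //; apply/eq_in_map => w /(allP aus) /and3P[nw _ _].
  exact: prod_arr.
move: (split_leaves (contour G)) (join_split_leaves (contour G)) => ws <- e.
congr join; move: e.
elim: us ws aus {nus} => [|u us IHus] [|w ws] //= /andP[iu aus] [/(prod_arr_word iu)-> /IHus->] //.
Qed.

Lemma c0_words us : us != [::] -> all is_word us ->
  c0 (map pathw us) = central_part hm (join us).
Proof.
move=> nus aus; rewrite /c0.
have -> : [set G | tiling_tree m G /\ avec hm G = map pathw us]%classic =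
          [set G | tiling_tree m G /\ contour G = join us]%classic.
  by apply/seteqP; split=> G /= [tG /(avecP _ nus aus)].
rewrite /central_part; have [eT|/weight_neq0[G tG eG]] := eqVneq (T (join us)) 0.
  rewrite eT mulr0; apply: fsbig1 => G /= [tG eG]; move/eqP: eT.
  by rewrite -eG weight_contour // (negPf (Xn_neq0 _ _)).
rewrite -eG weight_contour //.
rewrite (_ : [set _ | _]%classic = [set G]%classic).
  rewrite fsbig_set1 /iota_root /source; have [S ->] := contour_head hm tG.
  by rewrite /= src_lab ?(end_ok_top hm).
apply/seteqP; split=> H /=; last by move->.
by case=> tH e; apply: (contour_inj hm tH tG).
Qed.

Lemma factorizations_word u : is_word u ->
  factorizations (pathw u) =
  [set` [seq (pathw (take k u), pathw (drop k u)) | k <- iota 1 (size u).-1]]%classic.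
Proof.
move=> iu; apply/seteqP; split=> [[x y]|[x y]] /=.
  case=> -[k nk /= ->] [l nl /= ->]; rewrite !bas_pathw //.
  have nk' : kword k != [::] by []. have nl' : kword l != [::] by [].
  rewrite pathw_mul // => /esym/pathw_inj eu; have {}eu : kword k ++ kword l = u.
    by apply: eu => //; case: (kword k) nk'.
  apply/mapP; exists (size (kword k)).
    rewrite mem_iota -eu size_cat; move: nk' nl'.
    by case: (kword k) => // ? ?; case: (kword l) => //= ? ?; lia.
  by rewrite -eu take_size_cat // drop_size_cat.
case/mapP=> k; rewrite mem_iota => /andP[k0 kn] [-> ->].
have ku : (k < size u)%N by lia.
have iu2 : is_word (take k u) && is_word (drop k u).
  move: iu; rewrite /is_word -{2 3}(cat_take_drop k u) all_cat => /and3P[_ /andP[-> ->]].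
  case/cat_sorted2 => -> ->; rewrite !andbT -!size_eq0 size_take size_drop ku /=; lia.
have /andP[/word_kword[k1 n1 e1] /word_kword[k2 n2 e2]] := iu2.
split; first by exists k1; rewrite ?bas_pathw ?e1.
  by exists k2; rewrite ?bas_pathw ?e2.
by case/andP: iu2 => /and3P[nt _ _] /and3P[nd _ _]; rewrite /= pathw_mul // cat_take_drop.
Qed.

Lemma factorizations_sum (F : C * C -> Ct) u : is_word u ->
  \sum_(p \in factorizations (pathw u)) F p =
  \sum_(1 <= k < size u) F (pathw (take k u), pathw (drop k u)).
Proof.
move=> iu; rewrite factorizations_word // -fsbig_seq ?big_map.
  by rewrite /index_iota subn1.
rewrite map_inj_in_uniq ?iota_uniq // => i j; rewrite !mem_iota => ii jj [].
have nt k : (0 < k)%N -> take k u != [::].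
  by case/and3P: iu; case: (u) => //; case: k.
move=> e _; have : take i u = take j u.
  apply: pathw_inj e; last by apply: nt; lia.
  move: iu; rewrite /is_word -{2 3}(cat_take_drop j u) all_cat => /and3P[_ /andP[-> _]].
  by case/cat_sorted2 => -> _; rewrite nt //; lia.
by move/(congr1 size); rewrite !size_take; case: ifP; case: ifP; lia.
Qed.

Lemma is_word_cut k u : is_word u -> (0 < k < size u)%N ->
  is_word (take k u) /\ is_word (drop k u).
Proof.
move=> iu ku; apply/andP; move: iu; rewrite /is_word -{2 3}(cat_take_drop k u) all_cat.
case/and3P=> _ /andP[-> ->] /cat_sorted2[-> ->].
rewrite !andbT -!size_eq0 size_take size_drop; case: ifP => /=; lia.
Qed.

Lemma sum_inner (F : nat -> Ct) n : (0 < n)%N -> F 0%N = 0 -> F n = 0 ->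
  \sum_(k < n.+1) F k = \sum_(1 <= k < n) F k.
Proof.
move=> n0 F0 Fn; rewrite -(big_mkord xpredT F) big_nat_recr //= Fn addr0.
by rewrite big_ltn // F0 add0r.
Qed.

Lemma left_part_join u us : u != [::] ->
  left_part (join (u :: us)) =
  \sum_(1 <= k < size u) B (map Some (take k u)) * T (join (drop k u :: us)).
Proof.
move=> nu; have n0 : (0 < size u)%N by rewrite lt0n size_eq0.
have T0 : T (join ([::] :: us)) = 0 by case: us => [|v us]; rewrite ?weight_nil ?weight_bar.
have -> : left_part (join (u :: us)) =
  csum (fun U V => B U * T (V ++ flatten [seq None :: map Some v | v <- us])) (map Some u).
  rewrite /left_sum /join; case: us {T0} => [|v us].
    by rewrite cats0; apply: eq_csum => U V _; rewrite cats0.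
  by rewrite csum_cat [X in _ + X]csum0 ?addr0 // => P Q _; rewrite wordB_bar mul0r.
rewrite -sum_inner //=; first last.
- by rewrite drop_size T0 mulr0.
- by rewrite take0 wordB_nil mul0r.
by rewrite /csum size_map; apply: eq_bigr => k _; rewrite map_take map_drop.
Qed.

Lemma right_part_join us v : v != [::] ->
  right_part hm (join (rcons us v)) =
  \sum_(1 <= k < size v) T (join (rcons us (take k v))) * B (map Some (drop k v)).
Proof.
move=> nv; have n0 : (0 < size v)%N by rewrite lt0n size_eq0.
have T0 : T (join (rcons us [::])) = 0.
  case: us => [|u us]; first by rewrite weight_nil.
  by rewrite join_rcons // cats1 weight_rcons_bar.
have -> : right_part hm (join (rcons us v)) =
  csum (fun U V => T (join (rcons us (pmap id U))) * B V) (map Some v).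
  have eP P Q : P ++ Q = map Some v -> map Some (pmap id P) = P.
    by case/letters_prefix=> w ->; rewrite pmap_Some.
  rewrite /right_part; case: us {T0} => [|u us].
    by rewrite /= cats0; apply: eq_csum => U V /eP; rewrite cats0 => ->.
  rewrite join_rcons // csum_cat csum0 ?add0r => [|P Q _]; last by rewrite wordB_bar mulr0.
  by apply: eq_csum => U V /eP eU; rewrite join_rcons // eU.
rewrite -sum_inner //=; first last.
- by rewrite drop_size wordB_nil mulr0.
- by rewrite take0 T0 mul0r.
by rewrite /csum size_map; apply: eq_bigr => k _; rewrite -map_take pmap_Some map_drop.
Qed.

(** The path cut off from the last input starts at the vertex of the root and absorbs its
    idempotent; hence extensions carry [T] instead of [central_part]. *)
Lemma central_right S (w : seq arrow) : w != [::] ->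
  (forall a c, last None S = Some a -> c = head aU1 w -> src m c = tgt m a) ->
  central_part hm S * B (map Some w) = T S * B (map Some w).
Proof.
move=> nw Sw; rewrite /central_part; have [->|nS] := eqVneq (T S) 0.
  by rewrite mulr0 !mul0r.
rewrite -(weightC S (source hm S)) -mulrA; congr (_ * _).
have [e [oe [S1 eS1] [S2 eS2]]] := weight_ends nS.
have hw : head None (map Some w) = Some (head aU1 w) by case: (w) nw.
have hS : head None S = Some (lab m e) by rewrite eS1.
rewrite (source_wordB hm hS hw) (Sw (lab m (prv m e)) _ _ (erefl _)); last by rewrite eS2 last_rcons.
by rewrite tgt_lab ?end_ok_prv // prvK // src_lab // eqxx.
Qed.

Lemma central_left (w : seq arrow) S : w != [::] ->
  (forall a c, last None (map Some w) = Some a -> head None S = Some c -> src m c = tgt m a) ->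
  B (map Some w) * central_part hm S = B (map Some w) * T S.
Proof.
move=> nw Sw; rewrite /central_part; have [->|nS] := eqVneq (T S) 0; first by rewrite !mulr0.
have [e [_ [S1 eS1] _]] := weight_ends nS; rewrite mulrA; congr (_ * _).
have lw : last None (map Some w) = Some (last aU1 w) by case: (w) nw => //= a w' _; rewrite last_map.
have hS : head None S = Some (lab m e) by rewrite eS1.
by rewrite (wordB_source hm lw hS) (Sw _ _ lw hS) eqxx.
Qed.

Lemma word_step k u a c : is_word u -> (0 < k < size u)%N ->
  last None (map Some (take k u)) = Some a -> head None (map Some (drop k u)) = Some c ->
  src m c = tgt m a.
Proof.
move=> /and3P[_ _ su] ku; move: su; rewrite -{1}(cat_take_drop k u).
have : drop k u != [::] by case/andP: ku => _ ku; rewrite -size_eq0 size_drop -lt0n subn_gt0.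
have : take k u != [::] by case/andP: ku => k0; case: (u) => // x v _; case: (k) k0.
case/lastP: (take k u) => // P x _; case: (drop k u) => // y Q _.
rewrite map_rcons last_rcons /= => + [<-] [<-]; rewrite cat_rcons.
by elim: P => [|z P IHP] /=; [case/andP => /eqP-> _; rewrite tgt_succ | move/path_sorted].
Qed.

Lemma mu0_pure_words us : us != [::] -> all is_word us ->
  mu0_pure (map pathw us) = string_mu (join us).
Proof.
move=> nus aus; rewrite /mu0_pure c0_words // /string_mu; congr (_ + _ + _).
  case: us nus aus => // u us _ /= /andP[iu aus]; have nu : u != [::] by case/and3P: iu.
  rewrite factorizations_sum // left_part_join //; apply: eq_big_nat => k ku /=.
  have [it id] := is_word_cut iu ku; have nt : take k u != [::] by case/and3P: it.
  rewrite -map_cons c0_words //= ?id // -wordB_map //; apply: central_left => // a c la hc.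
  apply: word_step iu ku la _; move: hc; rewrite /=; case/and3P: id.
  by case: (drop k u).
case/lastP: us nus aus => // us v _; rewrite all_rcons => /andP[iv aus].
have nv : v != [::] by case/and3P: iv.
rewrite map_rcons last_rcons factorizations_sum // right_part_join //.
have -> : take (size (rcons (map pathw us) (pathw v))).-1 (rcons (map pathw us) (pathw v)) = map pathw us.
  by rewrite size_rcons -cats1 take_size_cat.
apply: eq_big_nat => k kv /=.
have [it id] := is_word_cut iv kv; have nd : drop k v != [::] by case/and3P: id.
rewrite -map_rcons c0_words ?all_rcons ?it //; last by case: (us).
rewrite -wordB_map //; apply: central_right => // a c la ->.
apply: word_step iv kv _ _; last by case: (drop k v) nd.
move: la; have nt : take k v != [::] by case/and3P: it.
case: us {aus} => [|u us]; first by rewrite /= cats0.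
by rewrite join_rcons // last_cat /=; case: (take k v) nt.
Qed.

Lemma mu0_basis_words (ks : seq K) : ks != [::] -> all (@nonconstant _) ks ->
  mu0_basis hm ks = string_mu (join (map kword ks)).
Proof.
move=> nks aks; rewrite /mu0_basis aks -mu0_pure_words; first last.
- by rewrite all_map; apply/allP => k /(allP aks); exact: kword_word.
- by case: (ks) nks.
rewrite -map_comp; congr mu0_pure; apply/eq_in_map => k /(allP aks); exact: bas_pathw.
Qed.

End Basis.

(** * Multilinear extension *)

Section Multilinear.
Variables (m : nat) (hm : (3 <= m)%N).
Local Notation C := (bordered m hm).
Local Notation Ct := {poly C}.
Local Notation K := (rpath m (zero_rel m)).
Implicit Types (f : K -> Ct) (F : seq K -> Ct) (x y : Ct) (s : seq Ct).

Lemma F2_cases (c : 'F_2) : c = 0 \/ c = 1.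
Proof. by case: c => -[|[|//]] ?; [left|right]; apply/val_inj. Qed.

Definition ext f (c : C) : Ct := \sum_(w <- msupp (c : {malg 'F_2[K]})) f w.

Lemma extE f (c : C) (d : {fset K}) : (msupp (c : {malg 'F_2[K]}) `<=` d)%fset ->
  ext f c = \sum_(w <- d) if (c : {malg 'F_2[K]})@_w == 0 then 0 else f w.
Proof.
move=> sub; rewrite -(big_fset_incl _ sub) => [|w _ /mcoeff_outdom ->]; last by rewrite eqxx.
rewrite /ext big_seq [RHS]big_seq; apply: eq_bigr => w.
by rewrite -mcoeff_neq0 => /negPf->.
Qed.

(** Characteristic 2 enters: a basis element in both supports is absent from that of the sum and
    counted twice on the right. *)
Lemma extD f (c d : C) : ext f (c + d) = ext f c + ext f d.
Proof.
pose D := (msupp (c : {malg 'F_2[K]}) `|` msupp (d : {malg 'F_2[K]}))%fset.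
rewrite (@extE f (c + d) D) ?(@extE f c D) ?(@extE f d D) ?fsubsetUl ?fsubsetUr ?msuppD_le //.
rewrite -big_split; apply: eq_bigr => w _ /=.
have -> : (c + d : {malg 'F_2[K]})@_w = (c : {malg 'F_2[K]})@_w + (d : {malg 'F_2[K]})@_w.
  exact: mcoeffD.
case: (F2_cases ((c : {malg 'F_2[K]})@_w)) => ->; case: (F2_cases ((d : {malg 'F_2[K]})@_w)) => ->;
  by rewrite ?addr0 ?add0r ?eqxx ?oner_eq0 ?addr0 ?add0r ?char2C.
Qed.

Lemma ext0 f : ext f 0 = 0.
Proof. by have := extD f 0 0; rewrite addr0 => /esym/eqP; rewrite -subr_eq0 addrK => /eqP. Qed.

Lemma ext_bas f w : ext f (bas hm w) = f w.
Proof. by rewrite /ext msuppU oner_eq0 big_seq_fset1. Qed.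

Definition lin f x : Ct := \sum_(k < size x) 'X^k * ext f x`_k.

Lemma linE f x n : (size x <= n)%N -> lin f x = \sum_(k < n) 'X^k * ext f x`_k.
Proof.
move=> sn; rewrite /lin (big_ord_widen n (fun k => 'X^k * ext f x`_k)) // big_mkcond.
apply: eq_bigr => k _; case: ltnP => // /(nth_default 0) ->.
by rewrite ext0 mulr0.
Qed.

Lemma linD f x y : lin f (x + y) = lin f x + lin f y.
Proof.
pose n := maxn (size x) (size y).
rewrite (@linE f x n) ?leq_maxl // (@linE f y n) ?leq_maxr // (@linE f (x + y) n) ?size_polyD //.
by rewrite -big_split; apply: eq_bigr => k _; rewrite coefD extD mulrDr.
Qed.

Lemma linX f k x : lin f ('X^k * x) = 'X^k * lin f x.
Proof.
rewrite (@linE f _ (k + size x)); last first.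
  by apply: leq_trans (size_polyMleq _ _) _; rewrite size_polyXn; lia.
rewrite big_split_ord /= big1 ?add0r => [|i _]; last by rewrite coefXnM ltn_ord ext0 mulr0.
rewrite /lin mulr_sumr; apply: eq_bigr => i _.
by rewrite coefXnM ltnNge leq_addr /= addKn exprD mulrA.
Qed.

Lemma linC f (c : C) : lin f c%:P = ext f c.
Proof.
rewrite (@linE f _ 1) ?size_polyC_leq1 //.
by rewrite big_ord1 coefC eqxx mul1r.
Qed.

Lemma lin_eq_fun f f' x : f =1 f' -> lin f x = lin f' x.
Proof. by move=> ff; apply: eq_bigr => k _; congr (_ * _); apply: eq_bigr => w _. Qed.

Lemma lin_funD f f' x : lin (fun w => f w + f' w) x = lin f x + lin f' x.
Proof.
rewrite /lin -big_split; apply: eq_bigr => k _ /=.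
by rewrite -mulrDr /ext -big_split.
Qed.

Lemma lin_funX f k x : lin (fun w => 'X^k * f w) x = 'X^k * lin f x.
Proof.
rewrite /lin mulr_sumr; apply: eq_bigr => i _; rewrite /ext mulr_sumr !mulr_sumr.
by apply: eq_bigr => w _; rewrite !mulrA -!exprD addnC.
Qed.

Lemma lin_fun0 x : lin (fun=> 0) x = 0.
Proof. by rewrite /lin big1 // => k _; rewrite /ext big1 ?mulr0. Qed.

Lemma lin_id x : lin (fun w => (bas hm w)%:P) x = x.
Proof.
have extC (c : C) : ext (fun w => (bas hm w)%:P) c = c%:P.
  rewrite /ext -(raddf_sum (@polyC C)) [in RHS](basE c); congr _%:P.
  rewrite big_seq [RHS]big_seq; apply: eq_bigr => w; rewrite -mcoeff_neq0.
  by case: (F2_cases ((c : {malg 'F_2[K]})@_w)) => ->; rewrite ?eqxx // scale1r.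
rewrite -[RHS]coefK poly_def; apply: eq_bigr => k _.
by rewrite extC -mul_polyC commr_polyXn.
Qed.

Lemma multilinear_cons F x s :
  multilinear F (x :: s) = lin (fun w => multilinear (fun r => F (w :: r)) s) x.
Proof. by rewrite /=; apply: eq_bigr => k _; rewrite mulr_sumr. Qed.

Lemma eq_multilinear F F' s : (forall ks, size ks = size s -> F ks = F' ks) ->
  multilinear F s = multilinear F' s.
Proof.
elim: s F F' => [|x s IHs] F F' FF; first exact: FF.
rewrite !multilinear_cons; apply: lin_eq_fun => w; apply: IHs => ks e.
by apply: FF; rewrite /= e.
Qed.

Lemma multilinear0 s : multilinear (fun=> 0) s = 0 :> Ct.
Proof.
elim: s => // x s IHs; rewrite multilinear_cons -[RHS](lin_fun0 x).
exact: lin_eq_fun.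
Qed.

Lemma multilinearD F s s' x y :
  multilinear F (s ++ (x + y) :: s') = multilinear F (s ++ x :: s') + multilinear F (s ++ y :: s').
Proof.
elim: s F => [|z s IHs] F; first by rewrite !cat0s !multilinear_cons linD.
by rewrite !cat_cons !multilinear_cons -lin_funD; apply: lin_eq_fun => w; exact: IHs.
Qed.

Lemma multilinearX F s s' k x :
  multilinear F (s ++ 'X^k * x :: s') = 'X^k * multilinear F (s ++ x :: s').
Proof.
elim: s F => [|z s IHs] F; first by rewrite !cat0s !multilinear_cons linX.
by rewrite !cat_cons !multilinear_cons -lin_funX; apply: lin_eq_fun => w; exact: IHs.
Qed.

Lemma multilinear_bas F ks : multilinear F (map (fun k => (bas hm k)%:P) ks) = F ks.
Proof.
elim: ks F => // k ks IHks F; rewrite [map _ _]/= multilinear_cons linC ext_bas.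
exact: IHks.
Qed.

End Multilinear.

(** * Idempotents and degrees of the operations on strings *)

Section StringMu.
Variables (m : nat) (hm : (3 <= m)%N).
Local Notation C := (bordered m hm).
Local Notation Ct := {poly C}.
Local Notation string := (seq (option arrow)).
Local Notation T := (weight hm).
Local Notation B := (wordB hm).
Local Notation well_formed := (well_formed m).
Local Notation source := (source hm).
Local Notation string_mu := (string_mu hm).
Implicit Types (S X Y : string) (x y : Ct).

Definition target S : Ct :=
  if last None S is Some a then (idem hm (zero_rel m) (tgt m a))%:P else 0.

Lemma wordB_target X Y c d : last None X = Some c -> last None Y = Some d ->
  B X * target Y = if tgt m c == tgt m d then B X else 0.
Proof.
move=> lX lY; have := @wordB_source m hm X [:: Some (succ d)] c (succ d) lX erefl.
by rewrite /target lY /source /= tgt_succ.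
Qed.

Lemma source_target S e : head None S = Some (lab m e) -> last None S = Some (lab m (prv m e)) ->
  end_ok m e -> target S = source S.
Proof.
by move=> hS lS oe; rewrite /target lS /source hS tgt_lab ?end_ok_prv // prvK // src_lab.
Qed.

Lemma weight_target S : T S != 0 -> target S = source S.
Proof.
move=> nS; have [e [oe [S1 eS1] [S2 eS2]]] := weight_ends nS.
by apply: (source_target (e := e)); rewrite // ?eS1 // -eS1 eS2 last_rcons.
Qed.

Lemma well_formed_junction X Y a b : well_formed (X ++ Y) ->
  last None X = Some a -> head None Y = Some b -> src m b = tgt m a.
Proof.
case/lastP: X => // X x; case: Y => // y Y /and3P[/andP[_ +] _ _].
rewrite last_rcons /= => + ex ey; rewrite ex ey cat_rcons => /sorted_adj/=/eqP->.
exact: tgt_succ.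
Qed.

Lemma wordB_ends S : B S != 0 -> exists a b, head None S = Some a /\ last None S = Some b.
Proof.
case/wordB_neq0=> -[|a w] -> /and3P[// _ _ _].
by exists a, (last a w); rewrite /= last_map.
Qed.

Lemma weight_sides S : T S != 0 -> exists a b,
  [/\ head None S = Some a, last None S = Some b & src m a = tgt m b].
Proof.
move=> nS; have [e [oe [S1 eS1] [S2 eS2]]] := weight_ends nS.
exists (lab m e), (lab m (prv m e)); split; first by rewrite eS1.
  by rewrite eS2 last_rcons.
by rewrite tgt_lab ?end_ok_prv // prvK // src_lab.
Qed.

Lemma source_catl X Y : head None X != None -> source (X ++ Y) = source X.
Proof. by case: X. Qed.

Lemma target_catr X Y : last None Y != None -> target (X ++ Y) = target Y.
Proof.
by case/lastP: Y => // Y y _; rewrite /target -rcons_cat !last_rcons.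
Qed.

Lemma source_string_mu S : well_formed S -> source S * string_mu S = string_mu S.
Proof.
move=> wS; rewrite /string_mu !mulrDr; congr (_ + _ + _).
- rewrite /central_part mulrA; congr (_ * _).
  rewrite /source; have [a [S' ->]] := well_formed_cons wS => /=.
  by rewrite -polyCM mul_cls /path_end /= eqxx.
- rewrite /left_sum csum_mull; apply: eq_csum => U V eS.
  have [->|nU] := eqVneq (B U) 0; first by rewrite mul0r mulr0.
  have [a [b [hU lU]]] := wordB_ends nU; rewrite mulrA -eS source_catl ?hU //.
  by rewrite (source_wordB hm hU hU) eqxx.
- rewrite /right_part csum_mull; apply: eq_csum => U V eS.
  have [->|nU] := eqVneq (T U) 0; first by rewrite mul0r mulr0.
  have [->|nV] := eqVneq (B V) 0; first by rewrite !mulr0.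
  have [a [b [hU lU eab]]] := weight_sides nU; have [c [d [hV lV]]] := wordB_ends nV.
  rewrite mulrA -weightC -mulrA -eS source_catl ?hU // (source_wordB hm hU hV).
  by rewrite -eS in wS; rewrite (well_formed_junction wS lU hV) eab eqxx.
Qed.

Lemma string_mu_target S : well_formed S -> string_mu S * target S = string_mu S.
Proof.
move=> wS; rewrite /string_mu !mulrDl; congr (_ + _ + _).
- rewrite /central_part; have [->|nS] := eqVneq (T S) 0; first by rewrite mulr0 mul0r.
  rewrite -mulrA weightC mulrA weight_target //; congr (_ * _).
  rewrite /source; have [a [S' ->]] := well_formed_cons wS => /=.
  by rewrite -polyCM mul_cls /path_end /= eqxx.
- rewrite /left_sum csum_mulr; apply: eq_csum => U V eS.
  have [->|nU] := eqVneq (B U) 0; first by rewrite !mul0r.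
  have [->|nV] := eqVneq (T V) 0; first by rewrite mulr0 mul0r.
  have [a [b [hU lU]]] := wordB_ends nU; have [c [d [hV lV ecd]]] := weight_sides nV.
  rewrite -mulrA weightC mulrA -eS target_catr ?lV // (wordB_target lU lV).
  by rewrite -eS in wS; rewrite -ecd (well_formed_junction wS lU hV) eqxx.
- rewrite /right_part csum_mulr; apply: eq_csum => U V eS.
  have [->|nV] := eqVneq (B V) 0; first by rewrite mulr0 mul0r.
  have [a [b [hV lV]]] := wordB_ends nV; rewrite -mulrA -eS target_catr ?lV //.
  by rewrite (wordB_target lV lV) eqxx.
Qed.

(** After rotation the bar is the root: the letter before it ends, and the letter after it starts,
    at the vertex that labels the root edge. *)
Lemma weight_mismatch X Y a b : last None X = Some a -> head None Y = Some b ->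
  src m b != tgt m a -> T (X ++ None :: Y) = 0.
Proof.
move=> lX hY ne; apply/eqP; apply: contraNT ne => nT; rewrite weight_rot in nT.
have [c [d [hYX lYX e]]] := weight_sides nT; move: hYX lYX.
rewrite last_cat /= lX; case: (Y) hY => //= y Y' -> [eb] [ea].
by rewrite eb e ea.
Qed.

Lemma string_mu_mismatch X Y a b : last None X = Some a -> head None Y = Some b ->
  src m b != tgt m a -> string_mu (X ++ None :: Y) = 0.
Proof.
move=> lX hY ne; rewrite /string_mu /central_part (weight_mismatch lX hY ne) mulr0 add0r.
rewrite left_bar; last exact: wordB_bar.
rewrite right_bar !csum0 ?addr0 // => P Q eP.
  case: P eP => [|p P] eP; first by rewrite cats1 weight_rcons_bar mul0r.
  by rewrite (weight_mismatch (b := b) lX _ ne) ?mul0r // -hY -eP.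
case/lastP: Q eP => [|Q x] eP; first by rewrite weight_bar mulr0.
by rewrite (weight_mismatch (a := a) _ hY ne) ?mulr0 // -lX -eP last_cat !last_rcons.
Qed.

(** [n] is a number of bars, as in [leaf_countE]. The bound on k records that trees have a vertex,
    and hence at least three bars. *)
Definition graded n x := forall k, x`_k != 0 -> (0 < k)%N /\ (k * (2 * m - 4)).+1 = n.

Lemma gradedD n x y : graded n x -> graded n y -> graded n (x + y).
Proof.
move=> gx gy k; rewrite coefD; have [->|/gx//] := eqVneq x`_k 0.
by rewrite add0r => /gy.
Qed.

Lemma graded0 n : graded n 0.
Proof. by move=> k; rewrite coef0 eqxx. Qed.

Lemma graded_csum n (F : string -> string -> Ct) S :
  (forall X Y, X ++ Y = S -> graded n (F X Y)) -> graded n (csum F S).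
Proof.
move=> gF; apply: (big_ind (graded n)); [exact: graded0 | exact: gradedD |].
by move=> k _; apply: gF; rewrite cat_take_drop.
Qed.

Lemma graded_weight S : graded (count_mem None S) (T S).
Proof.
have [->|/weight_neq0[G tG <-]] := eqVneq (T S) 0; first exact: graded0.
have cG : compatible m G by case/andP: tG.
rewrite weight_contour // => k; rewrite coefXn; have [-> _|_] := eqVneq k (internal_vertices G); last by rewrite eqxx.
by have := leaf_countE hm cG; rewrite /leaf_count => ->; case: (G) tG.
Qed.

Lemma graded_mull n (c : C) x : graded n x -> graded n (c%:P * x).
Proof. by move=> gx k; rewrite coefCM => nz; apply: gx; apply: contraNneq nz => ->; rewrite mulr0. Qed.

Lemma graded_mulr n (c : C) x : graded n x -> graded n (x * c%:P).
Proof. by move=> gx k; rewrite coefMC => nz; apply: gx; apply: contraNneq nz => ->; rewrite mul0r. Qed.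

Lemma wordB_const S : exists2 c, B S = c%:P & B S != 0 -> count_mem None S = 0%N.
Proof.
have [e|/wordB_neq0[w -> iw]] := eqVneq (B S) 0.
  by exists 0; rewrite ?e ?polyC0.
exists (pathw hm w); first by rewrite wordB_map //; case/and3P: iw.
by move=> _; elim: (w).
Qed.

Lemma graded_string_mu S : graded (count_mem None S) (string_mu S).
Proof.
apply: gradedD; first apply: gradedD.
- rewrite /central_part /source; case: (head None S) => [a|]; last by rewrite mul0r; exact: graded0.
  exact/graded_mull/graded_weight.
- apply: graded_csum => U V <-; have [c eB nB] := wordB_const U.
  have [->|/nB e] := eqVneq (B U) 0; first by rewrite mul0r; exact: graded0.
  by rewrite eB count_cat e; apply/graded_mull/graded_weight.
- apply: graded_csum => U V <-; have [c eB nB] := wordB_const V.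
  have [->|/nB e] := eqVneq (B V) 0; first by rewrite mulr0; exact: graded0.
  by rewrite eB count_cat e addn0; apply/graded_mulr/graded_weight.
Qed.

Lemma string_mu_small S : (count_mem None S < 3)%N -> string_mu S = 0.
Proof.
move=> cS; apply/polyP => k; rewrite coef0; apply/eqP; apply: contraLR cS => nz.
have [k0 <-] := graded_string_mu nz; rewrite -leqNgt.
have : (2 <= k * (2 * m - 4))%N by rewrite -[2%N]mul1n leq_mul //; lia.
by [].
Qed.

End StringMu.

(** * Linearity over the ground ring, unit and degree *)

Section Fields.
Variables (m : nat) (hm : (3 <= m)%N).
Local Notation C := (bordered m hm).
Local Notation Ct := {poly C}.
Local Notation K := (rpath m (zero_rel m)).
Local Notation basis k := ((bas hm k)%:P : Ct).
Local Notation higher := (multilinear (@mu0_basis m hm)).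
Local Notation string_mu := (string_mu hm).
Local Notation well_formed := (well_formed m).
Implicit Types (f : K -> Ct) (F : seq K -> Ct) (x y c : Ct) (s : seq Ct) (k : K) (ks : seq K).

(** Linearity over F_2[t]: the scalars of F_2 are covered by additivity. Such a map is determined by
    its values on the paths, see [tlin_lin]. *)
Definition tlin (phi : Ct -> Ct) : Prop :=
  (forall x y, phi (x + y) = phi x + phi y) /\
  (forall n x, phi ('X^n * x) = 'X^n * phi x).

Lemma tlin0 phi : tlin phi -> phi 0 = 0.
Proof. by case=> D _; apply: (addrI (phi 0)); rewrite -D !addr0. Qed.

Lemma tlin_sum phi (I : Type) (r : seq I) (P : pred I) (E : I -> Ct) : tlin phi ->
  phi (\sum_(i <- r | P i) E i) = \sum_(i <- r | P i) phi (E i).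
Proof. by move=> tp; apply: (big_morph phi); [case: tp | exact: tlin0]. Qed.

Lemma tlin_lin phi x : tlin phi -> phi x = lin (fun k => phi (basis k)) x.
Proof.
move=> tp; rewrite -{1}(lin_id x) /lin tlin_sum //; apply: eq_bigr => i _.
by case: (tp) => _ ->; congr (_ * _); rewrite /ext tlin_sum.
Qed.

Lemma tlin_eq phi psi : tlin phi -> tlin psi ->
  (forall k, phi (basis k) = psi (basis k)) -> phi =1 psi.
Proof. by move=> tp ts e x; rewrite (tlin_lin x tp) (tlin_lin x ts); apply: lin_eq_fun. Qed.

Lemma Xn_comm n x : 'X^n * x = x * 'X^n :> Ct.
Proof. exact/esym/commr_polyXn. Qed.

Lemma tlin_slot F s s' : tlin (fun x => multilinear F (s ++ x :: s')).
Proof. by split=> *; [exact: multilinearD | exact: multilinearX]. Qed.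

Lemma tlin_comp phi psi : tlin phi -> tlin psi -> tlin (phi \o psi).
Proof. by move=> [D1 X1] [D2 X2]; split=> * /=; rewrite ?D2 ?D1 ?X2 ?X1. Qed.

Lemma tlin_mull c : tlin (fun x => c * x).
Proof. by split=> [x y|n x]; [exact: mulrDr | rewrite mulrA -Xn_comm mulrA]. Qed.

Lemma tlin_mulr c : tlin (fun x => x * c).
Proof. by split=> [x y|n x]; [exact: mulrDl | rewrite mulrA]. Qed.

Lemma lin_mulr f x c : lin f x * c = lin (fun k => f k * c) x.
Proof.
rewrite /lin mulr_suml; apply: eq_bigr => i _; rewrite -mulrA; congr (_ * _).
exact: mulr_suml.
Qed.

Lemma multilinear_mull F s (a : C) :
  a%:P * multilinear F s = multilinear (fun ks => a%:P * F ks) s.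
Proof.
elim: s F => // x s IHs F; rewrite !multilinear_cons -(lin_eq_fun x (fun k => IHs (fun r => F (k :: r)))).
have tp : tlin (fun y => a%:P * lin (fun k => multilinear (fun r => F (k :: r)) s) y).
  split=> [y z|n y]; first by rewrite linD mulrDr.
  by rewrite linX mulrA -Xn_comm mulrA.
by rewrite (tlin_lin x tp); apply: lin_eq_fun => k; rewrite linC ext_bas.
Qed.

Definition ground_elt (g : nat -> 'F_2) : C := \sum_(1 <= i < m) g i *: idem hm (zero_rel m) i.

Lemma F2_scale (a : 'F_2) (u : C) : a *: u = if a == 0 then 0 else u.
Proof. by case: (F2_cases a) => ->; rewrite ?eqxx ?scale0r ?oner_eq0 ?scale1r. Qed.

Lemma cls_vertex p : cls hm (zero_rel m) p != 0 -> is_vertex m p.1 && is_vertex m (path_end m p).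
Proof.
move=> nz; have /and3P[vp cp _] : is_rpath m (zero_rel m) p.
  by apply: contraNT nz => /(cls0 hm)->.
by rewrite vp [p]surjective_pairing is_vertex_path_end.
Qed.

Lemma ground_mull g p : ground_elt g * cls hm (zero_rel m) p =
  if g p.1 == 0 then 0 else cls hm (zero_rel m) p.
Proof.
have [->|/cls_vertex/andP[vp _]] := eqVneq (cls hm (zero_rel m) p) 0; first by rewrite mulr0 if_same.
rewrite /ground_elt mulr_suml; apply: etrans (big_vertex hm vp _) _ => [y ny|].
  by rewrite F2_scale; case: ifP => _; rewrite ?mul0r // mul_cls /path_end /= (negPf ny).
by rewrite F2_scale; case: ifP => _; rewrite ?mul0r // mul_cls /path_end /= eqxx -surjective_pairing.
Qed.

Lemma ground_mulr g p : cls hm (zero_rel m) p * ground_elt g =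
  if g (path_end m p) == 0 then 0 else cls hm (zero_rel m) p.
Proof.
have [->|/cls_vertex/andP[_ vp]] := eqVneq (cls hm (zero_rel m) p) 0; first by rewrite mul0r if_same.
rewrite /ground_elt mulr_sumr; apply: etrans (big_vertex hm vp _) _ => [y ny|].
  by rewrite F2_scale; case: ifP => _; rewrite ?mulr0 // mul_cls /= eq_sym (negPf ny).
by rewrite F2_scale; case: ifP => _; rewrite ?mulr0 // mul_cls /= eqxx cats0 -surjective_pairing.
Qed.

Lemma join_well_formed us : us != [::] -> all (is_word m) us -> well_formed (join us).
Proof.
elim: us => // u [|v us] IHus _ /andP[iu aus]; first by rewrite /= cats0 well_formed_word.
by rewrite join_cons // well_formed_bar ?well_formed_word ?IHus.
Qed.

Lemma all_kword ks : all (@nonconstant _) ks -> all (is_word m) (map (@kword m) ks).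
Proof. by rewrite all_map => /allP aks; apply/allP => k /aks; exact: kword_word. Qed.

Lemma kword_src k : nonconstant k -> (val k).1 = src m (head aU1 (kword k)).
Proof.
rewrite /nonconstant /kword => nk; have := valP k; rewrite {1}[val k]surjective_pairing.
by rewrite is_rpath_word // => /andP[/eqP].
Qed.

Lemma kword_tgt k : nonconstant k -> path_end m (val k) = tgt m (last aU1 (kword k)).
Proof.
by rewrite /nonconstant /path_end /kword; case: (val k).2 => //= a w _; rewrite last_map.
Qed.

Lemma mu0_basis_source g k ks : (ground_elt g)%:P * mu0_basis hm (k :: ks) =
  if g (val k).1 == 0 then 0 else mu0_basis hm (k :: ks).
Proof.
have [aks|nks] := boolP (all (@nonconstant _) (k :: ks)); last first.
  by rewrite /mu0_basis (negPf nks) mulr0 if_same.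
rewrite mu0_basis_words //; set S := join _.
have wS : well_formed S by apply: join_well_formed => //; exact: all_kword.
have nk : nonconstant k by case/andP: aks.
rewrite -(source_string_mu hm wS) mulrA.
have -> : source hm S = (idem hm (zero_rel m) (val k).1)%:P.
  by rewrite kword_src // /S /source /=; case: (kword k) nk (kword_word hm nk).
by rewrite -polyCM ground_mull /=; case: ifP => _; rewrite ?polyC0 ?mul0r.
Qed.

Lemma mu0_basis_target g k ks : mu0_basis hm (rcons ks k) * (ground_elt g)%:P =
  if g (path_end m (val k)) == 0 then 0 else mu0_basis hm (rcons ks k).
Proof.
have [aks|nks] := boolP (all (@nonconstant _) (rcons ks k)); last first.
  by rewrite /mu0_basis (negPf nks) mul0r if_same.
rewrite mu0_basis_words //; last by case: (ks).
set S := join _; have wS : well_formed S.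
  by apply: join_well_formed; [case: (ks) | exact: all_kword].
have nk : nonconstant k by move: aks; rewrite all_rcons => /andP[].
rewrite -(string_mu_target hm wS) -mulrA.
have -> : target hm S = (idem hm (zero_rel m) (path_end m (val k)))%:P.
  rewrite kword_tgt // /target; suff -> : last None S = Some (last aU1 (kword k)) by [].
  have lk : last None (map Some (kword k)) = Some (last aU1 (kword k)).
    by case: (kword k) (kword_word hm nk) => //= a w _; rewrite last_map.
  rewrite /S map_rcons; case: (ks) => [|k' ks']; first by rewrite /= cats0.
  by rewrite join_rcons // last_cat /= -lk; case: (kword k) (kword_word hm nk).
by rewrite -polyCM ground_mulr /=; case: ifP => _; rewrite ?polyC0 ?mulr0.
Qed.

Lemma mu0_basis_mismatch ks k k' ks' : path_end m (val k) != (val k').1 ->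
  mu0_basis hm (ks ++ k :: k' :: ks') = 0.
Proof.
move=> ne; have [aks|nks] := boolP (all (@nonconstant _) (ks ++ k :: k' :: ks')); last first.
  by rewrite /mu0_basis (negPf nks).
rewrite mu0_basis_words //; last by case: (ks).
have [nk nk'] : nonconstant k /\ nonconstant k'.
  by move: aks; rewrite all_cat /= => /and4P[].
rewrite -cat_rcons map_cat join_cat //; last by case: (ks).
apply: (@string_mu_mismatch m hm _ _ (last aU1 (kword k)) (head aU1 (kword k'))).
- have lk : last None (map Some (kword k)) = Some (last aU1 (kword k)).
    by case: (kword k) (kword_word hm nk) => //= a w _; rewrite last_map.
  rewrite map_rcons; case: (ks) => [|k1 ks1]; first by rewrite /= cats0.
  by rewrite join_rcons // last_cat /= -lk; case: (kword k) (kword_word hm nk).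
- by rewrite /=; case: (kword k') (kword_word hm nk').
- by rewrite -kword_src // -kword_tgt // eq_sym.
Qed.

Lemma mu0_basis_constant ks k ks' : ~~ nonconstant k -> mu0_basis hm (ks ++ k :: ks') = 0.
Proof. by move=> nk; rewrite /mu0_basis all_cat /= (negPf nk) andbF. Qed.

Lemma mu0_basis_small ks : ks != [::] -> (size ks <= 3)%N -> mu0_basis hm ks = 0.
Proof.
move=> nks sks; have [aks|nk] := boolP (all (@nonconstant _) ks); last first.
  by rewrite /mu0_basis (negPf nk).
rewrite mu0_basis_words // string_mu_small //.
rewrite count_join ?size_map ?lt0n ?size_eq0 //; exact: leq_ltn_trans sks _.
Qed.

Lemma higher_small s : s != [::] -> (size s <= 3)%N -> higher s = 0.
Proof.
move=> ns ss; rewrite -[RHS](multilinear0 s); apply: eq_multilinear => ks es.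
by apply: mu0_basis_small; rewrite -?size_eq0 es ?size_eq0.
Qed.

Lemma basis_ground_mull g k : (ground_elt g)%:P * basis k =
  if g (val k).1 == 0 then 0 else basis k.
Proof. by rewrite -cls_val -polyCM ground_mull; case: ifP => _; rewrite ?polyC0. Qed.

Lemma basis_ground_mulr g k : basis k * (ground_elt g)%:P =
  if g (path_end m (val k)) == 0 then 0 else basis k.
Proof. by rewrite -cls_val -polyCM ground_mulr; case: ifP => _; rewrite ?polyC0. Qed.

Lemma multilinear_cons0 F s : multilinear F (0 :: s) = 0.
Proof. exact: (tlin0 (tlin_slot F [::] s)). Qed.

Lemma multilinear_cons_bas F k s :
  multilinear F (basis k :: s) = multilinear (fun ks => F (k :: ks)) s.
Proof. by rewrite multilinear_cons linC ext_bas. Qed.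

Lemma higher_left g x s :
  higher ((ground_elt g)%:P * x :: s) = (ground_elt g)%:P * higher (x :: s).
Proof.
apply: (@tlin_eq (fun x => higher ((ground_elt g)%:P * x :: s))
                 (fun x => (ground_elt g)%:P * higher (x :: s))).
- exact: (tlin_comp (tlin_slot _ [::] s) (tlin_mull _)).
- exact: (tlin_comp (tlin_mull _) (tlin_slot _ [::] s)).
move=> k; rewrite basis_ground_mull multilinear_cons_bas multilinear_mull.
rewrite [RHS](eq_multilinear (F' := fun ks => if g (val k).1 == 0 then 0 else mu0_basis hm (k :: ks))).
  by case: ifP => _; rewrite ?multilinear_cons0 ?multilinear0 ?multilinear_cons_bas.
by move=> ks _; exact: mu0_basis_source.
Qed.

Lemma multilinear_right g F x s :
  (forall ks k, F (rcons ks k) * (ground_elt g)%:P =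
     if g (path_end m (val k)) == 0 then 0 else F (rcons ks k)) ->
  multilinear F (rcons s (x * (ground_elt g)%:P)) = multilinear F (rcons s x) * (ground_elt g)%:P.
Proof.
elim: s F => [|y s IHs] F HF.
  apply: (@tlin_eq (fun x => multilinear F [:: x * (ground_elt g)%:P])
                   (fun x => multilinear F [:: x] * (ground_elt g)%:P)).
  - exact: (tlin_comp (tlin_slot _ [::] [::]) (tlin_mulr _)).
  - exact: (tlin_comp (tlin_mulr _) (tlin_slot _ [::] [::])).
  move=> k; have E : multilinear F [:: basis k] = F [:: k] by rewrite multilinear_cons_bas.
  by rewrite basis_ground_mulr E (HF [::]); case: ifP => _; rewrite ?multilinear_cons0 ?E.
rewrite !rcons_cons !multilinear_cons lin_mulr; apply: lin_eq_fun => k.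
by apply: IHs => ks k'; rewrite -rcons_cons HF.
Qed.

(** By linearity [x] and [y] may be paths. If they compose, the ground element acts on both by its
    coefficient at the common vertex; otherwise [F] vanishes. *)
Lemma multilinear_balanced g F x y s s' :
  (forall ks k k' ks', path_end m (val k) != (val k').1 -> F (ks ++ k :: k' :: ks') = 0) ->
  multilinear F (s ++ x * (ground_elt g)%:P :: y :: s') =
  multilinear F (s ++ x :: (ground_elt g)%:P * y :: s').
Proof.
elim: s F => [|z s IHs] F HF; last first.
  rewrite !cat_cons !multilinear_cons; apply: lin_eq_fun => k.
  by apply: IHs => ks k1 k2 ks'; exact: (HF (k :: ks)).
rewrite !cat0s.
apply: (@tlin_eq (fun x => multilinear F (x * (ground_elt g)%:P :: y :: s'))
                 (fun x => multilinear F (x :: (ground_elt g)%:P * y :: s'))).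
- exact: (tlin_comp (tlin_slot _ [::] _) (tlin_mulr _)).
- exact: (tlin_slot _ [::] _).
move=> k; apply: (@tlin_eq (fun y => multilinear F (basis k * (ground_elt g)%:P :: y :: s'))
                 (fun y => multilinear F (basis k :: (ground_elt g)%:P * y :: s'))).
- exact: (tlin_slot _ [:: _] _).
- exact: (tlin_comp (tlin_slot _ [:: _] _) (tlin_mull _)).
move=> k'; rewrite basis_ground_mulr basis_ground_mull.
have [e|ne] := eqVneq (path_end m (val k)) (val k').1.
  rewrite -e; case: (g _ == 0); last by [].
  by rewrite multilinear_cons0 multilinear_cons_bas multilinear_cons0.
have E z : multilinear F (basis k :: basis k' :: z) = 0.
  rewrite !multilinear_cons_bas -[RHS](multilinear0 z).
  by apply: eq_multilinear => ks _; exact: (HF [::]).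
have E0 z : multilinear F (0 :: z) = 0 by exact: multilinear_cons0.
have E1 z : multilinear F (basis k :: 0 :: z) = 0.
  by rewrite multilinear_cons_bas multilinear_cons0.
by case: (g _ == 0); case: (g _ == 0); rewrite ?E ?E0 ?E1.
Qed.

Lemma one_idem : 1 = \sum_(1 <= i < m) (idem hm (zero_rel m) i)%:P :> Ct.
Proof. by rewrite -(raddf_sum (@polyC C)). Qed.

Lemma multilinear_idem F i s s' :
  (forall ks k ks', ~~ nonconstant k -> F (ks ++ k :: ks') = 0) ->
  multilinear F (s ++ (idem hm (zero_rel m) i)%:P :: s') = 0.
Proof.
elim: s F => [|x s IHs] F HF.
  rewrite cat0s; have [->|] := eqVneq (idem hm (zero_rel m) i) 0.
    by rewrite polyC0 multilinear_cons0.
  rewrite /idem /cls; case: insubP => [k _ ek|]; last by rewrite eqxx.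
  move=> _; rewrite multilinear_cons_bas -[RHS](multilinear0 s').
  by apply: eq_multilinear => ks _; apply: (HF [::]); rewrite /nonconstant ek.
rewrite cat_cons multilinear_cons -[RHS](lin_fun0 x); apply: lin_eq_fun => k.
by apply: IHs => ks k' ks'; exact: (HF (k :: ks)).
Qed.

Lemma higher_one s : 1 \in s -> higher s = 0.
Proof.
move=> /(nthP 0)[n ns en]; rewrite -(cat_take_drop n s) (drop_nth 0 ns) en one_idem.
rewrite (tlin_sum _ _ _ (tlin_slot _ _ _)) big1 // => i _.
by apply: multilinear_idem => ks k ks'; exact: mu0_basis_constant.
Qed.

Local Notation homogeneous := (@gr_homogeneous m hm).

Lemma homogeneousD (d : int) x y : homogeneous d x -> homogeneous d y -> homogeneous d (x + y).
Proof.
move=> hx hy k; rewrite coefD; have [->|/hx//] := eqVneq x`_k 0.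
by rewrite add0r => /hy.
Qed.

Lemma homogeneous0 d : homogeneous d 0.
Proof. by move=> k; rewrite coef0 eqxx. Qed.

Lemma homogeneous_sum (d : int) (I : eqType) (r : seq I) (E : I -> Ct) :
  (forall i, i \in r -> homogeneous d (E i)) -> homogeneous d (\sum_(i <- r) E i).
Proof.
move=> hE; rewrite big_seq; apply: (big_ind (homogeneous d)) => //.
  exact: homogeneous0.
exact: homogeneousD.
Qed.

Lemma homogeneousX n (d : int) x : homogeneous d x ->
  homogeneous ((n * (2 * m - 4))%N%:Z + d) ('X^n * x).
Proof.
move=> hx k; rewrite coefXnM; case: ltnP => [|nk] ; first by rewrite eqxx.
by move/hx => <-; rewrite -PoszD -mulnDl subnKC.
Qed.

Lemma multilinear_homogeneous (e : int) F s (d : seq int) : size d = size s ->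
  (forall ks, size ks = size s -> homogeneous e (F ks)) ->
  (forall i, (i < size s)%N -> homogeneous d`_i s`_i) ->
  homogeneous (\sum_(i <- d) i + e) (multilinear F s).
Proof.
elim: s d F => [|x s IHs] [|d0 d] // F.
  by move=> _ HF _; rewrite big_nil add0r; exact: HF.
case=> sd HF hs; rewrite multilinear_cons big_cons -addrA /lin.
apply: homogeneous_sum => i _; have [->|nz] := eqVneq x`_i 0.
  by rewrite ext0 mulr0; exact: homogeneous0.
have <- : (i * (2 * m - 4))%N%:Z = d0 := hs 0%N isT i nz.
apply: homogeneousX; apply: homogeneous_sum => k _.
by apply: IHs => // [ks e1|j js]; [apply: HF; rewrite /= e1 | exact: (hs j.+1)].
Qed.

Lemma mu0_basis_homogeneous ks : ks != [::] ->
  homogeneous ((size ks)%:Z - 2) (mu0_basis hm ks).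
Proof.
move=> nks; have [aks|nk] := boolP (all (@nonconstant _) ks); last first.
  by rewrite /mu0_basis (negPf nk); exact: homogeneous0.
rewrite mu0_basis_words // => k /graded_string_mu[_ e].
have := @count_join (map (@kword m) ks); rewrite -e size_map lt0n size_eq0 => /(_ nks) <-.
by move: (k * (2 * m - 4))%N => n; lia.
Qed.

End Fields.

(** * The A-infinity relation *)

Section JoinSums.
Variable V : zmodType.
Local Notation string := (seq (option arrow)).
Implicit Types (F : string -> string -> V) (us : seq (seq arrow)).

(** A cut of the string falls into exactly one word, possibly at an end of it; [P] lists the words
    before that one. *)
Lemma csum_join F us : us != [::] ->
  csum F (join us) =
  csum (fun P I => if I is w :: I'
     then csum (fun u v => F (join (rcons P u)) (join (v :: I'))) w else 0) us.
Proof.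
elim: us F => // w [|w' us] IHus F _.
  rewrite csum_cons csum_nil addr0 /= cats0 csum_map.
  by apply: eq_csum => u v _; rewrite !cats0.
rewrite join_cons // csum_cat csum_cons csum_map; congr (_ + _).
  by apply: eq_csum => u v _ /=; rewrite cats0.
rewrite IHus //; apply: eq_csum => P [|w1 I] _ //; apply: eq_csum => u v _.
by rewrite rcons_cons (join_cons w) //; case: (P).
Qed.

Lemma bsum_join F us : us != [::] ->
  bsum F (join us) = csum (fun X Y => if nilp X || nilp Y then 0 else F (join X) (join Y)) us.
Proof.
elim: us F => // w [|w' us] IHus F _.
  by rewrite csum_cons csum_nil /= cats0 bsum_letters addr0.
rewrite join_cons // bsum_letters_bar IHus // !csum_cons /= !add0r cats0.
by congr (_ + _); apply: eq_csum => X Y _; case: (nilp Y).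
Qed.

End JoinSums.

Section StringMuBars.
Variables (m : nat) (hm : (3 <= m)%N).
Local Notation T := (weight hm).
Local Notation string_mu := (string_mu hm).

Lemma string_mu_nil : string_mu [::] = 0.
Proof. by apply: string_mu_small. Qed.

Lemma string_mu_bar S : string_mu (None :: S) = 0.
Proof.
rewrite /string_mu /central_part weight_bar mulr0 add0r /left_sum /right_part.
rewrite !csum0 ?addr0 // => -[|x X] Y /=.
- by rewrite weight_nil mul0r.
- by case=> -> _; rewrite weight_bar mul0r.
- by rewrite wordB_nil mul0r.
- by case=> -> _; rewrite (wordB_bar hm [::]) mul0r.
Qed.

Lemma string_mu_rcons_bar S : string_mu (rcons S None) = 0.
Proof.
rewrite /string_mu /central_part weight_rcons_bar mulr0 add0r /left_sum /right_part.
rewrite !csum0 ?addr0 // => X Y; case/lastP: Y => [|Y y].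
- by rewrite wordB_nil mulr0.
- by rewrite -rcons_cat => /rcons_inj[_ ->]; rewrite -cats1 wordB_bar mulr0.
- by rewrite weight_nil mulr0.
- by rewrite -rcons_cat => /rcons_inj[_ ->]; rewrite weight_rcons_bar mulr0.
Qed.

Lemma weight_bars X Y : T (X ++ None :: None :: Y) = 0.
Proof. by rewrite weight_rot weight_bar. Qed.

Lemma string_mu_bars X Y : string_mu (X ++ None :: None :: Y) = 0.
Proof.
rewrite /string_mu /central_part weight_bars mulr0 add0r.
rewrite left_bar; last exact: wordB_bar.
rewrite right_bar !csum0 ?addr0 // => [[|x P] Q /=|P Q _].
- by move=> ->; rewrite (wordB_bar hm [::]) mulr0.
- by case=> -> _; rewrite weight_bars mul0r.
- by rewrite weight_bars mulr0.
Qed.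

(** A cut at the end of a word leaves an empty word. Such terms vanish, so sums over all cuts agree
    with sums over factorizations into pure elements. *)
Lemma string_mu_empty us vs : string_mu (join (us ++ [::] :: vs)) = 0.
Proof.
case: us => [|u us].
  by case: vs => [|v vs]; rewrite ?string_mu_nil ?string_mu_bar.
case: vs => [|v vs]; first by rewrite cats1 join_rcons // cats1 string_mu_rcons_bar.
by rewrite join_cat // [join ([::] :: _)]join_cons // cat0s string_mu_bars.
Qed.

End StringMuBars.

Section Relation.
Variables (m : nat) (hm : (3 <= m)%N).
Local Notation C := (bordered m hm).
Local Notation Ct := {poly C}.
Local Notation K := (rpath m (zero_rel m)).
Local Notation T := (weight hm).
Local Notation B := (wordB hm).
Local Notation is_word := (is_word m).
Local Notation string_mu := (string_mu hm).
Local Notation basis k := ((bas hm k)%:P : Ct).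
Local Notation elt w := (B (map Some w)).
Local Notation higher := (multilinear (@mu0_basis m hm)).
Local Notation tlin := (@tlin m hm).
Implicit Types (x y z c : Ct) (s : seq Ct) (k : K) (ks : seq K) (us vs : seq (seq arrow)).

Definition pair_mul s : Ct := if s is [:: x; y] then x * y else 0.

(** Replaces the case distinction on the length by a sum, since the higher part vanishes on two
    inputs. *)
Lemma mu0E s : s != [::] -> mu0 s = pair_mul s + higher s.
Proof.
case: s => [|x [|y [|z s]]] // _; rewrite /mu0 [pair_mul _]/= ?add0r //.
by rewrite higher_small ?addr0.
Qed.

Definition slot_linear (phi : seq Ct -> Ct) : Prop := forall s s', tlin (fun x => phi (s ++ x :: s')).

Lemma tlin_ext phi psi : tlin phi -> phi =1 psi -> tlin psi.
Proof. by case=> D X e; split=> *; rewrite -!e; [exact: D | exact: X]. Qed.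

Lemma tlin_add phi psi : tlin phi -> tlin psi -> tlin (fun x => phi x + psi x).
Proof.
case=> [D X] [D' X']; split=> [x y|n x]; first by rewrite D D' addrACA.
by rewrite X X' mulrDr.
Qed.

Lemma tlin_zero : tlin (fun=> 0).
Proof. by split=> *; rewrite ?addr0 ?mulr0. Qed.

Lemma tlin_csum (A : Type) (F : Ct -> seq A -> seq A -> Ct) S :
  (forall X Y, tlin (fun x => F x X Y)) -> tlin (fun x => csum (F x) S).
Proof.
move=> tF; split=> [x y|n x].
  by rewrite -csumD; apply: eq_csum => X Y _; case: (tF X Y).
by rewrite csum_mull; apply: eq_csum => X Y _; case: (tF X Y).
Qed.

Lemma pair_mul_slot : slot_linear pair_mul.
Proof.
move=> [|u [|v s]] [|w [|z s']]; try exact: tlin_zero.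
- exact: tlin_mulr.
- exact: tlin_mull.
- by case: s => [|? ?]; exact: tlin_zero.
- by case: s => [|? ?]; exact: tlin_zero.
- by case: s => [|? ?]; exact: tlin_zero.
Qed.

Lemma higher_slot : slot_linear higher.
Proof. by move=> s s'; exact: tlin_slot. Qed.

Lemma mu0_slot : slot_linear (@mu0 m hm).
Proof.
move=> s s'; apply: tlin_ext (tlin_add (pair_mul_slot s s') (higher_slot s s')) _ => x.
by rewrite mu0E //; case: (s).
Qed.

(** Empty middle blocks are dropped because the relation has no inner operation without inputs. *)
Definition tsum (G : seq Ct -> seq Ct -> seq Ct -> Ct) s : Ct :=
  csum (fun X Z => csum (fun P I => if nilp I then 0 else G P I Z) X) s.

Definition compose (phi psi : seq Ct -> Ct) s : Ct := tsum (fun P I Z => phi (P ++ psi I :: Z)) s.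

Lemma relationE s :
  \sum_(j < (size s).+1) \sum_(i < j)
      mu0 (take i s ++ mu0 (drop i (take j s)) :: drop j s) = compose (@mu0 m hm) (@mu0 m hm) s.
Proof.
rewrite /compose /tsum {1}/csum; apply: eq_bigr => j _; rewrite /csum.
have js : (j <= size s)%N by rewrite -ltnS.
rewrite size_takel // big_ord_recr.
have nj : nilp (drop j (take j s)) by rewrite /nilp size_drop size_takel // subnn.
rewrite [X in _ = _ + X]ifT // addr0.
apply: eq_bigr => i _; have ij := ltn_ord i.
by rewrite take_takel ?(ltnW ij) // /nilp size_drop size_takel // subn_eq0 leqNgt ij.
Qed.

Lemma eq_tsum G G' s : (forall P I Z, P ++ I ++ Z = s -> I <> [::] -> G P I Z = G' P I Z) ->
  tsum G s = tsum G' s.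
Proof.
move=> GG; apply: eq_csum => X Z eX; apply: eq_csum => P [|x I] eI //=.
by apply: GG => //; rewrite -eX -eI catA.
Qed.

Lemma tsum0 G s : (forall P I Z, P ++ I ++ Z = s -> I <> [::] -> G P I Z = 0) -> tsum G s = 0.
Proof.
move=> G0; apply: csum0 => X Z eX; apply: csum0 => P [|x I] eI //=.
by apply: G0 => //; rewrite -eX -eI catA.
Qed.

Lemma tsumD G G' s : tsum (fun P I Z => G P I Z + G' P I Z) s = tsum G s + tsum G' s.
Proof.
rewrite /tsum -csumD; apply: eq_csum => X Z _; rewrite -csumD; apply: eq_csum => P I _.
by case: (nilp I); rewrite ?addr0.
Qed.

Lemma tsum_cat G s x s' : tsum G (s ++ x :: s') =
  tsum (fun P I Q => G P I (Q ++ x :: s')) s +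
  (csum (fun A B => csum (fun P Q => G P (Q ++ x :: A) B) s) s' +
   tsum (fun P I Z => G (s ++ x :: P) I Z) s').
Proof.
rewrite /tsum csum_cat; congr (_ + _); rewrite -csumD; apply: eq_csum => A B _.
rewrite csum_cat; congr (_ + _); apply: eq_csum => P Q _.
by case: Q.
Qed.

Lemma compose_slot phi psi : slot_linear phi -> slot_linear psi -> slot_linear (compose phi psi).
Proof.
move=> lphi lpsi s s'; apply: tlin_ext (fun x => esym (tsum_cat _ s x s')).
apply: tlin_add; last apply: tlin_add.
- apply: tlin_csum => X Z; apply: tlin_csum => P I; case: (nilp I); first exact: tlin_zero.
  by apply: tlin_ext (lphi (P ++ psi I :: Z) s') _ => x; rewrite -catA cat_cons.
- apply: tlin_csum => A B; apply: tlin_csum => P Q.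
  exact: (tlin_comp (lphi P B) (lpsi Q A)).
- apply: tlin_csum => X Z; apply: tlin_csum => P I; case: (nilp I); first exact: tlin_zero.
  by apply: tlin_ext (lphi s (P ++ psi I :: Z)) _ => x; rewrite -catA cat_cons.
Qed.

Lemma slot_linear_eq0 phi : slot_linear phi ->
  (forall ks, phi (map (fun k => basis k) ks) = 0) -> forall s, phi s = 0.
Proof.
move=> lphi phi0 s; suff H ks : phi (map (fun k => basis k) ks ++ s) = 0 by exact: (H [::]).
elim: s ks => [|x s IHs] ks; first by rewrite cats0.
rewrite (tlin_lin x (lphi _ s)) -[RHS](lin_fun0 x); apply: lin_eq_fun => k.
by rewrite -cat_rcons -map_rcons IHs.
Qed.

Lemma compose_split s :
  compose (@mu0 m hm) (@mu0 m hm) s =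
  compose higher pair_mul s + compose pair_mul higher s + compose higher higher s.
Proof.
have -> : compose (@mu0 m hm) (@mu0 m hm) s = compose higher pair_mul s +
    compose pair_mul higher s + compose higher higher s + compose pair_mul pair_mul s.
  rewrite -!tsumD; apply: eq_tsum => P I Z _ nI.
  have nI' : I != [::] by apply/eqP.
  rewrite mu0E; last by case: (P).
  rewrite mu0E //; case: (pair_mul_slot P Z) => -> _; case: (higher_slot P Z) => -> _.
  by rewrite [LHS](AC (2*2) (3*2*4*1)).
(* This composite is the associator of the multiplication. *)
suff -> : compose pair_mul pair_mul s = 0 by rewrite addr0.
have zero (P Z : seq Ct) : pair_mul (P ++ 0 :: Z) = 0 by exact: (tlin0 (pair_mul_slot P Z)).
have big P I Z : (size P + size I + size Z != 3)%N -> pair_mul (P ++ pair_mul I :: Z) = 0.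
  case: I => [|a [|b [|c I]]]; try by move=> _; exact: zero.
  by case: P => [|p [|q [|r P]]]; case: Z => [|u [|v Z]].
have [es|ns] := eqVneq (size s) 3%N; last first.
  by apply: tsum0 => P I Z e _; apply: big; rewrite -addnA -!size_cat e.
case: s es => [|x [|y [|z [|w s]]]] // _.
rewrite /compose /tsum !csum_cons !csum_nil /= !csum_cons !csum_nil /=.
by rewrite !addr0 !add0r mulrA char2C.
Qed.

(** Both descriptions serve in [compose_constant]: as an idempotent the input kills the higher
    operations, as a ground element it passes between neighbouring inputs. *)
Lemma basis_constant k : ~~ nonconstant k ->
  exists i, basis k = (idem hm (zero_rel m) i)%:P /\ exists g, basis k = (ground_elt hm g)%:P.
Proof.
rewrite negbK => /eqP k0; exists (val k).1.
have ek : bas hm k = idem hm (zero_rel m) (val k).1.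
  by rewrite -cls_val /idem [val k]surjective_pairing k0.
split; first by rewrite ek.
exists (fun i => (i == (val k).1)%:R); congr _%:P; rewrite ek /ground_elt.
have vk : is_vertex m (val k).1 by case/and3P: (valP k).
apply/esym; apply: etrans (big_vertex hm vk _) _ => [y /negPf->|].
  by rewrite scale0r.
by rewrite eqxx scale1r.
Qed.

Lemma higher_zero s s' : higher (s ++ 0 :: s') = 0.
Proof. exact: (tlin0 (higher_slot s s')). Qed.

Lemma pair_mul_zero s s' : pair_mul (s ++ 0 :: s') = 0.
Proof. exact: (tlin0 (pair_mul_slot s s')). Qed.

Section Constant.
Variables (e : Ct) (i : nat) (g : nat -> 'F_2).
Hypothesis ei : e = (idem hm (zero_rel m) i)%:P.
Hypothesis eg : e = (ground_elt hm g)%:P.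

Let higher_e s s' : higher (s ++ e :: s') = 0.
Proof. by rewrite ei multilinear_idem // => ks k ks'; exact: mu0_basis_constant. Qed.

Let higher_in s : e \in s -> higher s = 0.
Proof.
move=> /(nthP 0)[n ns en]; rewrite -(cat_take_drop n s) (drop_nth 0 ns) en.
exact: higher_e.
Qed.

Let compose_hh s s' : compose higher higher (s ++ e :: s') = 0.
Proof.
apply: tsum0 => P I Z eP _; have : e \in P ++ I ++ Z by rewrite eP mem_cat mem_head orbT.
rewrite !mem_cat => /or3P[eP'|eI|eZ].
- by apply: higher_in; rewrite mem_cat eP'.
- by rewrite (higher_in eI) higher_zero.
- by apply: higher_in; rewrite mem_cat inE eZ !orbT.
Qed.

Let compose_hm s s' : compose higher pair_mul (s ++ e :: s') =
  csum (fun A D => csum (fun P Q => higher (P ++ pair_mul (Q ++ e :: A) :: D)) s) s'.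
Proof.
rewrite /compose tsum_cat tsum0 ?add0r => [|P I Z _ _]; last first.
  by rewrite -cat_cons catA higher_e.
by rewrite [X in _ + X]tsum0 ?addr0 // => P I Z _ _; rewrite -catA cat_cons higher_e.
Qed.

Let compose_mh s s' : compose pair_mul higher (s ++ e :: s') =
  tsum (fun P I Q => pair_mul (P ++ higher I :: Q ++ e :: s')) s +
  tsum (fun P I Z => pair_mul ((s ++ e :: P) ++ higher I :: Z)) s'.
Proof.
rewrite /compose tsum_cat; congr (_ + _).
rewrite csum0 ?add0r // => A D _; apply: csum0 => P Q _.
by rewrite higher_e pair_mul_zero.
Qed.

Let pair_mul_big s : (2 < size s)%N -> pair_mul s = 0.
Proof. by case: s => [|x [|y [|z s]]]. Qed.

Let inner_first s a D : csum (fun P Q => higher (P ++ pair_mul (Q ++ [:: e; a]) :: D)) s =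
  higher (s ++ e * a :: D).
Proof.
rewrite csum_last => [//|P Q _ nQ]; rewrite pair_mul_big ?higher_zero // size_cat.
by case: Q nQ => //= q Q _; rewrite addn2.
Qed.

Let inner_last s x D : csum (fun P Q => higher (P ++ pair_mul (Q ++ [:: e]) :: D)) (rcons s x) =
  higher (s ++ x * e :: D).
Proof.
rewrite csum_rcons higher_zero addr0 csum_last => [//|P Q _ nQ].
rewrite pair_mul_big ?higher_zero // size_cat size_rcons addn1.
by case: Q nQ.
Qed.

Let inner_big s A D : (1 < size A)%N ->
  csum (fun P Q => higher (P ++ pair_mul (Q ++ e :: A) :: D)) s = 0.
Proof.
move=> sA; apply: csum0 => P Q _; rewrite pair_mul_big ?higher_zero // size_cat /=.
by rewrite addnS ltnS (leq_trans sA) ?leq_addl.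
Qed.

Let outer_after s s' : s' <> [::] ->
  tsum (fun P I Q => pair_mul (P ++ higher I :: Q ++ e :: s')) s = 0.
Proof.
move=> ns; apply: tsum0 => P I Q _ _; apply: pair_mul_big; rewrite size_cat /= size_cat /=.
by case: s' ns => //= y s' _; lia.
Qed.

Let outer_before s s' : s <> [::] ->
  tsum (fun P I Z => pair_mul ((s ++ e :: P) ++ higher I :: Z)) s' = 0.
Proof.
move=> ns; apply: tsum0 => P I Q _ _; apply: pair_mul_big; rewrite !size_cat /=.
by case: s ns => //= y s _; lia.
Qed.

Let outer_last s : s <> [::] ->
  tsum (fun P I Q => pair_mul (P ++ higher I :: Q ++ [:: e])) s = higher s * e.
Proof.
move=> ns; rewrite /tsum csum_last => [|X Y _ nY].
  rewrite csum_first => [|P I _ nP]; first by case: (s) ns.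
  case: (nilp I) => //; apply: pair_mul_big; rewrite size_cat /=.
  by case: P nP => //= p P _; lia.
apply: csum0 => P I _; case: (nilp I) => //; apply: pair_mul_big; rewrite size_cat /= size_cat.
by case: Y nY => //= p Y _; lia.
Qed.

Let outer_first s : s <> [::] ->
  tsum (fun P I Z => pair_mul (([::] ++ e :: P) ++ higher I :: Z)) s = e * higher s.
Proof.
move=> ns; rewrite /tsum csum_last => [|X Y _ nY].
  rewrite csum_first => [|P I _ nP]; first by case: (s) ns.
  case: (nilp I) => //; apply: pair_mul_big; rewrite !size_cat /=.
  by case: P nP => //= p P _; lia.
apply: csum0 => P I _; case: (nilp I) => //; apply: pair_mul_big; rewrite !size_cat /=.
by case: Y nY => //= p Y _; lia.
Qed.

Let tsum_nil G : tsum G [::] = 0 :> Ct.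
Proof. by rewrite /tsum !csum_nil. Qed.

(** Only terms multiplying [e] by something survive. With inputs on both sides these are the
    products with the two neighbours, equal by balancedness; at an end of the list, one inner and
    one outer product, equal by linearity. *)
Lemma compose_constant s s' :
  compose higher pair_mul (s ++ e :: s') + compose pair_mul higher (s ++ e :: s')
  + compose higher higher (s ++ e :: s') = 0.
Proof.
rewrite compose_hh addr0 compose_hm compose_mh.
have rc t x : rcons t x <> [::] :> seq Ct by case: t.
have inner_tail t y D : csum (fun X Y => csum (fun P Q => higher (P ++ pair_mul (Q ++ e :: y :: X) :: Y)) t) D =
    higher (t ++ e * y :: D).
  rewrite csum_first => [|X Y _ nX]; first exact: inner_first.
  by apply: inner_big; case: X nX.
case: s' => [|y s'].
  rewrite csum_nil; case/lastP: s => [|s x].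
    by rewrite csum_nil !tsum_nil higher_zero !addr0.
  rewrite inner_last outer_before ?outer_last // addr0 cats1 {1}eg.
  rewrite (@multilinear_right m hm g _ x s (fun ks k => mu0_basis_target hm g k ks)) -eg.
  by rewrite char2C.
rewrite csum_cons inner_tail outer_after // add0r; case/lastP: s => [|s x].
  rewrite csum_nil higher_zero add0r outer_first // cat0s {1}eg higher_left -eg.
  by rewrite char2C.
rewrite inner_last outer_before // addr0 cat_rcons {1}eg.
rewrite (@multilinear_balanced m hm g _ x y s s' (fun ks k k' ks' => @mu0_basis_mismatch m hm ks k k' ks')).
by rewrite -eg char2C.
Qed.

End Constant.

Lemma higher_words us : us != [::] -> all is_word us ->
  higher (map (fun w => elt w) us) = string_mu (join us).
Proof.
move=> nus aus.
have [ks [ak eus e]] : exists ks, [/\ all (@nonconstant _) ks, map (@kword m) ks = us &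
    map (fun w => elt w) us = map (fun k => basis k) ks].
  elim: us aus {nus} => [|u us IHus]; first by exists [::].
  case/andP=> /[dup] iu /(word_kword hm)[k nk ek] /IHus[ks [ak eks e]].
  exists (k :: ks); split; rewrite /= ?nk ?ek ?eks // e.
  by rewrite bas_pathw // ek wordB_map //; case/and3P: iu.
by rewrite e multilinear_bas mu0_basis_words ?eus // -size_eq0 -(size_map (@kword m)) eus size_eq0.
Qed.

Lemma higher_subword P u Z : all is_word P -> all is_word Z -> is_word u ->
  higher (map (fun w => elt w) P ++ elt u :: map (fun w => elt w) Z) =
  string_mu (join (P ++ u :: Z)).
Proof.
move=> aP aZ iu; rewrite -higher_words ?map_cat //; first by case: (P).
by rewrite all_cat aP /= iu.
Qed.

Lemma join_merge P u v Z : join (rcons P u) ++ join (v :: Z) = join (P ++ (u ++ v) :: Z).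
Proof.
case: P => [|p P]; first by rewrite /= cats0 map_cat -catA.
by rewrite join_rcons // join_cat //= map_cat -!catA.
Qed.

Lemma join_tail P u Z : join (rcons P u) ++ (if nilp Z then [::] else None :: join Z) =
  join (P ++ u :: Z).
Proof.
case: Z => [|z Z]; first by rewrite cats0 cats1.
by rewrite -join_cat ?cat_rcons //; case: P.
Qed.

Lemma join_front P v Z : (if nilp P then [::] else rcons (join P) None) ++ join (v :: Z) =
  join (P ++ v :: Z).
Proof. by case: P => [|p P] //; rewrite join_cat // cat_rcons. Qed.

Lemma joins_join P u v Z : u != [::] -> v != [::] ->
  joins (join (rcons P u)) (join (v :: Z)) = joins (map Some u) (map Some v).
Proof.
move=> nu nv; rewrite /joins.
have -> : last None (join (rcons P u)) = last None (map Some u).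
  case: P => [|p P]; first by rewrite /= cats0.
  by rewrite join_rcons // last_cat /=; case: (u) nu.
by case: v nv.
Qed.

Lemma joins_word u v : is_word u -> is_word v -> joins (map Some u) (map Some v) -> is_word (u ++ v).
Proof.
move=> /and3P[nu au su] /and3P[nv av sv]; rewrite /joins.
case/lastP: u nu au su => // u a _ au su; case: v nv av sv => // b v _ av sv.
rewrite map_rcons last_rcons /= => /eqP eb; apply/and3P; split.
- by case: (u).
- by rewrite all_cat au.
have bs : (b == succ a) && path (fun a b => b == succ a) b v by rewrite eb eqxx -eb.
by case: u au su => [|c u] //= au su; rewrite cat_path su last_rcons.
Qed.

Section Insert.
Variables (P Z : seq (seq arrow)).
Hypothesis aP : all is_word P.
Hypothesis aZ : all is_word Z.
Let insert x : Ct := higher (map (fun w => elt w) P ++ x :: map (fun w => elt w) Z).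

Let insert_tlin : tlin insert.
Proof. exact: higher_slot. Qed.

Let insertD x y : insert (x + y) = insert x + insert y.
Proof. by case: insert_tlin. Qed.

Let insert_weight x S : insert (x * T S) = T S * insert x.
Proof.
rewrite -weightC; have [->|/weight_neq0[G tG <-]] := eqVneq (T S) 0.
  by rewrite !mul0r (tlin0 insert_tlin).
by rewrite weight_contour //; case: insert_tlin.
Qed.

(** The centered part inserts an idempotent and gives 0. In an extension the weight is central and
    comes out, leaving the cut-off piece of the first word [w] or of the last word [v] as an
    input. *)
Lemma insert_string_mu w I v J : w :: I = rcons J v -> all is_word (w :: I) ->
  insert (string_mu (join (w :: I))) =
  csum (fun u u' => T (join (u' :: I)) * string_mu (join (P ++ u :: Z))) w +
  csum (fun u u' => T (join (rcons J u)) * string_mu (join (P ++ u' :: Z))) v.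
Proof.
move=> eI aI; rewrite /string_mu !insertD.
have iw : is_word w by case/andP: aI.
have iv : is_word v by move: aI; rewrite eI all_rcons => /andP[].
have [nw nv] : w != [::] /\ v != [::] by case/and3P: iw; case/and3P: iv.
have -> : insert (central_part hm (join (w :: I))) = 0.
  rewrite /central_part insert_weight /source; case: (head None _) => [a|].
    by rewrite /insert multilinear_idem ?mulr0 // => ks k ks'; exact: mu0_basis_constant.
  by rewrite (tlin0 insert_tlin) mulr0.
rewrite add0r; congr (_ + _).
  rewrite left_part_join // tlin_sum //.
  rewrite /csum [RHS](sum_inner (F := fun n => T (join (drop n w :: I)) * string_mu (join (P ++ take n w :: Z)))) ?lt0n ?size_eq0 //; last 2 first.
  - by rewrite take0 string_mu_empty mulr0.
  - rewrite drop_size; case: (I) => [|i I']; first by rewrite weight_nil mul0r.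
    by rewrite weight_bar mul0r.
  apply: eq_big_nat => n kw; rewrite insert_weight; congr (_ * _).
  by have [it _] := is_word_cut hm iw kw; exact: higher_subword.
rewrite eI right_part_join // tlin_sum //.
rewrite /csum [RHS](sum_inner (F := fun n => T (join (rcons J (take n v))) * string_mu (join (P ++ drop n v :: Z)))) ?lt0n ?size_eq0 //; last 2 first.
- rewrite take0; case: (J) => [|j J']; first by rewrite weight_nil mul0r.
  by rewrite join_rcons // cats1 weight_rcons_bar mul0r.
- by rewrite drop_size string_mu_empty mulr0.
apply: eq_big_nat => n kw; rewrite weightC insert_weight; congr (_ * _).
by have [_ it] := is_word_cut hm iv kw; exact: higher_subword.
Qed.

End Insert.

Section Words.
Variable us : seq (seq arrow).
Hypothesis nus : us != [::].
Hypothesis aus : all is_word us.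

Let words := map (fun w => elt w) us.

Lemma compose_higher_pair : compose higher pair_mul words =
  bsum (fun X Y => if joins X Y then string_mu (X ++ Y) else 0) (join us).
Proof.
rewrite /compose /tsum /words csum_map; under eq_csum => X Z _ do rewrite csum_map.
rewrite csumA bsum_join // [RHS]csum_shift [X in _ = _ + X]/= addr0; apply: eq_csum => P [|u [|v Z]] eP.
- by rewrite csum_nil.
- rewrite csum_cons csum_nil /= add0r orbT.
  exact: higher_zero.
have : all is_word (P ++ [:: u, v & Z]) by rewrite eP.
rewrite all_cat /= => /and4P[aP iu iv aZ].
have [nu nv] : u != [::] /\ v != [::] by case/and3P: iu; case/and3P: iv.
rewrite !csum_cons /= add0r higher_zero add0r csum_first => [|X Y _ nX]; last first.
  by case: X nX => //= x X _; rewrite higher_zero.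
rewrite orbF (_ : nilp (rcons P u) = false); last by rewrite /nilp size_rcons.
rewrite joins_join // join_merge wordB_mul; last 2 first.
- by case: (u) nu.
- by case: (v) nv.
case: (boolP (joins _ _)) => [j|nj].
  by rewrite -map_cat higher_subword // joins_word.
rewrite wordB_joins ?higher_zero //.
  by case/lastP: (u) nu => // u' a _; rewrite map_rcons last_rcons.
by case: (v) nv.
Qed.

Lemma compose_pair_higher : compose pair_mul higher words =
  bsum (fun X Y => B X * string_mu Y + string_mu X * B Y) (join us).
Proof.
have E (P Z : seq Ct) c : pair_mul (P ++ c :: Z) =
    (if P is [:: x] then if nilp Z then x * c else 0 else 0) +
    (if nilp P then if Z is [:: z] then c * z else 0 else 0).
  by case: P => [|p [|q [|r P]]]; case: Z => [|u [|v Z]]; rewrite /= ?addr0 ?add0r.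
have eh X Y : X ++ Y = us -> X <> [::] -> higher (map (fun w => elt w) X) = string_mu (join X).
  move=> e /eqP nX; apply: higher_words => //; move: aus; rewrite -e all_cat => /andP[].
  by [].
have eh' X Y : X ++ Y = us -> Y <> [::] -> higher (map (fun w => elt w) Y) = string_mu (join Y).
  move=> e /eqP nX; apply: higher_words => //; move: aus; rewrite -e all_cat => /andP[].
  by [].
have B0 u v ws : B (join (u :: v :: ws)) = 0 by rewrite join_cons // wordB_bar.
rewrite bsumD /compose (eq_tsum (fun P I Z _ _ => E P Z (higher I))) tsumD; congr (_ + _).
  rewrite /tsum csum_last => [|X Y _ nY]; last first.
    by apply: csum0 => P I _; case: Y nY => // y Y _; case: P => [|p [|q P]]; case: (nilp I).
  rewrite /words csum_map bsum_join //; apply: eq_csum => X Y e.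
  case: Y e => [|y Y] e; first by rewrite orbT.
  rewrite orbF; case: X e => [|x [|x' X]] e //; last by rewrite /= B0 mul0r.
  by rewrite [nilp _]/= [nilp _]/= (eh' _ _ e) //= cats0.
rewrite /tsum /words csum_map bsum_join //; apply: eq_csum => X Z e.
rewrite csum_first => [|P I _ nP]; last by case: P nP => // p P _; case: (nilp I).
case: X e => [|x X] e //; case: Z e => [|z [|z' Z]] e //; last by rewrite /= B0 mulr0.
by rewrite -(eh _ _ e) //= cats0.
Qed.

Lemma all_is_word3 P I Z : P ++ I ++ Z = us -> [/\ all is_word P, all is_word I & all is_word Z].
Proof. by move=> e; move: aus; rewrite -e !all_cat => /and3P. Qed.

(** For right extensions the words [P] before the inner inputs are fixed: choosing the inner inputs
    and the cut in the last of them is choosing one cut of the string after [P]. An empty [P] gives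
    the sum over cuts of the whole string, a nonempty one ends at a bar. Left extensions are treated
    likewise, with [Z] fixed. *)
Lemma compose_higher_higher : compose higher higher words =
  csum (fun V D => T V * string_mu D) (join us) +
  bsum (fun X Y => csum (fun V D => T V * string_mu (X ++ None :: D)) Y) (join us) +
  (csum (fun P V => T V * string_mu P) (join us) +
  bsum (fun X Y => csum (fun P V => T V * string_mu (P ++ None :: Y)) X) (join us)).
Proof.
have nn : nilp us = false by rewrite /nilp size_eq0 (negPf nus).
pose L P I Z := if I is w :: I' then
  csum (fun u u' => T (join (u' :: I')) * string_mu (join (P ++ u :: Z))) w else 0.
pose R P I Z := if I is w :: I' then
  csum (fun u u' => T (join (rcons (belast w I') u)) * string_mu (join (P ++ u' :: Z))) (last w I') else 0.
have -> : compose higher higher words =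
    csum (fun X Z => csum (fun P I => R P I Z) X) us + csum (fun X Z => csum (fun P I => L P I Z) X) us.
  rewrite /compose /tsum /words csum_map -csumD; apply: eq_csum => X Z eX.
  rewrite csum_map -csumD; apply: eq_csum => P [|w I] eP; first by rewrite addr0.
  have [aP aI aZ] : [/\ all is_word P, all is_word (w :: I) & all is_word Z].
    by apply: all_is_word3; rewrite catA eP eX.
  rewrite [nilp _]/= higher_words // (insert_string_mu aP aZ (lastI w I) aI).
  by rewrite addrC.
congr (_ + _).
  rewrite csumA; transitivity (csum (fun P Y => if nilp Y then 0 else
    csum (fun V D => T V * string_mu ((if nilp P then [::] else rcons (join P) None) ++ D)) (join Y)) us).
    apply: eq_csum => P Y _; case: Y => [|y Y]; first by rewrite csum_nil.
    rewrite [nilp _]/= csum_join // csum_shift addr0; apply: eq_csum => I [|w Z] _ //.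
    case eI : (rcons I w) => [|i I']; first by case: (I) eI.
    rewrite /R -/(rcons _ _); have [-> ->] : I = belast i I' /\ w = last i I'.
      by move: eI; rewrite lastI => /rcons_inj[].
    by apply: eq_csum => u u' _; rewrite join_front.
  rewrite bsum_join // csum_nill addrC nn; congr (_ + _).
  apply: eq_csum => X Y _; case: (nilp X) => //=; case: (nilp Y) => //.
  by apply: eq_csum => V D _; rewrite cat_rcons.
transitivity (csum (fun X Z => if nilp X then 0 else
    csum (fun A V => T V * string_mu (A ++ if nilp Z then [::] else None :: join Z)) (join X)) us).
  apply: eq_csum => X Z _; case: X => [|x X]; first by rewrite csum_nil.
  rewrite [nilp _]/= csum_join //; apply: eq_csum => P [|w I] _ //.
  by apply: eq_csum => u u' _; rewrite join_tail.
rewrite bsum_join // csum_nilr addrC nn; congr (_ + _).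
  by apply: eq_csum => A V _; rewrite cats0.
by apply: eq_csum => X Y _; case: (nilp X) => //=; case: (nilp Y).
Qed.

Lemma compose_words :
  compose higher pair_mul words + compose pair_mul higher words + compose higher higher words = 0.
Proof.
rewrite compose_higher_pair compose_pair_higher compose_higher_higher.
rewrite -[RHS](string_relation hm (join_well_formed nus aus)) !bsumD.
by rewrite [LHS](AC (1*2*(2*2)) (1*2*3*5*7*4*6)).
Qed.

End Words.

Lemma compose_basis ks : ks != [::] ->
  compose higher pair_mul (map (fun k => basis k) ks) +
  compose pair_mul higher (map (fun k => basis k) ks) +
  compose higher higher (map (fun k => basis k) ks) = 0.
Proof.
move=> nks; have [aks|/allPn[k kks nk]] := boolP (all (@nonconstant _) ks).
  have -> : map (fun k => basis k) ks = map (fun w => elt w) (map (@kword m) ks).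
    rewrite -map_comp; apply/eq_in_map => k /(allP aks) nk /=.
    by rewrite bas_pathw // wordB_map //; case/and3P: (kword_word hm nk).
  by apply: compose_words; [case: (ks) nks | exact: all_kword].
have [i [ei [g eg]]] := basis_constant nk.
case/splitPr: kks => ks1 ks2; rewrite map_cat /=.
exact: compose_constant ei eg _ _.
Qed.

Lemma mu0_relation s : compose (@mu0 m hm) (@mu0 m hm) s = 0.
Proof.
apply: slot_linear_eq0 s; first by apply: compose_slot; exact: mu0_slot.
move=> ks; rewrite compose_split; have [->|nks] := eqVneq ks [::]; last exact: compose_basis.
by rewrite /compose /tsum !csum_nil !addr0.
Qed.

End Relation.

Theorem theorem5p2 (m : nat) (hm : (3 <= m)%N) :
  @unital_Ainf {poly bordered m hm}
    (@ground m hm) (@gr_homogeneous m hm) (@mu0 m hm).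
Proof.
split.
- by move=> s s' x y; case: (mu0_slot (hm := hm) s s').
- move=> c x s [g ->]; rewrite -/(ground_elt hm g) !mu0E // higher_left mulrDr.
  by congr (_ + _); case: s => [|y [|z s]]; rewrite /= ?mulr0 ?mulrA.
- move=> c x s [g ->]; rewrite -/(ground_elt hm g) !mu0E; try by case: (s).
  rewrite mulrDl (multilinear_right _ _ (fun ks k => mu0_basis_target hm g k ks)).
  by congr (_ + _); case: s => [|y [|z [|w s]]]; rewrite /= ?mul0r ?mulrA.
- move=> c x y s s' [g ->]; rewrite -/(ground_elt hm g) !mu0E; try by case: (s).
  rewrite (@multilinear_balanced m hm g _ x y s s' (fun ks k k' ks' => @mu0_basis_mismatch m hm ks k k' ks')).
  by congr (_ + _); case: s => [|u [|v [|w s]]]; case: s' => [|w' s']; rewrite /= ?mulrA.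
- move=> s d s0 sd hs; rewrite /mu0; case: eqP => [s2|ns].
    case: s s0 sd hs s2 => [|x [|y [|? ?]]] // _; case: d => [|d [|d' [|? ?]]] // _ hs _.
    have -> : ((size [:: x; y])%:Z - 2 = 0)%R by [].
    rewrite !big_cons big_nil !addr0 => k; rewrite [_`_0]/= [_`_1]/= coefM => nz.
    (* A nonzero coefficient of the product needs a nonzero summand, whose two indices give the
       degrees of the factors. *)
    have /existsP[i nzi] : [exists i : 'I_k.+1, x`_i * y`_(k - i) != 0].
      apply: contraNT nz; rewrite negb_exists => /forallP nz.
      by rewrite big1 // => i _; apply/eqP; rewrite -[_ == _]negbK nz.
    have xi : x`_i != 0 by apply: contraNneq nzi => ->; rewrite mul0r.
    have yi : y`_(k - i) != 0 by apply: contraNneq nzi => ->; rewrite mulr0.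
    rewrite -[d](hs 0%N isT i xi) -[d'](hs 1%N isT _ yi) -PoszD -mulnDl subnKC //.
    by rewrite -ltnS.
  apply: multilinear_homogeneous => // ks e; rewrite -e; apply: mu0_basis_homogeneous.
  by rewrite -size_eq0 e -lt0n.
- by move=> s _; rewrite relationE mu0_relation.
- by move=> a; rewrite /mu0 /= mul1r.
- by move=> a; rewrite /mu0 /= mulr1.
- by move=> s /eqP s2 s1; rewrite /mu0; case: eqP => // _; exact: higher_one.
Qed.
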